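(* Work over the cartesian monoidal category $\mathrm{Set}$ of sets. Let $*_C$ and $\underline{*}_C$ be the terminal objects of the categories of cyclic operads and of non-$\Sigma$ cyclic operads in $\mathrm{Set}$, and let $*_M$ and $\underline{*}_M$ be the terminal objects of the categories of modular operads and of (geometric) non-$\Sigma$ modular operads in $\mathrm{Set}$. Let $\mathrm{Mod}$ and $\underline{\mathrm{Mod}}$ denote the modular envelope functor and the non-$\Sigma$ modular envelope functor. Then $$\mathrm{Mod}( *_C)\cong *_M \quad\text{(isomorphism of modular operads)}$$ and $$\underline{\mathrm{Mod}}(\underline{*}_C)\cong \underline{*}_M \quad\text{(isomorphism of non-}\Sigma\text{ modular operads)}.$$
   Context: Conventions: $\mathbb N=\{0,1,2,\dots\}$. The monoidal category is $(\mathtt M,\otimes,1)=(\mathrm{Set},\times,* )$, with symmetry $\tau$ and initial object $0=\emptyset$. No operadic units and no stability conditions are required. **Cyclically ordered sets.** All cyclic orders are total cyclic orders on finite sets. A total cyclic order on a finite set $C$ may be given by a linear order on $C$, two linear orders representing the same cyclic order iff they differ by a cyclic rotation. The empty set has a unique cyclic order. Isomorphisms are bijections preserving the cyclic order; $\mathrm{Cyc}$ is the category of cyclically ordered finite sets and isomorphisms, $\mathrm{Fin}$ the category of finite sets and bijections. *Merging.* If $C',C''$ are disjoint cyclically ordered sets, $u\in C'$, $v\in C''$, with cyclic orders represented by $a_1<\dots<a_k<u$ and $v<b_1<\dots<b_l$, then $(C'\cup C'')\setminus\{u,v\}$ has the cyclic order represented by $a_1<\dots<a_k<b_1<\dots<b_l$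 ($k=l=0$ allowed). **Multicyclically ordered sets.** A multicyclic order on a finite set $S$ is a disjoint decomposition $\mathsf S=C_1\cup\dots\cup C_b$ of $S$ into $b>0$ possibly empty cyclically ordered sets (the order of listing of the components is immaterial). An isomorphism $\mathsf S'\to\mathsf S''$ is a pair consisting of a bijection $\sigma$ of underlying sets and a bijection $u$ of the sets indexing the components such that $\sigma$ restricts to isomorphisms of cyclically ordered sets $C'_i\to C''_{u(i)}$. $\mathrm{MultCyc}$ is the category of multicyclically ordered sets and their isomorphisms. $\mathrm{Cyc}\subset\mathrm{MultCyc}$ as the objects with $b=1$. - For $\mathsf S',\mathsf S''$ with disjoint underlying sets, $u\in C'_i$, $v\in C''_j$: $\mathsf S'\cup\mathsf S''\setminus\{u,v\}$ has as components all components of $\mathsf S'$ and $\mathsf S''$ other than $C'_i,C''_j$, together with the merged component $(C'_i\cup C''_j)\setminus\{u,v\}$. - For distinct $u\in C_i$, $v\in C_j$ in the same $\mathsf S$: if $i\ne j$, $\mathsf S\setminus\{u,v\}$ is obtained by replacing $C_i,C_j$ by the merged component $(C_i\cup C_j)\setminus\{u,v\}$. If $i=j$, it is obtained by replacing $C_i$ by the two components $I_1,I_2$, the (possibly empty) open intervals of $C_i$ between $u$ and $v$ and between $v$ and $u$, with induced cyclic orders. A pair $(\mathsf S,g)$ with $\mathsf S=C_1\cup\dots\cup C_b$, $g\in\mathbb N$, is *geometric* if $\tfrac12(g-b+1)\in\mathbb N$. **Non-$\Sigma$ modular operads.** A non-$\Sigma$ modular module is a functor $\mathrm{MultCyc}\times\mathbb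 N\to\mathtt M$ ($\mathbb N$ discrete). A non-$\Sigma$ modular operad is a non-$\Sigma$ modular module $\underline P$, $(\mathsf S,g)\mapsto\underline P(\mathsf S;g)$, with compositions $${}_u\circ_v:\underline P(\mathsf S';g')\otimes\underline P(\mathsf S'';g'')\to\underline P(\mathsf S'\cup\mathsf S''\setminus\{u,v\};g'+g'')$$ for disjoint $\mathsf S',\mathsf S''$, $u\in S'$, $v\in S''$, and contractions $$\xi_{uv}=\xi_{vu}:\underline P(\mathsf S;g)\to\underline P(\mathsf S\setminus\{u,v\};g+1)$$ for distinct $u,v\in S$, satisfying: (i) ${}_u\circ_v={}_v\circ_u\,\tau$. (ii) ${}_a\circ_b(\mathrm{id}\otimes{}_c\circ_d)={}_c\circ_d({}_a\circ_b\otimes\mathrm{id})$ on $\underline P(\mathsf S_1;g_1)\otimes\underline P(\mathsf S_2;g_2)\otimes\underline P(\mathsf S_3;g_3)$, for $\mathsf S_1,\mathsf S_2,\mathsf S_3$ mutually disjoint, $a\in S_1$, $b\neq c\in S_2$, $d\in S_3$. (iii) $\xi_{ab}\xi_{cd}=\xi_{cd}\xi_{ab}$ for mutually distinct $a,b,c,d\in S$. (iv) $\xi_{ab}\,{}_c\circ_d=\xi_{cd}\,{}_a\circ_b$ on $\underline P(\mathsf S';g')\otimes\underline P(\mathsf S'';g'')$, for distinct $a,c\in S'$ and distinct $b,d\in S''$. (v) ${}_a\circ_b(\xi_{cd}\otimes\mathrm{id})=\xi_{cd}\,{}_a\circ_b$ on $\underline P(\mathsf S';g')\otimes\underline P(\mathsf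 S'';g'')$, for mutually distinct $a,c,d\in S'$ and $b\in S''$. (vi) $\underline P(\rho|_{S'\setminus\{u\}}\cup\sigma|_{S''\setminus\{v\}})\,{}_u\circ_v={}_{\rho(u)}\circ_{\sigma(v)}(\underline P(\rho)\otimes\underline P(\sigma))$ for isomorphisms $\rho,\sigma$ out of $\mathsf S',\mathsf S''$ with disjoint targets. (vii) $\underline P(\rho|_{S\setminus\{u,v\}})\,\xi_{uv}=\xi_{\rho(u)\rho(v)}\,\underline P(\rho)$ for an isomorphism $\rho$ out of $\mathsf S$. Morphisms are natural transformations commuting with all ${}_u\circ_v$ and $\xi_{uv}$. All non-$\Sigma$ modular operads are assumed *geometric*: $\underline P(\mathsf S;g)\ne0$ implies $(\mathsf S,g)$ geometric. Thus $\underline *_M(\mathsf S;g)$ is a one-point set for every geometric $(\mathsf S,g)$ and $\emptyset$ otherwise. **Non-$\Sigma$ cyclic operads.** These are functors $\underline P:\mathrm{Cyc}\to\mathtt M$ with compositions ${}_u\circ_v:\underline P(C')\otimes\underline P(C'')\to\underline P((C'\cup C'')\setminus\{u,v\})$ (target with the merged cyclic order) for disjoint $C',C''$ and $u\in C'$, $v\in C''$, satisfying the analogs of (i), (ii) and (vi) (no genus, no contractions). $\underline *_C(C)$ is a one-point set for every $C\in\mathrm{Cyc}$ (including $C=\emptyset$). **Modular and cyclic operads.** A modular operad is defined exactly as a non-$\Sigma$ modular operad, with finite sets $S\in\mathrm{Fin}$ in place of multicyclically ordered sets, so it is a functor $P:\mathrm{Fin}\times\mathbb N\to\mathtt M$ with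 operations ${}_u\circ_v$ and $\xi_{uv}$ satisfying (i)–(vii), all unions and complements being those of plain sets, and with no geometricity condition. A cyclic operad is defined exactly as a non-$\Sigma$ cyclic operad with $\mathrm{Fin}$ in place of $\mathrm{Cyc}$. $*_C(S)$ and $*_M(S;g)$ are one-point sets for all $S\in\mathrm{Fin}$, $g\in\mathbb N$. **Modular envelopes.** $\mathrm{Mod}$ is the left adjoint of the forgetful functor $\Box$ from modular to cyclic operads, $(\Box P)(S)=P(S;0)$ with the operations ${}_u\circ_v$. $\underline{\mathrm{Mod}}$ is the left adjoint of the forgetful functor $\underline\Box$ from (geometric) non-$\Sigma$ modular operads to non-$\Sigma$ cyclic operads, $(\underline\Box\,\underline P)(C)=\underline P(C;0)$ for $C\in\mathrm{Cyc}$, with the operations ${}_u\circ_v$. *)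

(* Defs.v *)
From HB Require Import structures.
From mathcomp Require Import all_boot.
From mathcomp Require Import boolp zify.

Set Implicit Arguments.
Unset Strict Implicit.
Unset Printing Implicit Defensive.

Record category := Category {
  ob :> Type;
  hom : ob -> ob -> Type;
  idm : forall X, hom X X;
  cmp : forall X Y Z, hom Y Z -> hom X Y -> hom X Z;
  cmp1m : forall X Y (f : hom X Y), cmp (idm Y) f = f;
  cmpm1 : forall X Y (f : hom X Y), cmp f (idm X) = f;
  cmpA : forall X Y Z W (f : hom X Y) (g : hom Y Z) (h : hom Z W),
    cmp h (cmp g f) = cmp (cmp h g) f }.
Arguments idm {c} X.

Definition isomorphic (C : category) (X Y : C) : Prop :=
  exists (f : hom X Y) (g : hom Y X), cmp g f = idm X /\ cmp f g = idm Y.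

Definition terminal (C : category) (X : C) : Prop :=
  forall Y : C, exists f : hom Y X, forall g : hom Y X, g = f.

Record functor (C D : category) := Functor {
  fob :> C -> D;
  fmap : forall X Y, hom X Y -> hom (fob X) (fob Y);
  fmap1 : forall X, fmap (idm X) = idm (fob X);
  fmapM : forall X Y Z (g : hom Y Z) (f : hom X Y),
    fmap (cmp g f) = cmp (fmap g) (fmap f) }.
Arguments fmap {C D} F {X Y} f : rename.

Record nat_trans (C D : category) (F G : functor C D) := NatTrans {
  ntf :> forall X : C, hom (F X) (G X);
  nt_nat : forall (X Y : C) (f : hom X Y),
    cmp (ntf Y) (fmap F f) = cmp (fmap G f) (ntf X) }.

Definition left_adjoint (C D : category) (F : functor C D) (G : functor D C)
    : Prop :=
  exists Phi : forall (X : C) (Y : D), hom (F X) Y -> hom X (G Y),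
    (forall X Y, bijective (@Phi X Y)) /\
    (forall (X X' : C) (Y Y' : D) (h : hom X' X) (f : hom (F X) Y)
       (k : hom Y Y'),
       Phi X' Y' (cmp k (cmp f (fmap F h))) =
       cmp (fmap G k) (cmp (Phi X Y f) h)).

Definition Sets : category :=
  @Category Type (fun A B => A -> B) (fun _ x => x)
    (fun _ _ _ g f x => g (f x))
    (fun _ _ _ => erefl) (fun _ _ _ => erefl) (fun _ _ _ _ _ _ _ => erefl).

Definition discrete (T : Type) : category.
Proof.
exists T (fun x y => x = y) (fun x => erefl) (fun x y z p q => etrans q p).
- by move=> x y; case: y /.
- by move=> x y; case: y /.
- by move=> x y z w f g h; case: w / h; case: z / g; case: y / f.
Defined.

Definition prod_cat (C D : category) : category.
Proof.
exists (C * D)%type (fun X Y => (hom X.1 Y.1 * hom X.2 Y.2)%type)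
  (fun X => (idm X.1, idm X.2))
  (fun X Y Z g f => (cmp g.1 f.1, cmp g.2 f.2)).
- by move=> X Y [f f'] /=; rewrite !cmp1m.
- by move=> X Y [f f'] /=; rewrite !cmpm1.
- by move=> X Y Z W [f f'] [g g'] [h h'] /=; rewrite !cmpA.
Defined.

Definition full_sub (C : category) (P : C -> Prop) : category :=
  @Category {X : C | P X} (fun X Y => hom (sval X) (sval Y))
    (fun X => idm (sval X)) (fun _ _ _ g f => cmp g f)
    (fun _ _ f => cmp1m f) (fun _ _ f => cmpm1 f)
    (fun _ _ _ _ f g h => cmpA f g h).

Section NatTransComposition.
Variables (C D : category).

Lemma nat_trans_eq (F G : functor C D) (a b : nat_trans F G) :
  (forall X, a X = b X) -> a = b.
Proof.
case: a b => [a Ha] [b Hb] /= E.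
have {}E : a = b by apply: functional_extensionality_dep.
by subst b; rewrite (Prop_irrelevance Ha Hb).
Qed.

Definition nat_id (F : functor C D) : nat_trans F F.
Proof. by exists (fun X => idm (F X)) => X Y f; rewrite cmp1m cmpm1. Defined.

Definition nat_comp (F G H : functor C D) (b : nat_trans G H)
  (a : nat_trans F G) : nat_trans F H.
Proof.
exists (fun X => cmp (b X) (a X)) => X Y f.
by rewrite -cmpA nt_nat cmpA nt_nat cmpA.
Defined.
End NatTransComposition.

Record bij (S T : finType) := Bij {
  bfun :> S -> T;
  bfunP : bijective bfun }.

Lemma bij_eq (S T : finType) (f g : bij S T) : f =1 g -> f = g.
Proof.
case: f g => [f Hf] [g Hg] /= E.
have {}E : f = g by apply: functional_extensionality_dep.
by subst g; rewrite (Prop_irrelevance Hf Hg).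
Qed.

Definition Fin : category.
Proof.
exists finType bij (fun S => @Bij S S id (inv_bij (fun=> erefl)))
  (fun S T U (g : bij T U) (f : bij S T) => @Bij S U (g \o f) (bij_comp (bfunP g) (bfunP f))).
- by move=> *; apply: bij_eq.
- by move=> *; apply: bij_eq.
- by move=> *; apply: bij_eq.
Defined.

Definition del (S : finType) (u v : S) : finType :=
  {x : S | (x != u) && (x != v)}.

(* (S' u S'') \ {u, v} for disjoint S', S''.  Disjoint unions being sum types,
   two sets which are equal as iterated unions and deletions become types in
   bijection along the identity of points.  The axioms of operads therefore
   compare their two sides through any such bijection [phi] (there is exactly
   one). *)
Definition glue (S' S'' : finType) (u : S') (v : S'') : finType :=
  del (inl u : S' + S'')%type (inr v).

Definition sum_swap (A B : Type) (x : A + B) : B + A :=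
  match x with inl a => inr a | inr b => inl b end.

Definition sum_map (A A' B B' : Type) (f : A -> A') (g : B -> B')
    (x : A + B) : A' + B' :=
  match x with inl a => inl (f a) | inr b => inr (g b) end.

(* Points of S1 u (S2 u S3 \ {c, d}) and of (S1 u S2 \ {a, b}) u S3, seen in
   S1 u S2 u S3. *)
Definition orig_r (S1 S2 S3 : finType) (c : S2) (d : S3)
    (x : S1 + glue c d) : (S1 + S2) + S3 :=
  match x with
  | inl s => inl (inl s)
  | inr t => match val t with inl s => inl (inr s) | inr s => inr s end
  end.

Definition orig_l (S1 S2 S3 : finType) (a : S1) (b : S2)
    (x : glue a b + S3) : (S1 + S2) + S3 :=
  match x with inl t => inl (val t) | inr s => inr s end.

(* Points of (S' \ {c, d}) u S'', seen in S' u S''. *)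
Definition orig_d (S' S'' : finType) (c d : S') (x : del c d + S'')
    : S' + S'' :=
  match x with inl t => inl (val t) | inr s => inr s end.

Lemma sum_map_inj (A A' B B' : Type) (f : A -> A') (g : B -> B') :
  injective f -> injective g -> injective (sum_map f g).
Proof. by move=> fI gI [a|b] [a'|b'] //= []; [move/fI-> | move/gI->]. Qed.

Lemma sum_map_bij (A A' B B' : Type) (f : A -> A') (g : B -> B') :
  bijective f -> bijective g -> bijective (sum_map f g).
Proof.
case=> f' fK f'K [g' gK g'K]; exists (sum_map f' g').
- by move=> [a|b] /=; rewrite ?fK ?gK.
- by move=> [a|b] /=; rewrite ?f'K ?g'K.
Qed.

Section DelMap.
Variables (S T : finType) (f : S -> T) (fI : injective f) (u v : S).

Lemma del_map_subproof (x : del u v) :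
  (f (val x) != f u) && (f (val x) != f v).
Proof. by rewrite !(inj_eq fI); apply: (valP x). Qed.

Definition del_map (x : del u v) : del (f u) (f v) :=
  exist _ (f (val x)) (del_map_subproof x).

Lemma del_map_inj : injective del_map.
Proof. by move=> x y /(congr1 val)/fI; apply: val_inj. Qed.

Lemma del_map_bij : bijective f -> bijective del_map.
Proof.
case=> g fK gK.
have gP (y : del (f u) (f v)) : (g (val y) != u) && (g (val y) != v).
  by rewrite -!(inj_eq fI) gK; apply: (valP y).
exists (fun y => exist _ (g (val y)) (gP y)).
- by move=> x; apply: val_inj; rewrite /= fK.
- by move=> y; apply: val_inj; rewrite /= gK.
Qed.
End DelMap.

Definition del_bij (S T : finType) (f : bij S T) (u v : S)
    : bij (del u v) (del (f u) (f v)) :=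
  Bij (del_map_bij (bij_inj (bfunP f)) u v (bfunP f)).

Definition sum_bij (S T S' T' : finType) (f : bij S T) (g : bij S' T')
    : bij (S + S')%type (T + T')%type :=
  Bij (sum_map_bij (bfunP f) (bfunP g)).

Definition glue_bij (S T S' T' : finType) (f : bij S T) (g : bij S' T')
    (u : S) (v : S') : bij (glue u v) (glue (f u) (g v)) :=
  del_bij (sum_bij f g) (inl u) (inr v).

Record cyc_operad := CycOperad {
  cop :> functor Fin Sets;
  ccomp : forall (S' S'' : Fin) (u : S') (v : S''),
    cop S' -> cop S'' -> cop (glue u v);
  ccomp_sym : forall (S' S'' : Fin) (u : S') (v : S'')
      (x : cop S') (y : cop S'') (phi : bij (glue u v) (glue v u)),
    (forall z, val (phi z) = sum_swap (val z)) ->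
    fmap cop phi (ccomp u v x y) = ccomp v u y x;
  ccomp_assoc : forall (S1 S2 S3 : Fin) (a : S1) (b c : S2) (d : S3)
      (b' : glue c d) (c' : glue a b),
    val b' = inl b -> val c' = inr c ->
    forall (x : cop S1) (y : cop S2) (z : cop S3)
      (phi : bij (glue a b') (glue c' d)),
    (forall t, orig_l (val (phi t)) = orig_r (val t)) ->
    fmap cop phi (ccomp a b' x (ccomp c d y z)) =
    ccomp c' d (ccomp a b x y) z;
  ccomp_equiv : forall (S' S'' T' T'' : Fin) (rho : bij S' T')
      (sigma : bij S'' T'') (u : S') (v : S'') (x : cop S') (y : cop S''),
    fmap cop (glue_bij rho sigma u v) (ccomp u v x y) =
    ccomp (rho u) (sigma v) (fmap cop rho x) (fmap cop sigma y) }.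


Record cyc_mor (P Q : cyc_operad) := CycMor {
  cyc_nt :> nat_trans P Q;
  cyc_ntP : forall (S' S'' : Fin) (u : S') (v : S'') (x : P S') (y : P S''),
    cyc_nt (glue u v) (ccomp u v x y) = ccomp u v (cyc_nt S' x) (cyc_nt S'' y) }.

Lemma cyc_mor_eq (P Q : cyc_operad) (f g : cyc_mor P Q) :
  (forall S x, f S x = g S x) -> f = g.
Proof.
case: f g => [f Hf] [g Hg] /= E.
have {}E : f = g.
  by apply: nat_trans_eq => S; apply: functional_extensionality_dep => x.
by subst g; rewrite (Prop_irrelevance Hf Hg).
Qed.

Definition CycOp : category.
Proof.
unshelve refine (@Category cyc_operad cyc_mor _ _ _ _ _).
- by move=> P; exists (nat_id P).
- move=> P Q R g f; exists (nat_comp g f) => S' S'' u v x y /=.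
  by rewrite !cyc_ntP.
- by move=> *; apply: cyc_mor_eq.
- by move=> *; apply: cyc_mor_eq.
- by move=> *; apply: cyc_mor_eq.
Defined.

Definition const_functor (C : category) : functor C Sets :=
  @Functor C Sets (fun=> unit) (fun _ _ _ x => x)
    (fun=> erefl) (fun _ _ _ _ _ => erefl).

Definition star_C : CycOp.
Proof.
exists (const_functor Fin) (fun _ _ _ _ _ _ => tt).
all: by move=> *; do ?case: (fmap _ _).
Defined.

Lemma star_C_terminal : terminal star_C.
Proof.
move=> P; unshelve eexists.
  by unshelve eexists; first by exists (fun _ _ => tt).
by move=> g; apply: cyc_mor_eq => S x; case: (g S x).
Qed.

Notation modular_module := (functor (prod_cat Fin (discrete nat)) Sets).

Definition mod_at (P : modular_module) (S : finType) (g : nat) : Type :=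
  P (S, g).

Definition mod_act (P : modular_module) (S T : finType) (g h : nat)
    (phi : bij S T) (e : g = h) : mod_at P S g -> mod_at P T h :=
  @fmap _ _ P (S, g) (T, h) (phi, e).
Arguments mod_act P {S T g h} phi e _.

Record mod_operad := ModOperad {
  mop :> modular_module;
  mcomp : forall (S' S'' : finType) (g' g'' : nat) (u : S') (v : S''),
    mod_at mop S' g' -> mod_at mop S'' g'' ->
    mod_at mop (glue u v) (g' + g'');
  mctr : forall (S : finType) (g : nat) (u v : S), u != v ->
    mod_at mop S g -> mod_at mop (del u v) g.+1;
  mctr_sym : forall (S : finType) (g : nat) (u v : S)
      (uv : u != v) (vu : v != u) (x : mod_at mop S g)
      (phi : bij (del u v) (del v u)),
    (forall z, val (phi z) = val z) ->
    mod_act mop phi erefl (mctr uv x) = mctr vu x;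
  mcomp_sym : forall (S' S'' : finType) (g' g'' : nat) (u : S') (v : S'')
      (x : mod_at mop S' g') (y : mod_at mop S'' g'')
      (phi : bij (glue u v) (glue v u)),
    (forall z, val (phi z) = sum_swap (val z)) ->
    mod_act mop phi (addnC g' g'') (mcomp u v x y) = mcomp v u y x;
  mcomp_assoc : forall (S1 S2 S3 : finType) (g1 g2 g3 : nat)
      (a : S1) (b c : S2) (d : S3) (b' : glue c d) (c' : glue a b),
    val b' = inl b -> val c' = inr c ->
    forall (x : mod_at mop S1 g1) (y : mod_at mop S2 g2)
      (z : mod_at mop S3 g3) (phi : bij (glue a b') (glue c' d)),
    (forall t, orig_l (val (phi t)) = orig_r (val t)) ->
    mod_act mop phi (addnA g1 g2 g3) (mcomp a b' x (mcomp c d y z)) =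
    mcomp c' d (mcomp a b x y) z;
  mctr_ctr : forall (S : finType) (g : nat) (a b c d : S)
      (a' b' : del c d) (c' d' : del a b),
    val a' = a -> val b' = b -> val c' = c -> val d' = d ->
    forall (ab : a != b) (cd : c != d) (ab' : a' != b') (cd' : c' != d')
      (x : mod_at mop S g) (phi : bij (del a' b') (del c' d')),
    (forall z, val (val (phi z)) = val (val z)) ->
    mod_act mop phi erefl (mctr ab' (mctr cd x)) = mctr cd' (mctr ab x);
  mctr_comp : forall (S' S'' : finType) (g' g'' : nat)
      (a c : S') (b d : S'') (a' b' : glue c d) (c' d' : glue a b),
    val a' = inl a -> val b' = inr b -> val c' = inl c -> val d' = inr d ->
    forall (ab' : a' != b') (cd' : c' != d')
      (x : mod_at mop S' g') (y : mod_at mop S'' g'')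
      (phi : bij (del a' b') (del c' d')),
    (forall z, val (val (phi z)) = val (val z)) ->
    mod_act mop phi erefl (mctr ab' (mcomp c d x y)) =
    mctr cd' (mcomp a b x y);
  mcomp_ctr : forall (S' S'' : finType) (g' g'' : nat)
      (a c d : S') (b : S'') (a' : del c d) (c' d' : glue a b),
    val a' = a -> val c' = inl c -> val d' = inl d ->
    forall (cd : c != d) (cd' : c' != d')
      (x : mod_at mop S' g') (y : mod_at mop S'' g'')
      (phi : bij (glue a' b) (del c' d')),
    (forall z, val (val (phi z)) = orig_d (val z)) ->
    mod_act mop phi (addSn g' g'') (mcomp a' b (mctr cd x) y) =
    mctr cd' (mcomp a b x y);
  mcomp_equiv : forall (S' S'' T' T'' : finType) (g' g'' : nat)
      (rho : bij S' T') (sigma : bij S'' T'') (u : S') (v : S'')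
      (x : mod_at mop S' g') (y : mod_at mop S'' g''),
    mod_act mop (glue_bij rho sigma u v) erefl (mcomp u v x y) =
    mcomp (rho u) (sigma v) (mod_act mop rho erefl x)
      (mod_act mop sigma erefl y);
  mctr_equiv : forall (S T : finType) (g : nat) (rho : bij S T) (u v : S)
      (uv : u != v) (uv' : rho u != rho v) (x : mod_at mop S g),
    mod_act mop (del_bij rho u v) erefl (mctr uv x) =
    mctr uv' (mod_act mop rho erefl x) }.

Record mod_mor (P Q : mod_operad) := ModMor {
  mod_nt :> nat_trans P Q;
  mod_nt_comp : forall (S' S'' : finType) (g' g'' : nat) (u : S') (v : S'')
      (x : mod_at P S' g') (y : mod_at P S'' g''),
    mod_nt (glue u v, g' + g'') (mcomp u v x y) =
    mcomp u v (mod_nt (S', g') x) (mod_nt (S'', g'') y);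
  mod_nt_ctr : forall (S : finType) (g : nat) (u v : S) (uv : u != v)
      (x : mod_at P S g),
    mod_nt (del u v, g.+1) (mctr uv x) = mctr uv (mod_nt (S, g) x) }.

Lemma mod_mor_eq (P Q : mod_operad) (f g : mod_mor P Q) :
  (forall X x, f X x = g X x) -> f = g.
Proof.
case: f g => [f Hf Kf] [g Hg Kg] /= E.
have {}E : f = g.
  by apply: nat_trans_eq => S; apply: functional_extensionality_dep => x.
by subst g; rewrite (Prop_irrelevance Hf Hg) (Prop_irrelevance Kf Kg).
Qed.

Definition ModOp : category.
Proof.
unshelve refine (@Category mod_operad mod_mor _ _ _ _ _).
- by move=> P; exists (nat_id P).
- move=> P Q R g f; exists (nat_comp g f).
  + by move=> S' S'' g' g'' u v x y /=; rewrite !mod_nt_comp.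
  + by move=> S n u v uv x /=; rewrite !mod_nt_ctr.
- by move=> *; apply: mod_mor_eq.
- by move=> *; apply: mod_mor_eq.
- by move=> *; apply: mod_mor_eq.
Defined.

Definition star_M : ModOp.
Proof.
exists (const_functor _) (fun _ _ _ _ _ _ _ _ => tt) (fun _ _ _ _ _ _ => tt).
all: by [].
Defined.

Lemma star_M_terminal : terminal star_M.
Proof.
move=> P; unshelve eexists.
  by unshelve eexists; first by exists (fun _ _ => tt).
by move=> g; apply: mod_mor_eq => S x; case: (g S x).
Qed.

Definition genus0 : functor Fin (prod_cat Fin (discrete nat)).
Proof.
exists (fun S => (S, 0) : prod_cat Fin (discrete nat))
  (fun S T phi => (phi, erefl)) => //.
Defined.

Definition comp_functor (C D E : category) (G : functor D E) (F : functor C D)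
  : functor C E.
Proof.
exists (fun X => G (F X)) (fun X Y f => fmap G (fmap F f)).
- by move=> X; rewrite !fmap1.
- by move=> X Y Z g f; rewrite !fmapM.
Defined.

Definition box_ob (P : mod_operad) : cyc_operad.
Proof.
exists (comp_functor P genus0) (fun S' S'' u v x y => @mcomp P S' S'' 0 0 u v x y).
- move=> S' S'' u v x y phi Hphi /=.
  by rewrite -(mcomp_sym _ _ Hphi) (eq_irrelevance (addnC 0 0) erefl).
- move=> S1 S2 S3 a b c d b' c' Hb Hc x y z phi Hphi /=.
  have := @mcomp_assoc P _ _ _ 0 0 0 _ _ _ _ _ _ Hb Hc x y z phi Hphi.
  by rewrite (eq_irrelevance (addnA 0 0 0) erefl).
- move=> S' S'' T' T'' rho sigma u v x y /=.
  exact: (mcomp_equiv rho sigma u v x y).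
Defined.

Definition box_mor (P Q : mod_operad) (f : mod_mor P Q)
  : cyc_mor (box_ob P) (box_ob Q).
Proof.
unshelve eexists.
  exists (fun S => f (S, 0)) => S T phi.
  exact: (nt_nat f (fmap genus0 phi)).
by move=> S' S'' u v x y; apply: (mod_nt_comp f (g' := 0) (g'' := 0)).
Defined.

Definition Box : functor ModOp CycOp.
Proof.
exists (box_ob : ModOp -> CycOp) box_mor.
- by move=> *; apply: cyc_mor_eq.
- by move=> *; apply: cyc_mor_eq.
Defined.

(* [R] restricts to a total cyclic order on [A]; [R x y z] says that, going
   around from [x], one meets [y] strictly before [z]. *)
Definition total_cyclic (T : eqType) (A : pred T) (R : T -> T -> T -> bool) :=
  [/\ {in A & &, forall x y z, R x y z -> R y z x},
      {in A & &, forall x y z, R x y z -> ~~ R z y x},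
      (forall x y z t, x \in A -> y \in A -> z \in A -> t \in A ->
         R x y z -> R x z t -> R x y t)
    & {in A & &, forall x y z, x != y -> y != z -> z != x ->
         R x y z || R z y x}].

(* The cyclic order represented by the linear order [lt]. *)
Definition cyc_of_lt (T : Type) (lt : T -> T -> bool) (x y z : T) : bool :=
  [|| lt x y && lt y z, lt y z && lt z x | lt z x && lt x y].

Lemma cyc_of_ltP (T : eqType) (A : pred T) (lt : T -> T -> bool) :
  {in A, irreflexive lt} -> {in A & &, transitive lt} ->
  {in A &, forall x y, x != y -> lt x y || lt y x} ->
  total_cyclic A (cyc_of_lt lt).
Proof.
move=> irr tr tot.
have asym x y : x \in A -> y \in A -> lt x y -> lt y x = false.
  move=> xA yA xy; apply/negP => yx.
  by have := irr x xA; rewrite (tr y x x).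
rewrite /cyc_of_lt; split.
- by move=> x y z _ _ _; case: (lt x y); case: (lt y z); case: (lt z x).
- move=> x y z xA yA zA.
  have axy := asym x y xA yA; have ayz := asym y z yA zA.
  have azx := asym z x zA xA.
  by case/or3P => /andP[p q]; do ?[rewrite (axy p) | rewrite (axy q)];
    do ?[rewrite (ayz p) | rewrite (ayz q)];
    do ?[rewrite (azx p) | rewrite (azx q)]; rewrite ?andbF.
- move=> x y z t xA yA zA tA.
  have xz_zx : lt x z -> lt z x -> False by move=> /(asym _ _ xA zA) ->.
  case/or3P => /andP[p q]; case/or3P => /andP[r s].
  + by rewrite p (tr z y t).
  + by case: xz_zx; [apply: (tr y) | apply: (tr t)].
  + by rewrite p r !orbT.
  + by case: xz_zx => //; apply: (tr z y x).
  + by rewrite (tr z y t) // s !orbT.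
  + by case: xz_zx.
  + by case: xz_zx.
  + by rewrite s q !orbT.
  + by case: xz_zx.
- move=> x y z xA yA zA xy yz zx.
  have := tot x y xA yA xy; have := tot y z yA zA yz.
  have := tot z x zA xA zx.
  have := tr y x z yA xA zA; have := tr z y x zA yA xA.
  have := tr x z y xA zA yA; have := tr y z x yA zA xA.
  have := tr z x y zA xA yA; have := tr x y z xA yA zA.
  move: (lt x y) (lt y z) (lt z x) (lt y x) (lt z y) (lt x z).
  by do 6![case] => //=; intuition.
Qed.

Lemma total_cyclic_sub (T U : eqType) (A : pred T) (B : pred U)
    (R : T -> T -> T -> bool) (R' : U -> U -> U -> bool) (f : U -> T) :
  injective f -> {in B, forall x, f x \in A} ->
  {in B & &, forall x y z, R' x y z = R (f x) (f y) (f z)} ->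
  total_cyclic A R -> total_cyclic B R'.
Proof.
move=> fI BA E [H1 H2 H3 H4]; split.
- by move=> x y z xB yB zB; rewrite !E //; apply: H1; apply: BA.
- by move=> x y z xB yB zB; rewrite !E //; apply: H2; apply: BA.
- by move=> x y z t xB yB zB tB; rewrite !E //; apply: H3; apply: BA.
- move=> x y z xB yB zB xy yz zx; rewrite !E //.
  by apply: H4; rewrite ?(inj_eq fI) ?BA.
Qed.

(* A multicyclic order: [comp x] is the index of the component of [x]; a
   component whose index is not in the image of [comp] is empty. *)
Record mcset := MCSet {
  pts :> finType;
  idx : finType;
  comp : pts -> idx;
  cyc : pts -> pts -> pts -> bool;
  idx_gt0 : 0 < #|idx|;
  cyc_comp : forall x y z, cyc x y z -> comp x = comp y /\ comp y = comp z;
  cyc_total : forall i : idx, total_cyclic [pred x | comp x == i] cyc }.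
Arguments comp {m} x.
Arguments cyc {m} x y z.

(* An injection preserving the cyclic orders, with a bijection between the
   indices of the components: the target is the source with further points
   inserted into its components. *)
Record emb (S T : mcset) := Emb {
  epts :> S -> T;
  eidx : idx S -> idx T;
  epts_inj : injective epts;
  eidx_bij : bijective eidx;
  emb_comp : forall x, comp (epts x) = eidx (comp x);
  emb_cyc : forall x y z, cyc (epts x) (epts y) (epts z) = cyc x y z }.

Record mciso (S T : mcset) := MCIso {
  iso_emb :> emb S T;
  iso_bij : bijective iso_emb }.

Lemma emb_eq (S T : mcset) (f g : emb S T) :
  epts f =1 epts g -> eidx f =1 eidx g -> f = g.
Proof.
case: f g => [f fi H1 H2 H3 H4] [g gi K1 K2 K3 K4] /= E E'.
have {}E : f = g by apply: functional_extensionality_dep.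
have {}E' : fi = gi by apply: functional_extensionality_dep.
subst g gi; rewrite (Prop_irrelevance H1 K1) (Prop_irrelevance H2 K2).
by rewrite (Prop_irrelevance H3 K3) (Prop_irrelevance H4 K4).
Qed.

Lemma mciso_eq (S T : mcset) (f g : mciso S T) :
  epts f =1 epts g -> eidx f =1 eidx g -> f = g.
Proof.
case: f g => [f Hf] [g Hg] /= E E'; have {E E'}fg := emb_eq E E'.
by subst g; rewrite (Prop_irrelevance Hf Hg).
Qed.

Definition emb_id (S : mcset) : emb S S.
Proof.
by exists id id => //; exists id.
Defined.

Definition emb_cmp (S T U : mcset) (g : emb T U) (f : emb S T) : emb S U.
Proof.
exists (g \o f) (eidx g \o eidx f).
- by apply: inj_comp; apply: epts_inj.
- by apply: bij_comp; apply: eidx_bij.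
- by move=> x /=; rewrite !emb_comp.
- by move=> x y z /=; rewrite !emb_cyc.
Defined.

Definition MultCyc : category.
Proof.
unshelve refine (@Category mcset mciso _ _ _ _ _).
- by move=> S; exists (emb_id S); exists id.
- move=> S T U g f; exists (emb_cmp g f).
  by apply: bij_comp; [exact: (iso_bij g) | exact: (iso_bij f)].
- by move=> *; apply: mciso_eq.
- by move=> *; apply: mciso_eq.
- by move=> *; apply: mciso_eq.
Defined.

(* Cyclically ordered sets are the multicyclic ones with one component. *)
Definition Cyc : category := full_sub (C := MultCyc) (fun S => #|idx S| = 1).

Section Union.
Variables S' S'' : mcset.

Definition munion_comp (x : S' + S'') : idx S' + idx S'' :=
  sum_map comp comp x.

Definition munion_cyc (x y z : S' + S'') : bool :=
  match x, y, z with
  | inl x, inl y, inl z => cyc x y z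
  | inr x, inr y, inr z => cyc x y z
  | _, _, _ => false
  end.

Lemma munion_cyc_comp x y z : munion_cyc x y z ->
  munion_comp x = munion_comp y /\ munion_comp y = munion_comp z.
Proof.
by case: x => x; case: y => y; case: z => z //= /cyc_comp[-> ->].
Qed.

Lemma munion_total i : total_cyclic [pred x | munion_comp x == i] munion_cyc.
Proof.
case: i => i; have [H1 H2 H3 H4] := cyc_total i; split.
- case=> x [] y [] z // xi yi zi; exact: (H1 x y z).
- case=> x [] y [] z // xi yi zi; exact: (H2 x y z).
- case=> x [] y [] z [] t // xi yi zi ti; exact: (H3 x y z t).
- case=> x [] y [] z // xi yi zi; exact: (H4 x y z).
- case=> x [] y [] z // xi yi zi; exact: (H1 x y z).
- case=> x [] y [] z // xi yi zi; exact: (H2 x y z).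
- case=> x [] y [] z [] t // xi yi zi ti; exact: (H3 x y z t).
- case=> x [] y [] z // xi yi zi; exact: (H4 x y z).
Qed.

Lemma munion_gt0 : 0 < #|{: idx S' + idx S''}|.
Proof. by rewrite card_sum addn_gt0 idx_gt0. Qed.

Definition munion : mcset :=
  @MCSet (S' + S'')%type (idx S' + idx S'')%type munion_comp munion_cyc
    munion_gt0 munion_cyc_comp munion_total.
End Union.

Section Deletion.
Variables (S : mcset) (u v : S).

(* The components of S \ {u, v} are those of S not containing u, v, together
   with
   - the merged component, [inr true], if u, v lie in different components;
   - the open intervals from u to v, [inr true], and from v to u, [inr false],
     if u, v lie in the same component. *)
Definition mdel_index (i : idx S + bool) : bool :=
  match i with
  | inl k => (k != comp u) && (k != comp v)
  | inr s => s || (comp u == comp v)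
  end.

Definition mdel_idx : finType := {i : idx S + bool | mdel_index i}.

Definition touched (x : S) : bool := (comp x == comp u) || (comp x == comp v).

Definition mdel_raw (x : S) : idx S + bool :=
  if touched x then inr ((comp u != comp v) || cyc u x v) else inl (comp x).

Lemma mdel_raw_subproof (x : S) : mdel_index (mdel_raw x).
Proof.
rewrite /mdel_raw /touched; case: ifP => [_|/negbT]; last by rewrite negb_or.
by rewrite /=; case: eqP; rewrite ?orbT.
Qed.

Definition mdel_comp (x : del u v) : mdel_idx :=
  exist _ (mdel_raw (val x)) (mdel_raw_subproof (val x)).

(* The linear order a_1 < ... < a_k < b_1 < ... < b_l on the merged component,
   where a_1 < ... < a_k < u and v < b_1 < ... < b_l represent the cyclic
   orders of the components of u and v. *)
Definition merged_lt (x y : S) : bool :=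
  if comp x == comp u then (comp y != comp u) || cyc u x y
  else (comp y != comp u) && cyc v x y.

Definition mdel_cyc (x y z : del u v) : bool :=
  [&& mdel_comp x == mdel_comp y, mdel_comp y == mdel_comp z &
      if (comp u != comp v) && touched (val x)
      then cyc_of_lt merged_lt (val x) (val y) (val z)
      else cyc (val x) (val y) (val z)].

Lemma mdel_gt0 : 0 < #|mdel_idx|.
Proof. by apply/card_gt0P; exists (exist _ (inr true) isT). Qed.

Lemma mdel_cyc_comp x y z : mdel_cyc x y z ->
  mdel_comp x = mdel_comp y /\ mdel_comp y = mdel_comp z.
Proof. by case/and3P => /eqP-> /eqP->. Qed.

Lemma cyc_irr (x y : S) : cyc x y y = false.
Proof.
apply/negP => H; have [E _] := cyc_comp H.
have [H1 H2 _ _] := cyc_total (comp x).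
have H' : cyc y y x by apply: H1 => //; rewrite inE ?E eqxx.
have := H2 y y x; rewrite !inE E eqxx => /(_ isT isT isT H').
by rewrite H.
Qed.

Lemma cyc_trans (x y z t : S) : cyc x y z -> cyc x z t -> cyc x y t.
Proof.
move=> H K; have [E1 E2] := cyc_comp H; have [E3 E4] := cyc_comp K.
have [_ _ H3 _] := cyc_total (comp x).
by apply: (H3 x y z t) => //; rewrite inE ?eqxx // -?E4 -?E3 ?E1.
Qed.

Lemma cyc_tot (x y z : S) : comp x = comp y -> comp x = comp z ->
  x != y -> y != z -> z != x -> cyc x y z || cyc x z y.
Proof.
move=> E1 E2 xy yz zx; have [H1 _ _ H4] := cyc_total (comp x).
have /orP[->//|] : cyc x y z || cyc z y x.
  by apply: H4 => //; rewrite inE ?eqxx -?E1 -?E2.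
move=> K.
have {}K : cyc y x z by apply: H1 K; rewrite inE ?eqxx -?E1 -?E2.
have -> : cyc x z y by apply: H1 K; rewrite inE ?eqxx -?E1 -?E2.
by rewrite orbT.
Qed.

Lemma merged_ltP : comp u != comp v ->
  total_cyclic [pred x | [&& touched x, x != u & x != v]]
    (cyc_of_lt merged_lt).
Proof.
move=> uv; apply: cyc_of_ltP; rewrite /merged_lt /touched.
- by move=> x; rewrite !cyc_irr; case: eqP.
- move=> y x z _ _ _.
  case: (comp x == _); case: (comp y == _); case: (comp z == _) => //=;
  exact: cyc_trans.
- move=> x y /and3P[/orP xc xu xv] /and3P[/orP yc yu yv] xy.
  case: (eqVneq (comp x) (comp u)) xc => [xE _|_ []// /eqP xE];
  case: (eqVneq (comp y) (comp u)) yc => [yE _|_ []// /eqP yE] //=.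
  + by apply: cyc_tot; rewrite ?xE ?yE // eq_sym.
  + by apply: cyc_tot; rewrite ?xE ?yE // eq_sym.
Qed.

Lemma mdel_total i : total_cyclic [pred x | mdel_comp x == i] mdel_cyc.
Proof.
have E3 (A : pred S) (R : S -> S -> S -> bool) :
    total_cyclic A R ->
    (forall x, mdel_comp x = i -> val x \in A) ->
    (forall x, mdel_comp x = i ->
       (if (comp u != comp v) && touched (val x)
        then cyc_of_lt merged_lt else cyc) = R) ->
  total_cyclic [pred x | mdel_comp x == i] mdel_cyc.
  move=> H AP RP; apply: (total_cyclic_sub val_inj _ _ H).
    by move=> x /eqP/AP.
  move=> x y z /eqP xi /eqP yi /eqP zi.
  by rewrite /mdel_cyc xi yi zi !eqxx /= -(RP x xi); case: ifP.
have raw (x : del u v) : mdel_comp x = i -> mdel_raw (val x) = val i.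
  by move <-.
case: (boolP ((comp u != comp v) && ~~ if val i is inl _ then true else false)).
  case/andP => uv iP; apply: (E3 _ _ (merged_ltP uv)) => x /raw.
  - rewrite /mdel_raw inE (valP x) andbT; case: ifP => // _ E.
    by rewrite -E in iP.
  - by rewrite /mdel_raw uv; case: ifP => // _ E; rewrite -E in iP.
move=> NP; have [j jP] : exists j : idx S, forall x, mdel_comp x = i ->
    comp (val x) = j /\ ((comp u != comp v) && touched (val x)) = false.
  case Ei : (val i) NP => [k|s]; rewrite ?andbF ?andbT => NP.
    exists k => x /raw; rewrite Ei /mdel_raw.
    by case: ifP => // _ [<-]; rewrite andbF.
  move/negPn/eqP: NP => uv; exists (comp u) => x /raw; rewrite Ei /mdel_raw.
  by case: ifP => // /orP H _; rewrite uv eqxx; case: H => /eqP->.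
by apply: (E3 _ _ (cyc_total j)) => x /jP[xj t]; rewrite ?inE ?xj ?t.
Qed.

Definition mdel : mcset :=
  @MCSet (del u v) mdel_idx mdel_comp mdel_cyc
    mdel_gt0 mdel_cyc_comp mdel_total.
End Deletion.

Definition mglue (S' S'' : mcset) (u : S') (v : S'') : mcset :=
  @mdel (munion S' S'') (inl u) (inr v).

Section DeletionEmb.
Variables (S T : mcset) (e : emb S T) (u v : S).

Lemma mdel_index_map (i : idx S + bool) :
  mdel_index (e u) (e v) (sum_map (eidx e) id i) = mdel_index u v i.
Proof.
have eI := bij_inj (eidx_bij e).
by case: i => i; rewrite /= !emb_comp !(inj_eq eI).
Qed.

Lemma mdel_raw_map (x : S) :
  mdel_raw (e u) (e v) (e x) = sum_map (eidx e) id (mdel_raw u v x).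
Proof.
have eI := bij_inj (eidx_bij e).
by rewrite /mdel_raw /touched !emb_comp !(inj_eq eI) emb_cyc; case: ifP.
Qed.

Lemma mdel_eidx_subproof (i : mdel_idx u v) :
  mdel_index (e u) (e v) (sum_map (eidx e) id (val i)).
Proof. by rewrite mdel_index_map; apply: (valP i). Qed.

Definition mdel_eidx (i : mdel_idx u v) : mdel_idx (e u) (e v) :=
  exist _ (sum_map (eidx e) id (val i)) (mdel_eidx_subproof i).

Lemma mdel_eidx_bij : bijective mdel_eidx.
Proof.
have [g gK Kg] := eidx_bij e.
have K1 : cancel (sum_map (eidx e) id) (sum_map g (@id bool)).
  by case=> i /=; rewrite ?gK.
have K2 : cancel (sum_map g id) (sum_map (eidx e) (@id bool)).
  by case=> i /=; rewrite ?Kg.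
have gP (i : mdel_idx (e u) (e v)) : mdel_index u v (sum_map g id (val i)).
  by rewrite -mdel_index_map K2; apply: (valP i).
exists (fun i => exist _ (sum_map g id (val i)) (gP i)).
- by move=> i; apply: val_inj; apply: K1.
- by move=> i; apply: val_inj; apply: K2.
Qed.

Lemma mdel_emb_comp (x : mdel u v) :
  comp (del_map (@epts_inj _ _ e) x : mdel (e u) (e v)) = mdel_eidx (comp x).
Proof. by apply: val_inj; apply: mdel_raw_map. Qed.

Lemma mdel_emb_cyc (x y z : mdel u v) :
  let f := @del_map _ _ _ (@epts_inj _ _ e) u v in
  mdel_cyc (f x : del (e u) (e v)) (f y) (f z) = mdel_cyc x y z.
Proof.
have eI := bij_inj (eidx_bij e).
have lt_map (a b : S) :
    merged_lt (e u) (e v) (e a) (e b) = merged_lt u v a b.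
  by rewrite /merged_lt !emb_comp !(inj_eq eI) !emb_cyc.
move=> f; have fE w : mdel_comp (f w) = mdel_eidx (mdel_comp w).
  exact: mdel_emb_comp.
rewrite /mdel_cyc !fE !(inj_eq (bij_inj mdel_eidx_bij)).
by rewrite /cyc_of_lt /touched /= !lt_map !emb_comp !(inj_eq eI) emb_cyc.
Qed.

Definition mdel_emb : emb (mdel u v) (mdel (e u) (e v)) :=
  @Emb (mdel u v) (mdel (e u) (e v)) (@del_map _ _ _ (@epts_inj _ _ e) u v) mdel_eidx
    (@del_map_inj _ _ _ _ _ _) mdel_eidx_bij mdel_emb_comp mdel_emb_cyc.
End DeletionEmb.

Definition munion_emb (S T S' T' : mcset) (e : emb S T) (e' : emb S' T')
  : emb (munion S S') (munion T T').
Proof.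
exists (sum_map e e') (sum_map (eidx e) (eidx e')).
- by apply: sum_map_inj; apply: epts_inj.
- by apply: sum_map_bij; apply: eidx_bij.
- by case=> x /=; rewrite emb_comp.
- by case=> x [] y [] z //=; rewrite emb_cyc.
Defined.

Definition mglue_emb (S T S' T' : mcset) (e : emb S T) (e' : emb S' T')
    (u : S) (v : S') : emb (mglue u v) (mglue (e u) (e' v)) :=
  mdel_emb (munion_emb e e') (inl u) (inr v).

Definition mdel_iso (S T : mcset) (f : mciso S T) (u v : S)
    : mciso (mdel u v) (mdel (f u) (f v)) :=
  @MCIso _ _ (mdel_emb f u v) (del_map_bij (@epts_inj _ _ f) u v (iso_bij f)).

Definition munion_iso (S T S' T' : mcset) (f : mciso S T) (g : mciso S' T')
    : mciso (munion S S') (munion T T') :=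
  @MCIso _ _ (munion_emb f g) (sum_map_bij (iso_bij f) (iso_bij g)).

Definition mglue_iso (S T S' T' : mcset) (f : mciso S T) (g : mciso S' T')
    (u : S) (v : S') : mciso (mglue u v) (mglue (f u) (g v)) :=
  mdel_iso (munion_iso f g) (inl u) (inr v).

(* In the axioms of operads on multicyclically ordered sets, T1 and T2 are the
   same iterated union and deletion performed in two different orders, and
   they are identified by an isomorphism [phi] which is the identity on points.
   This determines [phi] on the indices of the nonempty components, but not on
   those of the empty ones: for instance, the intervals from u to v and from v
   to u may both be empty.  [comps_match] requires the matching [h] of the
   components to stay compatible with the identity of points after inserting
   arbitrary further points into the sets one started from; [e1] and [e2] are
   the induced embeddings of T1 and T2 into the enlarged sets, and [o1] and [o2]
   give the origin of the points of the latter.  There is exactly one such [phi]: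
   each component of T1 can be made nonempty by inserting a point, and the
   components in which an inserted point ends up in T1 and T2 correspond. *)
Definition comps_match (T1 T2 U1 U2 : mcset) (W : Type)
    (h : idx T1 -> idx T2) (e1 : emb T1 U1) (e2 : emb T2 U2)
    (o1 : U1 -> W) (o2 : U2 -> W) : Prop :=
  forall (p : U1) (q : U2) (k : idx T1), o1 p = o2 q ->
    comp p = eidx e1 k -> comp q = eidx e2 (h k).

Definition can_del_sym (S : mcset) (u v : S)
    (phi : mciso (mdel u v) (mdel v u)) : Prop :=
  (forall z, val (phi z) = val z) /\
  forall (U : mcset) (e : emb S U),
    comps_match (eidx phi) (mdel_emb e u v) (mdel_emb e v u) val val.

Definition can_glue_sym (S' S'' : mcset) (u : S') (v : S'')
    (phi : mciso (mglue u v) (mglue v u)) : Prop :=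
  (forall z, val (phi z) = sum_swap (val z)) /\
  forall (U' U'' : mcset) (e' : emb S' U') (e'' : emb S'' U''),
    comps_match (eidx phi) (mglue_emb e' e'' u v) (mglue_emb e'' e' v u)
      (fun p => sum_swap (val p)) val.

Definition can_glue_assoc (S1 S2 S3 : mcset) (a : S1) (b c : S2) (d : S3)
    (b' : mglue c d) (c' : mglue a b)
    (phi : mciso (mglue a b') (mglue c' d)) : Prop :=
  (forall z, orig_l (val (phi z)) = orig_r (val z)) /\
  forall (U1 U2 U3 : mcset) (e1 : emb S1 U1) (e2 : emb S2 U2) (e3 : emb S3 U3),
    comps_match (eidx phi)
      (mglue_emb e1 (mglue_emb e2 e3 c d) a b')
      (mglue_emb (mglue_emb e1 e2 a b) e3 c' d)
      (fun p => orig_r (val p)) (fun q => orig_l (val q)).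

Definition can_del_del (S : mcset) (a b c d : S)
    (a' b' : mdel c d) (c' d' : mdel a b)
    (phi : mciso (mdel a' b') (mdel c' d')) : Prop :=
  (forall z, val (val (phi z)) = val (val z)) /\
  forall (U : mcset) (e : emb S U),
    comps_match (eidx phi)
      (mdel_emb (mdel_emb e c d) a' b') (mdel_emb (mdel_emb e a b) c' d')
      (fun p => val (val p)) (fun q => val (val q)).

Definition can_glue_del (S' S'' : mcset) (a c d : S') (b : S'')
    (a' : mdel c d) (c' d' : mglue a b)
    (phi : mciso (mglue a' b) (mdel c' d')) : Prop :=
  (forall z, val (val (phi z)) = orig_d (val z)) /\
  forall (U' U'' : mcset) (e' : emb S' U') (e'' : emb S'' U''),
    comps_match (eidx phi)
      (mglue_emb (mdel_emb e' c d) e'' a' b)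
      (mdel_emb (mglue_emb e' e'' a b) c' d')
      (fun p => orig_d (val p)) (fun q => val (val q)).

Lemma sum_count (I J : finType) (P : pred (I + J)) :
  #|[pred x | P x]| = #|[pred i | P (inl i)]| + #|[pred j | P (inr j)]|.
Proof. by rewrite -!sum1_card big_sumType. Qed.

Lemma card_mdel (S : mcset) (u v : S) :
  #|idx (mdel u v)| + (comp u != comp v) = #|idx S| + (comp u == comp v).
Proof.
have -> : #|idx (mdel u v)| =
    #|[predC pred2 (comp u) (comp v)]| + (comp u == comp v).+1.
  rewrite card_sig sum_count; congr addn.
    by apply: eq_card => k; rewrite !inE negb_or.
  rewrite -sum1_card big_mkcond big_bool /=.
  by rewrite !inE /=; case: (comp u == comp v).
rewrite -(cardC (pred2 (comp u) (comp v))) card2 /=.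
by case: (comp u == comp v); rewrite /= ?addn0 ?addn1 ?addn2 ?addSn ?addnS.
Qed.

Lemma card_mglue (S' S'' : mcset) (u : S') (v : S'') :
  #|idx (mglue u v)| + 1 = #|idx S'| + #|idx S''|.
Proof.
by have /= := @card_mdel (munion S' S'') (inl u) (inr v); rewrite card_sum addn0.
Qed.

Lemma cglue_subproof (C' C'' : Cyc) (u : sval C' : mcset)
  (v : sval C'' : mcset) : #|idx (mglue u v)| = 1.
Proof.
apply/eqP; rewrite -(eqn_add2r 1) card_mglue.
by rewrite (svalP C') (svalP C'').
Qed.

Definition cset (C : Cyc) : mcset := sval C.

Definition cglue (C' C'' : Cyc) (u : cset C') (v : cset C'') : Cyc :=
  exist _ (mglue u v) (cglue_subproof u v).

Record ns_cyc_operad := NsCycOperad {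
  ncop :> functor Cyc Sets;
  nccomp : forall (C' C'' : Cyc) (u : cset C') (v : cset C''),
    ncop C' -> ncop C'' -> ncop (cglue u v);
  nccomp_sym : forall (C' C'' : Cyc) (u : cset C') (v : cset C'')
      (x : ncop C') (y : ncop C'') (phi : mciso (mglue u v) (mglue v u)),
    can_glue_sym phi ->
    @fmap _ _ ncop (cglue u v) (cglue v u) phi (nccomp u v x y) =
    nccomp v u y x;
  nccomp_assoc : forall (C1 C2 C3 : Cyc)
      (a : cset C1) (b c : cset C2) (d : cset C3)
      (b' : mglue c d) (c' : mglue a b),
    val b' = inl b -> val c' = inr c ->
    forall (x : ncop C1) (y : ncop C2) (z : ncop C3)
      (phi : mciso (mglue a b') (mglue c' d)),
    can_glue_assoc phi ->
    @fmap _ _ ncop (@cglue C1 (cglue c d) a b') (@cglue (cglue a b) C3 c' d) phi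
      (@nccomp C1 (cglue c d) a b' x (nccomp c d y z)) =
    @nccomp (cglue a b) C3 c' d (nccomp a b x y) z;
  nccomp_equiv : forall (C' C'' D' D'' : Cyc) (rho : mciso (cset C') (cset D'))
      (sigma : mciso (cset C'') (cset D'')) (u : cset C') (v : cset C'')
      (x : ncop C') (y : ncop C''),
    @fmap _ _ ncop (cglue u v) (cglue (rho u) (sigma v))
      (mglue_iso rho sigma u v) (nccomp u v x y) =
    nccomp (rho u) (sigma v)
      (@fmap _ _ ncop C' D' rho x) (@fmap _ _ ncop C'' D'' sigma y) }.

Record ns_cyc_mor (P Q : ns_cyc_operad) := NsCycMor {
  ncyc_nt :> nat_trans P Q;
  ncyc_ntP : forall (C' C'' : Cyc) (u : cset C') (v : cset C'')
      (x : P C') (y : P C''),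
    ncyc_nt (cglue u v) (nccomp u v x y) =
    nccomp u v (ncyc_nt C' x) (ncyc_nt C'' y) }.

Lemma ns_cyc_mor_eq (P Q : ns_cyc_operad) (f g : ns_cyc_mor P Q) :
  (forall S x, f S x = g S x) -> f = g.
Proof.
case: f g => [f Hf] [g Hg] /= E.
have {}E : f = g.
  by apply: nat_trans_eq => S; apply: functional_extensionality_dep => x.
by subst g; rewrite (Prop_irrelevance Hf Hg).
Qed.

Definition NsCycOp : category.
Proof.
unshelve refine (@Category ns_cyc_operad ns_cyc_mor _ _ _ _ _).
- by move=> P; exists (nat_id P).
- move=> P Q R g f; exists (nat_comp g f) => S' S'' u v x y /=.
  by rewrite !ncyc_ntP.
- by move=> *; apply: ns_cyc_mor_eq.
- by move=> *; apply: ns_cyc_mor_eq.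
- by move=> *; apply: ns_cyc_mor_eq.
Defined.

Definition ns_star_C : NsCycOp.
Proof.
exists (const_functor Cyc) (fun _ _ _ _ _ _ => tt).
all: by move=> *; do ?case: (fmap _ _).
Defined.

Lemma ns_star_C_terminal : terminal ns_star_C.
Proof.
move=> P; unshelve eexists.
  by unshelve eexists; first by exists (fun _ _ => tt).
by move=> g; apply: ns_cyc_mor_eq => S x; case: (g S x).
Qed.

(* (g - b + 1) / 2 is a natural number, b being the number of components. *)
Definition geometric (S : mcset) (g : nat) : Prop :=
  exists h : nat, g + 1 = #|idx S| + h.*2.

Notation ns_modular_module :=
  (functor (prod_cat MultCyc (discrete nat)) Sets).

Definition nmod_at (P : ns_modular_module) (S : mcset) (g : nat) : Type :=
  P (S, g).

Definition nmod_act (P : ns_modular_module) (S T : mcset) (g h : nat)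
    (phi : mciso S T) (e : g = h) : nmod_at P S g -> nmod_at P T h :=
  @fmap _ _ P (S, g) (T, h) (phi, e).
Arguments nmod_act P {S T g h} phi e _.

Record ns_mod_operad := NsModOperad {
  nmop :> ns_modular_module;
  nmop_geometric : forall (S : mcset) (g : nat),
    nmod_at nmop S g -> geometric S g;
  nmcomp : forall (S' S'' : mcset) (g' g'' : nat) (u : S') (v : S''),
    nmod_at nmop S' g' -> nmod_at nmop S'' g'' ->
    nmod_at nmop (mglue u v) (g' + g'');
  nmctr : forall (S : mcset) (g : nat) (u v : S), u != v ->
    nmod_at nmop S g -> nmod_at nmop (mdel u v) g.+1;
  nmctr_sym : forall (S : mcset) (g : nat) (u v : S)
      (uv : u != v) (vu : v != u) (x : nmod_at nmop S g)
      (phi : mciso (mdel u v) (mdel v u)),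
    can_del_sym phi ->
    nmod_act nmop phi erefl (nmctr uv x) = nmctr vu x;
  nmcomp_sym : forall (S' S'' : mcset) (g' g'' : nat) (u : S') (v : S'')
      (x : nmod_at nmop S' g') (y : nmod_at nmop S'' g'')
      (phi : mciso (mglue u v) (mglue v u)),
    can_glue_sym phi ->
    nmod_act nmop phi (addnC g' g'') (nmcomp u v x y) = nmcomp v u y x;
  nmcomp_assoc : forall (S1 S2 S3 : mcset) (g1 g2 g3 : nat)
      (a : S1) (b c : S2) (d : S3) (b' : mglue c d) (c' : mglue a b),
    val b' = inl b -> val c' = inr c ->
    forall (x : nmod_at nmop S1 g1) (y : nmod_at nmop S2 g2)
      (z : nmod_at nmop S3 g3) (phi : mciso (mglue a b') (mglue c' d)),
    can_glue_assoc phi ->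
    nmod_act nmop phi (addnA g1 g2 g3) (nmcomp a b' x (nmcomp c d y z)) =
    nmcomp c' d (nmcomp a b x y) z;
  nmctr_ctr : forall (S : mcset) (g : nat) (a b c d : S)
      (a' b' : mdel c d) (c' d' : mdel a b),
    val a' = a -> val b' = b -> val c' = c -> val d' = d ->
    forall (ab : a != b) (cd : c != d) (ab' : a' != b') (cd' : c' != d')
      (x : nmod_at nmop S g) (phi : mciso (mdel a' b') (mdel c' d')),
    can_del_del phi ->
    nmod_act nmop phi erefl (nmctr ab' (nmctr cd x)) = nmctr cd' (nmctr ab x);
  nmctr_comp : forall (S' S'' : mcset) (g' g'' : nat)
      (a c : S') (b d : S'') (a' b' : mglue c d) (c' d' : mglue a b),
    val a' = inl a -> val b' = inr b -> val c' = inl c -> val d' = inr d ->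
    forall (ab' : a' != b') (cd' : c' != d')
      (x : nmod_at nmop S' g') (y : nmod_at nmop S'' g'')
      (phi : mciso (mdel a' b') (mdel c' d')),
    can_del_del (S := munion S' S'') phi ->
    nmod_act nmop phi erefl (nmctr ab' (nmcomp c d x y)) =
    nmctr cd' (nmcomp a b x y);
  nmcomp_ctr : forall (S' S'' : mcset) (g' g'' : nat)
      (a c d : S') (b : S'') (a' : mdel c d) (c' d' : mglue a b),
    val a' = a -> val c' = inl c -> val d' = inl d ->
    forall (cd : c != d) (cd' : c' != d')
      (x : nmod_at nmop S' g') (y : nmod_at nmop S'' g'')
      (phi : mciso (mglue a' b) (mdel c' d')),
    can_glue_del phi ->
    nmod_act nmop phi (addSn g' g'') (nmcomp a' b (nmctr cd x) y) =
    nmctr cd' (nmcomp a b x y);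
  nmcomp_equiv : forall (S' S'' T' T'' : mcset) (g' g'' : nat)
      (rho : mciso S' T') (sigma : mciso S'' T'') (u : S') (v : S'')
      (x : nmod_at nmop S' g') (y : nmod_at nmop S'' g''),
    nmod_act nmop (mglue_iso rho sigma u v) erefl (nmcomp u v x y) =
    nmcomp (rho u) (sigma v) (nmod_act nmop rho erefl x)
      (nmod_act nmop sigma erefl y);
  nmctr_equiv : forall (S T : mcset) (g : nat) (rho : mciso S T) (u v : S)
      (uv : u != v) (uv' : rho u != rho v) (x : nmod_at nmop S g),
    nmod_act nmop (mdel_iso rho u v) erefl (nmctr uv x) =
    nmctr uv' (nmod_act nmop rho erefl x) }.

Record ns_mod_mor (P Q : ns_mod_operad) := NsModMor {
  nmod_nt :> nat_trans P Q;
  nmod_nt_comp : forall (S' S'' : mcset) (g' g'' : nat) (u : S') (v : S'')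
      (x : nmod_at P S' g') (y : nmod_at P S'' g''),
    nmod_nt (mglue u v, g' + g'') (nmcomp u v x y) =
    nmcomp u v (nmod_nt (S', g') x) (nmod_nt (S'', g'') y);
  nmod_nt_ctr : forall (S : mcset) (g : nat) (u v : S) (uv : u != v)
      (x : nmod_at P S g),
    nmod_nt (mdel u v, g.+1) (nmctr uv x) = nmctr uv (nmod_nt (S, g) x) }.

Lemma ns_mod_mor_eq (P Q : ns_mod_operad) (f g : ns_mod_mor P Q) :
  (forall X x, f X x = g X x) -> f = g.
Proof.
case: f g => [f Hf Kf] [g Hg Kg] /= E.
have {}E : f = g.
  by apply: nat_trans_eq => S; apply: functional_extensionality_dep => x.
by subst g; rewrite (Prop_irrelevance Hf Hg) (Prop_irrelevance Kf Kg).
Qed.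

Definition NsModOp : category.
Proof.
unshelve refine (@Category ns_mod_operad ns_mod_mor _ _ _ _ _).
- by move=> P; exists (nat_id P).
- move=> P Q R g f; exists (nat_comp g f).
  + by move=> S' S'' g' g'' u v x y /=; rewrite !nmod_nt_comp.
  + by move=> S n u v uv x /=; rewrite !nmod_nt_ctr.
- by move=> *; apply: ns_mod_mor_eq.
- by move=> *; apply: ns_mod_mor_eq.
- by move=> *; apply: ns_mod_mor_eq.
Defined.

Lemma geometric_iso (S T : mcset) (g h : nat) (phi : mciso S T) :
  g = h -> geometric S g -> geometric T h.
Proof. by rewrite /geometric (bij_eq_card (eidx_bij phi)) => ->. Qed.

Lemma geometric_mdel (S : mcset) (g : nat) (u v : S) :
  geometric S g -> geometric (mdel u v) g.+1.
Proof.
case=> h E; exists (h + (comp u != comp v)); have := card_mdel u v.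
move: #|idx (mdel u v)| #|idx S| E => m n E.
by case: (comp u == comp v); rewrite /= -?muln2; lia.
Qed.

Lemma geometric_mglue (S' S'' : mcset) (g' g'' : nat) (u : S') (v : S'') :
  geometric S' g' -> geometric S'' g'' -> geometric (mglue u v) (g' + g'').
Proof.
by case=> h' E' [h'' E'']; exists (h' + h''); have := card_mglue u v; lia.
Qed.

(* A one-point set if (S, g) is geometric, the empty set otherwise. *)
Definition ns_point (S : mcset) (g : nat) : Type := {_ : unit | geometric S g}.

Definition ns_star_M_functor : ns_modular_module.
Proof.
exists (fun X => ns_point X.1 X.2 : Sets)
  (fun X Y f x => exist _ tt (geometric_iso f.1 f.2 (svalP x))).
- move=> X; apply: functional_extensionality_dep => -[[] H].
  by congr exist; apply: Prop_irrelevance.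
- move=> X Y Z g f; apply: functional_extensionality_dep => x.
  by congr exist; apply: Prop_irrelevance.
Defined.

Lemma ns_star_M_eq (X : prod_cat MultCyc (discrete nat))
  (x y : ns_star_M_functor X) : x = y.
Proof.
case: x y => -[] H [[] K]; congr exist; exact: Prop_irrelevance.
Qed.

Definition ns_star_M : NsModOp.
Proof.
exists ns_star_M_functor
  (fun S' S'' g' g'' u v (x : ns_point S' g') (y : ns_point S'' g'') =>
     exist _ tt (geometric_mglue u v (svalP x) (svalP y)))
  (fun S g u v _ (x : ns_point S g) =>
     exist _ tt (geometric_mdel u v (svalP x))).
- by move=> S g x; apply: (svalP x).
all: by move=> *; apply: ns_star_M_eq.
Defined.

Lemma ns_star_M_terminal : terminal ns_star_M.
Proof.
move=> P; have geo X (x : P X) : geometric X.1 X.2.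
  by case: X x => S g; apply: nmop_geometric.
unshelve eexists.
  unshelve eexists.
  - exists (fun X x => exist _ tt (geo X x)).
    by move=> *; apply: functional_extensionality_dep => x; apply: ns_star_M_eq.
  - by move=> *; apply: ns_star_M_eq.
  - by move=> *; apply: ns_star_M_eq.
by move=> g; apply: ns_mod_mor_eq => X x; apply: ns_star_M_eq.
Qed.

Definition ns_genus0 : functor Cyc (prod_cat MultCyc (discrete nat)).
Proof.
exists (fun C => (sval C, 0) : prod_cat MultCyc (discrete nat))
  (fun C D phi => (phi, erefl)) => //.
Defined.

Definition ns_box_ob (P : ns_mod_operad) : ns_cyc_operad.
Proof.
exists (comp_functor P ns_genus0)
  (fun C' C'' u v x y => @nmcomp P (cset C') (cset C'') 0 0 u v x y).
- move=> C' C'' u v x y phi Hphi /=.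
  have := @nmcomp_sym P _ _ 0 0 u v x y phi Hphi.
  by rewrite (eq_irrelevance (addnC 0 0) erefl).
- move=> C1 C2 C3 a b c d b' c' Hb Hc x y z phi Hphi /=.
  have := @nmcomp_assoc P _ _ _ 0 0 0 _ _ _ _ _ _ Hb Hc x y z phi Hphi.
  by rewrite (eq_irrelevance (addnA 0 0 0) erefl).
- move=> C' C'' D' D'' rho sigma u v x y /=.
  exact: (@nmcomp_equiv P _ _ _ _ 0 0 rho sigma u v x y).
Defined.

Definition ns_box_mor (P Q : ns_mod_operad) (f : ns_mod_mor P Q)
  : ns_cyc_mor (ns_box_ob P) (ns_box_ob Q).
Proof.
unshelve eexists.
  exists (fun C => f (sval C, 0)) => C D phi.
  exact: (nt_nat f (fmap ns_genus0 phi)).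
move=> C' C'' u v x y.
by apply: (@nmod_nt_comp _ _ f (cset C') (cset C'') 0 0 u v x y).
Defined.

Definition ns_Box : functor NsModOp NsCycOp.
Proof.
exists (ns_box_ob : NsModOp -> NsCycOp) ns_box_mor.
- by move=> *; apply: ns_cyc_mor_eq.
- by move=> *; apply: ns_cyc_mor_eq.
Defined.

(* The envelopes are constructed as sets of formal composites modulo the axioms
   of modular operads; this only serves to prove that left adjoints exist. *)
Lemma left_adjoint_of_universal (C D : category) (G : functor D C)
    (F0 : C -> D) (eta : forall X, hom X (G (F0 X)))
    (lift : forall X Y, hom X (G Y) -> hom (F0 X) Y) :
  (forall X Y (f : hom X (G Y)), cmp (fmap G (lift X Y f)) (eta X) = f) ->
  (forall X Y (h k : hom (F0 X) Y),
     cmp (fmap G h) (eta X) = cmp (fmap G k) (eta X) -> h = k) ->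
  exists F : functor C D, left_adjoint F G.
Proof.
move=> liftP uniq; unshelve eexists.
  exists F0 (fun X Y f => lift X (F0 Y) (cmp (eta Y) f)).
  - by move=> X; apply: uniq; rewrite liftP fmap1 cmpm1 cmp1m.
  - move=> X Y Z g f; apply: uniq.
    by rewrite liftP fmapM -cmpA liftP !cmpA liftP.
exists (fun X Y h => cmp (fmap G h) (eta X)); split.
  move=> X Y; exists (lift X Y); last exact: liftP.
  by move=> h; apply: uniq; rewrite liftP.
by move=> X X' Y Y' h f k /=; rewrite !fmapM -!cmpA liftP.
Qed.

Section Quotient.
Variables (T : Type) (E : T -> T -> Prop).
Hypotheses (Er : forall x, E x x) (Es : forall x y, E x y -> E y x)
  (Et : forall x y z, E x y -> E y z -> E x z).

Definition quot : Type := {X : T -> Prop | exists t, X = E t}.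
Definition quot_pi (t : T) : quot := exist _ (E t) (ex_intro _ t erefl).
Definition quot_repr (q : quot) : T := sval (cid (svalP q)).

Lemma quot_piE x y : E x y -> quot_pi x = quot_pi y.
Proof.
move=> xy; suff H : E x = E y.
  rewrite /quot_pi; move: (ex_intro _ x _) (ex_intro _ y _); rewrite H => a b.
  by rewrite (Prop_irrelevance a b).
apply: functional_extensionality_dep => z; apply: propositional_extensionality.
by split=> ?; [apply: Et (Es xy) _ | apply: Et xy _].
Qed.

Lemma quot_reprK q : quot_pi (quot_repr q) = q.
Proof.
case: q => X HX; rewrite /quot_repr /=; case: cid => t /= Et'; subst X.
by rewrite /quot_pi; congr exist; apply: Prop_irrelevance.
Qed.

Lemma quot_repr_pi t : E (quot_repr (quot_pi t)) t.
Proof. by have := congr1 sval (quot_reprK (quot_pi t)) => /= ->. Qed.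
End Quotient.

Section Envelope.
Variable P : cyc_operad.

Inductive term : finType -> nat -> Type :=
| t_in (S : finType) : P S -> term S 0
| t_act (S T : finType) g h : bij S T -> g = h -> term S g -> term T h
| t_comp (S' S'' : finType) g' g'' (u : S') (v : S'') :
    term S' g' -> term S'' g'' -> term (glue u v) (g' + g'')
| t_ctr (S : finType) g (u v : S) :
    u != v -> term S g -> term (del u v) g.+1.

Inductive teq : forall S g, term S g -> term S g -> Prop :=
| teq_refl S g (t : term S g) : teq t t
| teq_sym S g (s t : term S g) : teq s t -> teq t s
| teq_trans S g (s t r : term S g) : teq s t -> teq t r -> teq s r
| teq_act S T g h (phi : bij S T) (e : g = h) (s t : term S g) :
    teq s t -> teq (t_act phi e s) (t_act phi e t)
| teq_comp (S' S'' : finType) g' g'' (u : S') (v : S'')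
    (s s' : term S' g') (t t' : term S'' g'') :
    teq s s' -> teq t t' -> teq (t_comp u v s t) (t_comp u v s' t')
| teq_ctr (S : finType) g (u v : S) (uv : u != v) (s t : term S g) :
    teq s t -> teq (t_ctr uv s) (t_ctr uv t)
| teq_act1 S g (t : term S g) :
    teq (t_act (idm (S : Fin) : bij S S) erefl t) t
| teq_actM S T U g h k (phi : bij S T) (psi : bij T U) (e : g = h) (f : h = k)
    (t : term S g) :
    teq (t_act (@cmp Fin S T U psi phi : bij S U) (etrans e f) t)
      (t_act psi f (t_act phi e t))
| teq_in_act (S T : finType) (phi : bij S T) (x : P S) :
    teq (t_in (@fmap _ _ P S T phi x)) (t_act phi erefl (t_in x))
| teq_in_comp (S' S'' : finType) (u : S') (v : S'') (x : P S') (y : P S'') :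
    teq (t_in (ccomp u v x y) : term _ (0 + 0)) (t_comp u v (t_in x) (t_in y))
| teq_ctr_sym (S : finType) g (u v : S) (uv : u != v) (vu : v != u)
    (x : term S g) (phi : bij (del u v) (del v u)) :
    (forall z, val (phi z) = val z) ->
    teq (t_act phi erefl (t_ctr uv x)) (t_ctr vu x)
| teq_comp_sym (S' S'' : finType) g' g'' (u : S') (v : S'')
    (x : term S' g') (y : term S'' g'') (phi : bij (glue u v) (glue v u)) :
    (forall z, val (phi z) = sum_swap (val z)) ->
    teq (t_act phi (addnC g' g'') (t_comp u v x y)) (t_comp v u y x)
| teq_comp_assoc (S1 S2 S3 : finType) g1 g2 g3
    (a : S1) (b c : S2) (d : S3) (b' : glue c d) (c' : glue a b) :
    val b' = inl b -> val c' = inr c ->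
    forall (x : term S1 g1) (y : term S2 g2)
      (z : term S3 g3) (phi : bij (glue a b') (glue c' d)),
    (forall t, orig_l (val (phi t)) = orig_r (val t)) ->
    teq (t_act phi (addnA g1 g2 g3) (t_comp a b' x (t_comp c d y z)))
      (t_comp c' d (t_comp a b x y) z)
| teq_ctr_ctr (S : finType) g (a b c d : S)
    (a' b' : del c d) (c' d' : del a b) :
    val a' = a -> val b' = b -> val c' = c -> val d' = d ->
    forall (ab : a != b) (cd : c != d) (ab' : a' != b') (cd' : c' != d')
      (x : term S g) (phi : bij (del a' b') (del c' d')),
    (forall z, val (val (phi z)) = val (val z)) ->
    teq (t_act phi erefl (t_ctr ab' (t_ctr cd x))) (t_ctr cd' (t_ctr ab x))
| teq_ctr_comp (S' S'' : finType) g' g''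
    (a c : S') (b d : S'') (a' b' : glue c d) (c' d' : glue a b) :
    val a' = inl a -> val b' = inr b -> val c' = inl c -> val d' = inr d ->
    forall (ab' : a' != b') (cd' : c' != d')
      (x : term S' g') (y : term S'' g'')
      (phi : bij (del a' b') (del c' d')),
    (forall z, val (val (phi z)) = val (val z)) ->
    teq (t_act phi erefl (t_ctr ab' (t_comp c d x y)))
      (t_ctr cd' (t_comp a b x y))
| teq_comp_ctr (S' S'' : finType) g' g''
    (a c d : S') (b : S'') (a' : del c d) (c' d' : glue a b) :
    val a' = a -> val c' = inl c -> val d' = inl d ->
    forall (cd : c != d) (cd' : c' != d')
      (x : term S' g') (y : term S'' g'')
      (phi : bij (glue a' b) (del c' d')),
    (forall z, val (val (phi z)) = orig_d (val z)) ->
    teq (t_act phi (addSn g' g'') (t_comp a' b (t_ctr cd x) y))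
      (t_ctr cd' (t_comp a b x y))
| teq_comp_equiv (S' S'' T' T'' : finType) g' g''
    (rho : bij S' T') (sigma : bij S'' T'') (u : S') (v : S'')
    (x : term S' g') (y : term S'' g'') :
    teq (t_act (glue_bij rho sigma u v) erefl (t_comp u v x y))
      (t_comp (rho u) (sigma v) (t_act rho erefl x) (t_act sigma erefl y))
| teq_ctr_equiv (S T : finType) g (rho : bij S T) (u v : S)
    (uv : u != v) (uv' : rho u != rho v) (x : term S g) :
    teq (t_act (del_bij rho u v) erefl (t_ctr uv x))
      (t_ctr uv' (t_act rho erefl x)).

Definition env S g : Type := quot (@teq S g).
Definition env_pi S g (t : term S g) : env S g := quot_pi (@teq S g) t.
Definition env_repr S g (q : env S g) : term S g := quot_repr q.

Lemma env_eq S g (s t : term S g) : teq s t -> env_pi s = env_pi t.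
Proof. exact: (quot_piE (@teq_sym S g) (@teq_trans S g)). Qed.
Lemma env_reprK S g (q : env S g) : env_pi (env_repr q) = q.
Proof. exact: quot_reprK. Qed.
Lemma env_repr_pi S g (t : term S g) : teq (env_repr (env_pi t)) t.
Proof. exact: (quot_repr_pi (@teq_refl S g)). Qed.

Definition env_act S T g h (phi : bij S T) (e : g = h) (q : env S g) : env T h :=
  env_pi (t_act phi e (env_repr q)).
Definition env_comp (S' S'' : finType) g' g'' (u : S') (v : S'')
    (p : env S' g') (q : env S'' g'') : env (glue u v) (g' + g'') :=
  env_pi (t_comp u v (env_repr p) (env_repr q)).
Definition env_ctr (S : finType) g (u v : S) (uv : u != v) (q : env S g) :
    env (del u v) g.+1 :=
  env_pi (t_ctr uv (env_repr q)).

Lemma env_actE S T g h (phi : bij S T) (e : g = h) (t : term S g) :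
  env_act phi e (env_pi t) = env_pi (t_act phi e t).
Proof. by apply: env_eq; apply: teq_act; apply: env_repr_pi. Qed.
Lemma env_compE (S' S'' : finType) g' g'' (u : S') (v : S'')
    (s : term S' g') (t : term S'' g'') :
  env_comp u v (env_pi s) (env_pi t) = env_pi (t_comp u v s t).
Proof. by apply: env_eq; apply: teq_comp; apply: env_repr_pi. Qed.
Lemma env_ctrE (S : finType) g (u v : S) (uv : u != v) (t : term S g) :
  env_ctr uv (env_pi t) = env_pi (t_ctr uv t).
Proof. by apply: env_eq; apply: teq_ctr; apply: env_repr_pi. Qed.
Definition envE := (env_actE, env_compE, env_ctrE).

Lemma env_ind S g (Q : env S g -> Prop) :
  (forall t, Q (env_pi t)) -> forall q, Q q.
Proof. by move=> H q; rewrite -(env_reprK q). Qed.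

Definition env_functor : modular_module.
Proof.
exists (fun X => env X.1 X.2 : Sets) (fun X Y f => env_act f.1 f.2).
- move=> X; apply: functional_extensionality_dep; apply: env_ind => t.
  by rewrite envE; apply: env_eq; apply: teq_act1.
- move=> X Y Z g f; apply: functional_extensionality_dep; apply: env_ind => t.
  by rewrite /= !envE; apply: env_eq; apply: teq_actM.
Defined.

Definition env_operad : mod_operad.
Proof.
exists env_functor env_comp env_ctr; rewrite /mod_at /mod_act /=.
- move=> S g u v uv vu x phi H; elim/env_ind: x => x; rewrite !envE.
  exact/env_eq/teq_ctr_sym.
- move=> S' S'' g' g'' u v x y phi H; elim/env_ind: x => x.
  elim/env_ind: y => y; rewrite !envE; exact/env_eq/teq_comp_sym.
- move=> S1 S2 S3 g1 g2 g3 a b c d b' c' Hb Hc x y z phi H.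
  elim/env_ind: x => x; elim/env_ind: y => y; elim/env_ind: z => z.
  rewrite !envE; exact/env_eq/teq_comp_assoc.
- move=> S g a b c d a' b' c' d' Ha Hb Hc Hd ab cd ab' cd' x phi H.
  elim/env_ind: x => x; rewrite !envE.
  exact/env_eq/(teq_ctr_ctr Ha Hb Hc Hd).
- move=> S' S'' g' g'' a c b d a' b' c' d' Ha Hb Hc Hd ab' cd' x y phi H.
  elim/env_ind: x => x; elim/env_ind: y => y; rewrite !envE.
  exact/env_eq/(teq_ctr_comp Ha Hb Hc Hd).
- move=> S' S'' g' g'' a c d b a' c' d' Ha Hc Hd cd cd' x y phi H.
  elim/env_ind: x => x; elim/env_ind: y => y; rewrite !envE.
  exact/env_eq/(teq_comp_ctr Ha Hc Hd).
- move=> S' S'' T' T'' g' g'' rho sigma u v x y.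
  elim/env_ind: x => x; elim/env_ind: y => y; rewrite !envE.
  exact/env_eq/teq_comp_equiv.
- move=> S T g rho u v uv uv' x; elim/env_ind: x => x; rewrite !envE.
  exact/env_eq/teq_ctr_equiv.
Defined.

Definition env_unit : cyc_mor P (box_ob env_operad).
Proof.
unshelve eexists.
  exists (fun S x => env_pi (t_in x)) => S T phi.
  apply: functional_extensionality_dep => x /=; rewrite envE.
  exact/env_eq/teq_in_act.
move=> S' S'' u v x y /=; rewrite envE; exact/env_eq/teq_in_comp.
Defined.

Section Lift.
Variables (Q : mod_operad) (f : cyc_mor P (box_ob Q)).

Fixpoint eval S g (t : term S g) : mod_at Q S g :=
  match t with
  | t_in V x => f V x
  | t_act _ _ _ _ phi e t => mod_act Q phi e (eval t)
  | t_comp _ _ _ _ u v s t => mcomp u v (eval s) (eval t)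
  | t_ctr _ _ _ _ uv t => mctr uv (eval t)
  end.

Lemma eval_eq S g (s t : term S g) : teq s t -> eval s = eval t.
Proof.
elim=> {S g s t} //=.
- by move=> S g s t r _ -> _ ->.
- by move=> S T g h phi e s t _ ->.
- by move=> S' S'' g' g'' u v s s' t t' _ -> _ ->.
- by move=> S g u v uv s t _ ->.
- move=> S g t.
  exact: (congr1 (@^~ (eval t)) (fmap1 Q (S, g))).
- move=> S T U g h k phi psi e e' t.
  exact: (congr1 (@^~ (eval t)) (@fmapM _ _ Q (S, g) (T, h) (U, k)
    (psi, e') (phi, e))).
- by move=> S T phi x; apply: (congr1 (@^~ x) (@nt_nat _ _ _ _ f S T phi)).
- by move=> S' S'' u v x y; apply: (cyc_ntP f).
- by move=> *; apply: mctr_sym.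
- by move=> *; apply: mcomp_sym.
- by move=> *; apply: mcomp_assoc.
- by move=> *; apply: mctr_ctr.
- by move=> *; apply: mctr_comp.
- by move=> *; apply: mcomp_ctr.
- by move=> *; apply: mcomp_equiv.
- by move=> *; apply: mctr_equiv.
Qed.

Lemma eval_repr S g (t : term S g) : eval (env_repr (env_pi t)) = eval t.
Proof. exact/eval_eq/env_repr_pi. Qed.

Definition env_eval (X : Fin * nat) : env X.1 X.2 -> Q X :=
  match X with (V, g) => fun q : env V g => eval (env_repr q) end.

Definition env_lift_nt : nat_trans env_functor Q.
Proof.
exists env_eval.
case=> S g [T h] [phi e]; apply: functional_extensionality_dep.
by apply: env_ind => t /=; rewrite envE !eval_repr.
Defined.

Definition env_lift : mod_mor env_operad Q.
Proof.
exists env_lift_nt.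
- move=> S' S'' g' g'' u v; apply: env_ind => s; apply: env_ind => t.
  by rewrite /= envE !eval_repr.
- by move=> S g u v uv; apply: env_ind => t; rewrite /= envE !eval_repr.
Defined.
End Lift.
End Envelope.

Theorem Mod_exists : exists Mod : functor CycOp ModOp, left_adjoint Mod Box.
Proof.
apply: (@left_adjoint_of_universal CycOp ModOp Box env_operad env_unit
  env_lift).
- move=> P Q f; apply: cyc_mor_eq => S x /=.
  exact (@eval_eq P Q f S 0 _ _ (env_repr_pi (t_in x))).
- move=> P Q h k E; apply: mod_mor_eq => -[S g]; apply: env_ind.
  have Eh S0 g0 (t : term P S0 g0) : h (S0, g0) (env_pi t) = k (S0, g0) (env_pi t).
    elim: t => {S0 g0} [S0 x|S0 T0 g0 h0 phi e t IH|S1 S2 g1 g2 u v s IHs t IHt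
                       |S0 g0 u v uv t IH].
    + exact: (congr1 (fun a : cyc_mor P (box_ob Q) => a S0 x) E).
    + have nat (a : mod_mor (env_operad P) Q) :=
        congr1 (@^~ (env_pi t)) (@nt_nat _ _ _ _ a (S0, g0) (T0, h0) (phi, e)).
      have := nat h; have := nat k; rewrite /= envE => -> ->.
      by rewrite IH.
    + by rewrite -envE; have /= -> := mod_nt_comp h u v (env_pi s) (env_pi t);
      have /= -> := mod_nt_comp k u v (env_pi s) (env_pi t); rewrite IHs IHt.
    + by rewrite -envE; have /= -> := mod_nt_ctr h uv (env_pi t);
      have /= -> := mod_nt_ctr k uv (env_pi t); rewrite IH.
  exact: Eh.
Qed.
Section NsEnvelope.
Variable P : ns_cyc_operad.

Inductive nterm : mcset -> nat -> Type :=
| nt_in (C : {S : mcset | #|idx S| = 1}) : P C -> nterm (sval C) 0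
| nt_act (S T : mcset) g h : mciso S T -> g = h -> nterm S g -> nterm T h
| nt_comp (S' S'' : mcset) g' g'' (u : S') (v : S'') :
    nterm S' g' -> nterm S'' g'' -> nterm (mglue u v) (g' + g'')
| nt_ctr (S : mcset) g (u v : S) :
    u != v -> nterm S g -> nterm (mdel u v) g.+1.

Inductive nteq : forall S g, nterm S g -> nterm S g -> Prop :=
| nteq_refl S g (t : nterm S g) : nteq t t
| nteq_sym S g (s t : nterm S g) : nteq s t -> nteq t s
| nteq_trans S g (s t r : nterm S g) : nteq s t -> nteq t r -> nteq s r
| nteq_act S T g h (phi : mciso S T) (e : g = h) (s t : nterm S g) :
    nteq s t -> nteq (nt_act phi e s) (nt_act phi e t)
| nteq_comp (S' S'' : mcset) g' g'' (u : S') (v : S'')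
    (s s' : nterm S' g') (t t' : nterm S'' g'') :
    nteq s s' -> nteq t t' -> nteq (nt_comp u v s t) (nt_comp u v s' t')
| nteq_ctr (S : mcset) g (u v : S) (uv : u != v) (s t : nterm S g) :
    nteq s t -> nteq (nt_ctr uv s) (nt_ctr uv t)
| nteq_act1 S g (t : nterm S g) :
    nteq (nt_act (idm (S : MultCyc) : mciso S S) erefl t) t
| nteq_actM S T U g h k (phi : mciso S T) (psi : mciso T U) (e : g = h) (f : h = k)
    (t : nterm S g) :
    nteq (nt_act (@cmp MultCyc S T U psi phi : mciso S U) (etrans e f) t)
      (nt_act psi f (nt_act phi e t))
| nteq_in_act (C D : Cyc) (phi : mciso (cset C) (cset D)) (x : P C) :
    nteq (nt_in (@fmap _ _ P C D phi x)) (nt_act phi erefl (nt_in x))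
| nteq_in_comp (C' C'' : Cyc) (u : cset C') (v : cset C'') (x : P C')
    (y : P C'') :
    nteq (nt_in (nccomp u v x y) : nterm _ (0 + 0)) (nt_comp u v (nt_in x) (nt_in y))
| nteq_ctr_sym (S : mcset) g (u v : S) (uv : u != v) (vu : v != u)
    (x : nterm S g) (phi : mciso (mdel u v) (mdel v u)) :
    can_del_sym phi ->
    nteq (nt_act phi erefl (nt_ctr uv x)) (nt_ctr vu x)
| nteq_comp_sym (S' S'' : mcset) g' g'' (u : S') (v : S'')
    (x : nterm S' g') (y : nterm S'' g'') (phi : mciso (mglue u v) (mglue v u)) :
    can_glue_sym phi ->
    nteq (nt_act phi (addnC g' g'') (nt_comp u v x y)) (nt_comp v u y x)
| nteq_comp_assoc (S1 S2 S3 : mcset) g1 g2 g3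
    (a : S1) (b c : S2) (d : S3) (b' : mglue c d) (c' : mglue a b) :
    val b' = inl b -> val c' = inr c ->
    forall (x : nterm S1 g1) (y : nterm S2 g2)
      (z : nterm S3 g3) (phi : mciso (mglue a b') (mglue c' d)),
    can_glue_assoc phi ->
    nteq (nt_act phi (addnA g1 g2 g3) (nt_comp a b' x (nt_comp c d y z)))
      (nt_comp c' d (nt_comp a b x y) z)
| nteq_ctr_ctr (S : mcset) g (a b c d : S)
    (a' b' : mdel c d) (c' d' : mdel a b) :
    val a' = a -> val b' = b -> val c' = c -> val d' = d ->
    forall (ab : a != b) (cd : c != d) (ab' : a' != b') (cd' : c' != d')
      (x : nterm S g) (phi : mciso (mdel a' b') (mdel c' d')),
    can_del_del phi ->
    nteq (nt_act phi erefl (nt_ctr ab' (nt_ctr cd x))) (nt_ctr cd' (nt_ctr ab x))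
| nteq_ctr_comp (S' S'' : mcset) g' g''
    (a c : S') (b d : S'') (a' b' : mglue c d) (c' d' : mglue a b) :
    val a' = inl a -> val b' = inr b -> val c' = inl c -> val d' = inr d ->
    forall (ab' : a' != b') (cd' : c' != d')
      (x : nterm S' g') (y : nterm S'' g'')
      (phi : mciso (mdel a' b') (mdel c' d')),
    can_del_del (S := munion S' S'') phi ->
    nteq (nt_act phi erefl (nt_ctr ab' (nt_comp c d x y)))
      (nt_ctr cd' (nt_comp a b x y))
| nteq_comp_ctr (S' S'' : mcset) g' g''
    (a c d : S') (b : S'') (a' : mdel c d) (c' d' : mglue a b) :
    val a' = a -> val c' = inl c -> val d' = inl d ->
    forall (cd : c != d) (cd' : c' != d')
      (x : nterm S' g') (y : nterm S'' g'')
      (phi : mciso (mglue a' b) (mdel c' d')),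
    can_glue_del phi ->
    nteq (nt_act phi (addSn g' g'') (nt_comp a' b (nt_ctr cd x) y))
      (nt_ctr cd' (nt_comp a b x y))
| nteq_comp_equiv (S' S'' T' T'' : mcset) g' g''
    (rho : mciso S' T') (sigma : mciso S'' T'') (u : S') (v : S'')
    (x : nterm S' g') (y : nterm S'' g'') :
    nteq (nt_act (mglue_iso rho sigma u v) erefl (nt_comp u v x y))
      (nt_comp (rho u) (sigma v) (nt_act rho erefl x) (nt_act sigma erefl y))
| nteq_ctr_equiv (S T : mcset) g (rho : mciso S T) (u v : S)
    (uv : u != v) (uv' : rho u != rho v) (x : nterm S g) :
    nteq (nt_act (mdel_iso rho u v) erefl (nt_ctr uv x))
      (nt_ctr uv' (nt_act rho erefl x)).

Definition nenv S g : Type := quot (@nteq S g).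
Definition nenv_pi S g (t : nterm S g) : nenv S g := quot_pi (@nteq S g) t.
Definition nenv_repr S g (q : nenv S g) : nterm S g := quot_repr q.

Lemma nenv_eq S g (s t : nterm S g) : nteq s t -> nenv_pi s = nenv_pi t.
Proof. exact: (quot_piE (@nteq_sym S g) (@nteq_trans S g)). Qed.
Lemma nenv_reprK S g (q : nenv S g) : nenv_pi (nenv_repr q) = q.
Proof. exact: quot_reprK. Qed.
Lemma nenv_repr_pi S g (t : nterm S g) : nteq (nenv_repr (nenv_pi t)) t.
Proof. exact: (quot_repr_pi (@nteq_refl S g)). Qed.

Definition nenv_act S T g h (phi : mciso S T) (e : g = h) (q : nenv S g) : nenv T h :=
  nenv_pi (nt_act phi e (nenv_repr q)).
Definition nenv_comp (S' S'' : mcset) g' g'' (u : S') (v : S'')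
    (p : nenv S' g') (q : nenv S'' g'') : nenv (mglue u v) (g' + g'') :=
  nenv_pi (nt_comp u v (nenv_repr p) (nenv_repr q)).
Definition nenv_ctr (S : mcset) g (u v : S) (uv : u != v) (q : nenv S g) :
    nenv (mdel u v) g.+1 :=
  nenv_pi (nt_ctr uv (nenv_repr q)).

Lemma nenv_actE S T g h (phi : mciso S T) (e : g = h) (t : nterm S g) :
  nenv_act phi e (nenv_pi t) = nenv_pi (nt_act phi e t).
Proof. by apply: nenv_eq; apply: nteq_act; apply: nenv_repr_pi. Qed.
Lemma nenv_compE (S' S'' : mcset) g' g'' (u : S') (v : S'')
    (s : nterm S' g') (t : nterm S'' g'') :
  nenv_comp u v (nenv_pi s) (nenv_pi t) = nenv_pi (nt_comp u v s t).
Proof. by apply: nenv_eq; apply: nteq_comp; apply: nenv_repr_pi. Qed.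
Lemma nenv_ctrE (S : mcset) g (u v : S) (uv : u != v) (t : nterm S g) :
  nenv_ctr uv (nenv_pi t) = nenv_pi (nt_ctr uv t).
Proof. by apply: nenv_eq; apply: nteq_ctr; apply: nenv_repr_pi. Qed.
Definition nenvE := (nenv_actE, nenv_compE, nenv_ctrE).

Lemma nenv_ind S g (Q : nenv S g -> Prop) :
  (forall t, Q (nenv_pi t)) -> forall q, Q q.
Proof. by move=> H q; rewrite -(nenv_reprK q). Qed.

Definition nenv_functor : ns_modular_module.
Proof.
exists (fun X => nenv X.1 X.2 : Sets) (fun X Y f => nenv_act f.1 f.2).
- move=> X; apply: functional_extensionality_dep; apply: nenv_ind => t.
  by rewrite nenvE; apply: nenv_eq; apply: nteq_act1.
- move=> X Y Z g f; apply: functional_extensionality_dep; apply: nenv_ind => t.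
  by rewrite /= !nenvE; apply: nenv_eq; apply: nteq_actM.
Defined.

Lemma nterm_geometric S g (t : nterm S g) : geometric S g.
Proof.
elim: t => {S g} [[S e] x|S T g h phi e _|S' S'' g' g'' u v _ H' _ H''
                 |S g u v _ _] /=.
- by exists 0; rewrite e.
- exact: (geometric_iso phi e).
- exact: geometric_mglue.
- exact: geometric_mdel.
Qed.

Definition nenv_operad : ns_mod_operad.
Proof.
exists nenv_functor nenv_comp nenv_ctr; rewrite /nmod_at /nmod_act /=.
- by move=> S g x; apply: (nterm_geometric (nenv_repr x)).
- move=> S g u v uv vu x phi H; elim/nenv_ind: x => x; rewrite !nenvE.
  exact/nenv_eq/nteq_ctr_sym.
- move=> S' S'' g' g'' u v x y phi H; elim/nenv_ind: x => x.
  elim/nenv_ind: y => y; rewrite !nenvE; exact/nenv_eq/nteq_comp_sym.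
- move=> S1 S2 S3 g1 g2 g3 a b c d b' c' Hb Hc x y z phi H.
  elim/nenv_ind: x => x; elim/nenv_ind: y => y; elim/nenv_ind: z => z.
  rewrite !nenvE; exact/nenv_eq/nteq_comp_assoc.
- move=> S g a b c d a' b' c' d' Ha Hb Hc Hd ab cd ab' cd' x phi H.
  elim/nenv_ind: x => x; rewrite !nenvE.
  exact/nenv_eq/(nteq_ctr_ctr Ha Hb Hc Hd).
- move=> S' S'' g' g'' a c b d a' b' c' d' Ha Hb Hc Hd ab' cd' x y phi H.
  elim/nenv_ind: x => x; elim/nenv_ind: y => y; rewrite !nenvE.
  exact/nenv_eq/(nteq_ctr_comp Ha Hb Hc Hd).
- move=> S' S'' g' g'' a c d b a' c' d' Ha Hc Hd cd cd' x y phi H.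
  elim/nenv_ind: x => x; elim/nenv_ind: y => y; rewrite !nenvE.
  exact/nenv_eq/(nteq_comp_ctr Ha Hc Hd).
- move=> S' S'' T' T'' g' g'' rho sigma u v x y.
  elim/nenv_ind: x => x; elim/nenv_ind: y => y; rewrite !nenvE.
  exact/nenv_eq/nteq_comp_equiv.
- move=> S T g rho u v uv uv' x; elim/nenv_ind: x => x; rewrite !nenvE.
  exact/nenv_eq/nteq_ctr_equiv.
Defined.

Definition nenv_unit : ns_cyc_mor P (ns_box_ob nenv_operad).
Proof.
unshelve eexists.
  exists (fun S x => nenv_pi (nt_in x)) => S T phi.
  apply: functional_extensionality_dep => x /=; rewrite nenvE.
  exact/nenv_eq/nteq_in_act.
move=> S' S'' u v x y /=; rewrite nenvE; exact/nenv_eq/nteq_in_comp.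
Defined.

Section NsLift.
Variables (Q : ns_mod_operad) (f : ns_cyc_mor P (ns_box_ob Q)).

Fixpoint neval S g (t : nterm S g) : nmod_at Q S g :=
  match t with
  | nt_in V x => f V x
  | nt_act _ _ _ _ phi e t => nmod_act Q phi e (neval t)
  | nt_comp _ _ _ _ u v s t => nmcomp u v (neval s) (neval t)
  | nt_ctr _ _ _ _ uv t => nmctr uv (neval t)
  end.

Lemma neval_eq S g (s t : nterm S g) : nteq s t -> neval s = neval t.
Proof.
elim=> {S g s t} //=.
- by move=> S g s t r _ -> _ ->.
- by move=> S T g h phi e s t _ ->.
- by move=> S' S'' g' g'' u v s s' t t' _ -> _ ->.
- by move=> S g u v uv s t _ ->.
- move=> S g t.
  exact: (congr1 (@^~ (neval t)) (fmap1 Q (S, g))).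
- move=> S T U g h k phi psi e e' t.
  exact: (congr1 (@^~ (neval t)) (@fmapM _ _ Q (S, g) (T, h) (U, k)
    (psi, e') (phi, e))).
- by move=> C D phi x; apply: (congr1 (@^~ x) (@nt_nat _ _ _ _ f C D phi)).
- by move=> S' S'' u v x y; apply: (ncyc_ntP f).
- by move=> *; apply: nmctr_sym.
- by move=> *; apply: nmcomp_sym.
- by move=> *; apply: nmcomp_assoc.
- by move=> *; apply: nmctr_ctr.
- by move=> *; apply: nmctr_comp.
- by move=> *; apply: nmcomp_ctr.
- by move=> *; apply: nmcomp_equiv.
- by move=> *; apply: nmctr_equiv.
Qed.

Lemma neval_repr S g (t : nterm S g) : neval (nenv_repr (nenv_pi t)) = neval t.
Proof. exact/neval_eq/nenv_repr_pi. Qed.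

Definition nenv_eval (X : MultCyc * nat) : nenv X.1 X.2 -> Q X :=
  match X with (V, g) => fun q : nenv V g => neval (nenv_repr q) end.

Definition nenv_lift_nt : nat_trans nenv_functor Q.
Proof.
exists nenv_eval.
case=> S g [T h] [phi e]; apply: functional_extensionality_dep.
by apply: nenv_ind => t /=; rewrite nenvE !neval_repr.
Defined.

Definition nenv_lift : ns_mod_mor nenv_operad Q.
Proof.
exists nenv_lift_nt.
- move=> S' S'' g' g'' u v; apply: nenv_ind => s; apply: nenv_ind => t.
  by rewrite /= nenvE !neval_repr.
- by move=> S g u v uv; apply: nenv_ind => t; rewrite /= nenvE !neval_repr.
Defined.
End NsLift.
End NsEnvelope.

Theorem ns_Mod_exists : exists nsMod : functor NsCycOp NsModOp, left_adjoint nsMod ns_Box.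
Proof.
apply: (@left_adjoint_of_universal NsCycOp NsModOp ns_Box nenv_operad nenv_unit
  nenv_lift).
- move=> P Q f; apply: ns_cyc_mor_eq => S x /=.
  exact (@neval_eq P Q f (sval S) 0 _ _ (nenv_repr_pi (nt_in x))).
- move=> P Q h k E; apply: ns_mod_mor_eq => -[S g]; apply: nenv_ind.
  have Eh S0 g0 (t : nterm P S0 g0) : h (S0, g0) (nenv_pi t) = k (S0, g0) (nenv_pi t).
    elim: t => {S0 g0} [S0 x|S0 T0 g0 h0 phi e t IH|S1 S2 g1 g2 u v s IHs t IHt
                       |S0 g0 u v uv t IH].
    + exact: (congr1 (fun a : ns_cyc_mor P (ns_box_ob Q) => a S0 x) E).
    + have nat (a : ns_mod_mor (nenv_operad P) Q) :=
        congr1 (@^~ (nenv_pi t)) (@nt_nat _ _ _ _ a (S0, g0) (T0, h0) (phi, e)).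
      have := nat h; have := nat k; rewrite /= nenvE => -> ->.
      by rewrite IH.
    + by rewrite -nenvE; have /= -> := nmod_nt_comp h u v (nenv_pi s) (nenv_pi t);
      have /= -> := nmod_nt_comp k u v (nenv_pi s) (nenv_pi t); rewrite IHs IHt.
    + by rewrite -nenvE; have /= -> := nmod_nt_ctr h uv (nenv_pi t);
      have /= -> := nmod_nt_ctr k uv (nenv_pi t); rewrite IH.
  exact: Eh.
Qed.

(* Main.v *)
From mathcomp Require Import all_boot.
From mathcomp Require Import boolp zify.
Require Import Defs.

(** The unit of the adjunction makes the envelope of a terminal operad initial
among morphisms out of that operad; [left_adjoint_iso] therefore reduces both
isomorphisms to an extension property: a morphism [f] from the terminal cyclic
operad to the cyclic operad underlying [Q] must extend to the terminal modular
operad.  In other words, among the composites in [Q] of the elements given by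
[f] there has to be exactly one of each arity and genus (with the arity and the
genus geometric, in the version with cyclic orders).

Without cyclic orders this is immediate: an element of genus [g] is obtained from
the planar element by contracting [g] pairs of additional points ([loops]), and
all choices of pairs are conjugate under bijections.

With cyclic orders it is the cut and paste argument of the classification of
surfaces.  Call [gen] the elements composed from those of [f].  A [gen] element
of positive genus is a contraction of a [gen] element of genus one less
([gen_cases]), which is known by induction; so one has to compare two
contractions with the same target.  The tool is the surgery [surg u v], which is
contraction except that the points [u] and [v] are kept.  On successor
permutations it is composition with the transposition of [u] and [v]
([surg_succ]).  Hence surgery is an involution ([surg_surg]), surgeries along
disjoint pairs commute ([surg_commute]), and a way to write an element over [S] as a
contraction is the same as an [arc]: two points inserted into [S], the set before
the contraction being the result of the surgery at these points.

Any two arcs over [S] can be drawn in a common enlargement [X] of [S]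
([amalgam]), with distinct ends [u], [v] and [c], [d].  Surgery at both gives a
set [Y]; contracting both pairs in the part of [Y] made of [S] and the four ends
gives back [S].  If [c] and [d] lie on different circles
after the surgery at [u], [v], then [Y] has few enough components to carry a
[gen] element of genus two less, and since contractions commute both arcs give
the same element ([arc_step]).  Otherwise there are two cases ([arc_eq]).  If
both arcs join the same two components of [S], then [Y] is the union of a circle
and of the other components, and the relation between contraction and composition
applies instead ([exchange_comp]).  If the ends of each arc lie on one circle,
and the arcs do not cross, both are compared with a third arc, whose ends are
separated by the surgery at the ends of each of them.

The relations of an operad hold along canonical isomorphisms, which must be shown
to exist.  They are obtained from isomorphisms between iterated surgeries, where
the points are fixed and naturality in the set can be checked ([link_natural],
[comps_match_square]). *)

Set Implicit Arguments.
Unset Strict Implicit.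
Unset Printing Implicit Defensive.

(** * Isomorphisms from universal properties *)

(** The extension [m] is inverse to the unique map from [F X] to [Y]: by
naturality, their composite on [F X] has the same transpose as the identity. *)
Lemma left_adjoint_iso (C D : category) (F : functor C D) (G : functor D C)
    (X : C) (Y : D) :
  left_adjoint F G -> terminal Y ->
  (forall Z (f : hom X (G Z)), exists m : hom Y Z,
     forall t : hom X (G Y), cmp (fmap G m) t = f) ->
  isomorphic (F X) Y.
Proof.
case=> Phi [Pb Pn] tY H; have [T _] := tY (F X).
have [m Hm] := H (F X) (Phi _ _ (idm (F X))).
exists T, m; split.
- apply: (bij_inj (Pb X (F X))).
  have := Pn X X Y (F X) (idm X) T m.
  by rewrite fmap1 cmpm1 => ->; rewrite cmpm1 Hm.
- by have [k Hk] := tY Y; rewrite (Hk (cmp T m)) (Hk (idm Y)).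
Qed.

Lemma inj_surj_bij (A B : Type) (f : A -> B) :
  injective f -> (forall y, exists x, f x = y) -> bijective f.
Proof. by move=> fI /choice[g gP]; exists g => // x; apply: fI; rewrite gP. Qed.

(** The relations of an operad compare two sets along the bijection over the
identity of points; here the points are seen in [W]. *)
Lemma bij_over (A B : finType) (W : Type) (i : A -> W) (j : B -> W) :
  injective i -> injective j ->
  (forall a, exists b, j b = i a) -> (forall b, exists a, i a = j b) ->
  exists phi : bij A B, forall a, j (phi a) = i a.
Proof.
move=> iI jI /choice[f Hf] /choice[h Hh].
have fh : cancel f h by move=> a; apply: iI; rewrite Hh Hf.
have hf : cancel h f by move=> b; apply: jI; rewrite Hf Hh.
by exists (Bij (Bijective fh hf)).
Qed.

Lemma glue_swap (S' S'' : finType) (v : S'') (u : S') :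
  exists phi : bij (glue v u) (glue u v), forall z, val (phi z) = sum_swap (val z).
Proof.
have swapP (A B : finType) (a : A) (b : B) (z : glue a b) :
    (sum_swap (val z) != inl b) && (sum_swap (val z) != inr a).
  by move: (val z) (valP z) => [x|x] /andP[zl zr]; apply/andP.
apply: bij_over; first 2 last.
- by move=> z; exists (exist _ (sum_swap (val z)) (swapP _ _ _ _ z)).
- move=> z; exists (exist _ (sum_swap (val z)) (swapP _ _ _ _ z)).
  by case: z => -[].
- by move=> [[x|x] Hx] [[y|y] Hy] //= [E]; apply: val_inj => /=; rewrite E.
- exact: val_inj.
Qed.

Lemma glue_del_bij (S' S'' : finType) (a c d : S') (b : S'') (a' : del c d)
    (c' d' : glue a b) :
  val a' = a -> val c' = inl c -> val d' = inl d ->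
  exists phi : bij (glue a' b) (del c' d'), forall z, val (val (phi z)) = orig_d (val z).
Proof.
move=> Ea Ec Ed.
apply: (bij_over (i := fun z : glue a' b => orig_d (val z))
  (j := fun z : del c' d' => val (val z))).
- move=> [[x|x] Hx] [[y|y] Hy] //= [E]; last by apply: val_inj => /=; rewrite E.
  by apply: val_inj => /=; rewrite (val_inj E).
- by move=> x y /val_inj/val_inj.
- move=> z; have w1 : (orig_d (val z) != inl a) && (orig_d (val z) != inr b).
    move: (val z) (valP z) => [x|x] /andP[zl zr]; apply/andP; split=> //=.
    by apply: contra zl => /eqP[E]; apply/eqP; congr inl; apply: val_inj; rewrite Ea -E.
  pose w : glue a b := exist _ (orig_d (val z)) w1.
  have w2 : (w != c') && (w != d').
    rewrite -!(inj_eq val_inj) Ec Ed /=.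
    by case: (val z) => [x|x] //=; rewrite !(inj_eq inl_inj) (valP x).
  by exists (exist _ w w2).
- move=> [[w w1] w2] /=; move: (w2); rewrite -!(inj_eq val_inj) Ec Ed /=.
  case: w w1 {w2} => w w1 w2.
    have w3 : (w != c) && (w != d).
      by case/andP: w2 => /eqP nc /eqP nd; apply/andP; split; apply/eqP => E;
        [apply: nc | apply: nd]; rewrite E.
    have w4 : (inl (exist _ w w3 : del c d) != inl a' :> (del c d + S'')%type) &&
              (inl (exist _ w w3 : del c d) != inr b :> (del c d + S'')%type).
      rewrite andbT; case/andP: w1 => /eqP w1 _; apply/eqP => -[E]; apply: w1.
      by rewrite -Ea -E.
    by exists (exist _ (inl (exist _ w w3 : del c d)) w4).
  have w4 : (inr w != inl a' :> (del c d + S'')%type) &&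
            (inr w != inr b :> (del c d + S'')%type) by case/andP: w1.
  by exists (exist _ (inr w) w4).
Qed.

(** * The modular envelope *)

Section StarM.
Variables (Q : mod_operad) (f : cyc_mor star_C (box_ob Q)).

Lemma mod_act_cmp (S T U : finType) g h k (psi : bij T U) (phi : bij S T)
    (e : g = h) (e' : h = k) (x : mod_at Q S g) :
  mod_act Q psi e' (mod_act Q phi e x) =
  mod_act Q (@cmp Fin S T U psi phi : bij S U) (etrans e e') x.
Proof.
exact/esym/(congr1 (@^~ x) (@fmapM _ _ Q (S, g) (T, h) (U, k) (psi, e') (phi, e))).
Qed.

Lemma mod_act_id (S : finType) g (phi : bij S S) (e : g = g) (x : mod_at Q S g) :
  (forall z, phi z = z) -> mod_act Q phi e x = x.
Proof.
move=> H; rewrite (eq_irrelevance e erefl).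
have -> : phi = idm (S : Fin) by apply: bij_eq.
exact: (congr1 (@^~ x) (fmap1 Q (S, g))).
Qed.

Lemma mod_act_inj (S T : finType) g h (phi : bij S T) (e : g = h) :
  injective (mod_act Q phi e).
Proof.
case: h / e; have [psi psiK phiK] := bfunP phi.
pose phi' := @Bij T S psi (Bijective phiK psiK).
move=> x y /(congr1 (mod_act Q phi' erefl)).
by rewrite !mod_act_cmp !mod_act_id.
Qed.

(** Equivariance of contractions in a form where the ends [u'], [v'] need not be
syntactically [rho u], [rho v]. *)
Lemma mctr_transport (S T T' : finType) g (rho : bij T T') (u v : T) (u' v' : T')
    (uv : u != v) (uv' : u' != v') (x : mod_at Q T g) :
  rho u = u' -> rho v = v' ->
  forall (phi : bij (del u v) S) (psi : bij (del u' v') S),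
  (forall z z', val z' = rho (val z) -> psi z' = phi z) ->
  mod_act Q psi erefl (mctr uv' (mod_act Q rho erefl x)) =
  mod_act Q phi erefl (mctr uv x).
Proof.
move=> Eu Ev; subst u' v' => phi psi H; rewrite -mctr_equiv mod_act_cmp.
by congr (mod_act Q _ _ _); apply: bij_eq => z /=; apply: H.
Qed.

Lemma inr_neq (S : finType) : (inr true : S + bool) != inr false.
Proof. by []. Qed.

Lemma del_bool_exists (S : finType) :
  exists phi : bij (del (inr true : S + bool)%type (inr false)) S,
    forall z, inl (phi z) = val z.
Proof.
apply: bij_over; [exact: val_inj | by move=> x y [] | |].
- by case=> -[s|[]] //= _; exists s.
- by move=> s; exists (exist _ (inl s : S + bool)%type isT).
Qed.

Definition del_bool (S : finType) := sval (cid (del_bool_exists S)).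

(** The image of the point of genus [g]: a composite of genus [g] is a graph of
first Betti number [g], and it is enough to consider those with one vertex. *)
Fixpoint loops (g : nat) : forall S : finType, mod_at Q S g :=
  match g with
  | 0 => fun S => f S tt
  | g'.+1 => fun S =>
     mod_act Q (del_bool S) erefl (mctr (inr_neq S) (loops g' (S + bool)%type))
  end.

(** A bijection takes any pair of points to the pair used in the definition of
[loops], so equivariance allows to contract any other pair. *)
Lemma loops_ctr_of_act g :
  (forall (S T : finType) (phi : bij S T),
     mod_act Q phi erefl (loops g S) = loops g T) ->
  forall (S T : finType) (u v : T) (uv : u != v) (phi : bij (del u v) S),
    mod_act Q phi erefl (mctr uv (loops g T)) = loops g.+1 S.
Proof.
move=> IH S T u v uv phi.
(* [r] extends [phi] by taking [u], [v] to the added pair. *)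
pose r (x : T) : S + bool :=
  if x == u then inr true else if x == v then inr false else
  if insub x is Some z then inl (phi z) else inr true.
have ru : r u = inr true by rewrite /r eqxx.
have rv : r v = inr false by rewrite /r eqxx eq_sym (negbTE uv).
have rd (z : del u v) : r (val z) = inl (phi z).
  by case/andP: (valP z) => zu zv; rewrite /r (negbTE zu) (negbTE zv) valK.
have [psi psiK phiK] := bfunP phi.
pose r' (y : S + bool) : T :=
  match y with inl s => val (psi s) | inr b => if b then u else v end.
have rK : cancel r r'.
  move=> x; case: (boolP ((x != u) && (x != v))) => [xuv|].
    by rewrite -[x]/(val (exist _ x xuv : del u v)) rd /= psiK.
  by rewrite negb_and !negbK => /orP[/eqP->|/eqP->]; rewrite ?ru ?rv.
have r'K : cancel r' r.
  by case=> [s|[]] /=; rewrite ?ru ?rv // rd phiK.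
pose rho : bij T (S + bool)%type := Bij (Bijective rK r'K).
have uv' : rho u != rho v by rewrite /= ru rv.
rewrite -(mctr_transport (rho := rho) uv (inr_neq S) _ ru rv
  (psi := del_bool S) (phi := phi)).
  by rewrite IH.
move=> z z' Ez'; have Ez'' := svalP (cid (del_bool_exists S)) z'.
by move: Ez''; rewrite Ez' [bfun rho _]rd => -[].
Qed.

Lemma loops_act g h (S T : finType) (phi : bij S T) (e : g = h) :
  mod_act Q phi e (loops g S) = loops h T.
Proof.
case: h / e; elim: g S T phi => [|g IH] S T phi.
  exact/esym/(congr1 (@^~ tt) (@nt_nat _ _ _ _ f S T phi)).
rewrite [in LHS]/= mod_act_cmp; exact: loops_ctr_of_act.
Qed.

Lemma loops_ctr g (T : finType) (u v : T) (uv : u != v) :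
  mctr uv (loops g T) = loops g.+1 (del u v).
Proof.
rewrite -(loops_ctr_of_act (fun S T phi => loops_act phi erefl) uv
  (idm (del u v : Fin) : bij (del u v) (del u v))).
by rewrite mod_act_id.
Qed.

(** A contraction in the first factor can be performed after the composition,
which reduces the genus of that factor. *)
Lemma loops_comp_step g' g'' :
  (forall (S' S'' : finType) (u : S') (v : S''),
     mcomp u v (loops g' S') (loops g'' S'') = loops (g' + g'') (glue u v)) ->
  forall (S' S'' : finType) (u : S') (v : S''),
    mcomp u v (loops g'.+1 S') (loops g'' S'') = loops (g'.+1 + g'') (glue u v).
Proof.
move=> IH S' S'' u v.
have [psi psiK phiK] := bfunP (del_bool S').
pose c : (S' + bool)%type := inr true; pose d : (S' + bool)%type := inr false.
pose u' : del c d := psi u; rewrite -(phiK u) -/u'.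
rewrite -(loops_act (idm (S'' : Fin) : bij S'' S'') erefl).
rewrite [in LHS]/= -(@mcomp_equiv Q (del c d) S'' S' S'' g'.+1 g'' (del_bool S')
  (idm (S'' : Fin) : bij S'' S'') u' v).
have cP : (inl c != inl (val u') :> ((S' + bool) + S'')%type) &&
          (inl c != inr v :> ((S' + bool) + S'')%type).
  by case/andP: (valP u') => /eqP cu _; rewrite andbT; apply/eqP => -[/esym].
have dP : (inl d != inl (val u') :> ((S' + bool) + S'')%type) &&
          (inl d != inr v :> ((S' + bool) + S'')%type).
  by case/andP: (valP u') => _ /eqP du; rewrite andbT; apply/eqP => -[/esym].
pose c' : glue (val u') v := exist _ (inl c) cP.
pose d' : glue (val u') v := exist _ (inl d) dP.
have cd' : c' != d' by [].
have [phi Hphi] := @glue_del_bij _ S'' _ c d v u' c' d' erefl erefl erefl.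
have := @mcomp_ctr Q _ _ g' g'' (val u') c d v u' c' d' erefl erefl erefl
  (inr_neq S') cd' (loops g' _) (loops g'' S'') phi Hphi.
rewrite IH [mctr cd' _]loops_ctr -(loops_act phi (addSn g' g'')
  : mod_act Q phi _ (loops (g'.+1 + g'') _) = _).
by move/mod_act_inj => ->; rewrite loops_act.
Qed.

Lemma loops_comp g' g'' (S' S'' : finType) (u : S') (v : S'') :
  mcomp u v (loops g' S') (loops g'' S'') = loops (g' + g'') (glue u v).
Proof.
elim: g' S' S'' u v => [|g' IH]; last exact: loops_comp_step.
elim: g'' => [|g'' IH] S' S'' u v.
  exact/esym/(@cyc_ntP _ _ f S' S'' u v tt tt).
have [phi Hphi] := glue_swap v u.
rewrite -(mcomp_sym _ _ Hphi) loops_comp_step ?loops_act //.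
move=> T' T'' u' v'.
have [psi Hpsi] := glue_swap v' u'.
by rewrite -(mcomp_sym _ _ Hpsi) IH loops_act.
Qed.
End StarM.

Lemma star_M_extends (Q : ModOp) (f : hom star_C (Box Q)) :
  exists m : hom star_M Q, forall t : hom star_C (Box star_M),
    cmp (fmap Box m) t = f.
Proof.
unshelve eexists.
  unshelve eexists.
  - exists (fun X (_ : star_M X) => match X return Q X with (V, g) => loops f g V end).
    case=> S g [T h] [phi e]; apply: functional_extensionality_dep => _ /=.
    exact/esym/(loops_act f phi e).
  - by move=> S' S'' g' g'' u v [] [] /=; rewrite (loops_comp f).
  - by move=> S g u v uv [] /=; rewrite (loops_ctr f).
by move=> t; apply: cyc_mor_eq => S [].
Qed.

(** * Cyclic orders and successors *)

Section CyclicOrder.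
Variable S : mcset.
Implicit Types u v x y z : S.

Lemma cyc_rot x y z : cyc x y z -> cyc y z x.
Proof.
move=> H; have [E1 E2] := cyc_comp H; have [H1 _ _ _] := cyc_total (comp x).
by apply: H1 H; rewrite inE ?E1 ?E2.
Qed.

Lemma cyc_asym x y z : cyc x y z -> cyc z y x = false.
Proof.
move=> H; have [E1 E2] := cyc_comp H; have [_ H2 _ _] := cyc_total (comp x).
by apply/negbTE; apply: H2 H; rewrite inE ?E1 ?E2.
Qed.

Lemma cyc_cut u x y z : cyc u x y -> cyc u y z -> cyc x y z.
Proof. by move=> /cyc_rot/cyc_rot H /cyc_rot K; exact: cyc_rot (cyc_rot (cyc_trans K H)). Qed.

(** The linear order obtained by cutting the circle of [u] just after [u], whose
last point is then [u]. *)
Definition cut_lt u x y : bool := (x != u) && ((y == u) || cyc u x y).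

Lemma cut_lt_irr u x : cut_lt u x x = false.
Proof. by rewrite /cut_lt cyc_irr; case: eqP. Qed.

Lemma cut_lt_trans u y x z : cut_lt u x y -> cut_lt u y z -> cut_lt u x z.
Proof.
rewrite /cut_lt => /andP[-> H] /andP[/negbTE yu]; move: H; rewrite yu /=.
by case: eqP => //= _; apply: cyc_trans.
Qed.

Lemma cut_lt_total u x y : comp x = comp u -> comp y = comp u -> x != y ->
  cut_lt u x y || cut_lt u y x.
Proof.
rewrite /cut_lt => xc yc xy.
case: (eqVneq x u) xy => [->|xu]; first by rewrite eq_sym => ->.
case: (eqVneq y u) => [->//|yu] xy /=.
by apply: cyc_tot; rewrite // eq_sym.
Qed.

Lemma cyc_cut_lt u x y z : comp x = comp u -> comp y = comp u -> comp z = comp u ->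
  cyc x y z = cyc_of_lt (cut_lt u) x y z.
Proof.
have half a b c : comp a = comp u -> comp b = comp u -> comp c = comp u ->
    cut_lt u a b -> cut_lt u b c -> cyc a b c.
  rewrite /cut_lt => ac bc cc /andP[au ab] /andP[/negbTE bu bc'].
  move: ab; rewrite bu /= => ab; case/orP: bc' => [/eqP->|]; first exact: cyc_rot.
  exact: cyc_cut.
have halves a b c : comp a = comp u -> comp b = comp u -> comp c = comp u ->
    cyc_of_lt (cut_lt u) a b c -> cyc a b c.
  move=> ac bc cc /or3P[]/andP[p q]; first exact: half.
    by apply/cyc_rot/cyc_rot/half.
  by apply/cyc_rot/half.
move=> xc yc zc; apply/idP/idP; last exact: halves.
move=> H; have nxy : x != y.
  by apply/eqP => E; move: (cyc_rot (cyc_rot H)); rewrite E cyc_irr.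
have nyz : y != z by apply/eqP => E; move: H; rewrite E cyc_irr.
have nzx : z != x.
  by apply/eqP => E; move: (cyc_rot H); rewrite E cyc_irr.
have {}H : ~~ cyc_of_lt (cut_lt u) z y x.
  by apply/negP => /(halves _ _ _ zc yc xc); rewrite cyc_asym.
have := cut_lt_total xc yc nxy; have := cut_lt_total yc zc nyz.
have := cut_lt_total zc xc nzx; move: H; rewrite /cyc_of_lt.
have := @cut_lt_trans u x y z; have := @cut_lt_trans u y z x.
have := @cut_lt_trans u z x y.
move: (cut_lt u x y) (cut_lt u y z) (cut_lt u z x) (cut_lt u y x) (cut_lt u z y)
  (cut_lt u x z).
by do 6![case] => //=; intuition.
Qed.

(** Ranks translate statements about a few points of one circle into linear
arithmetic ([cyc_rankP]). *)
Definition cut_rank u x : nat := #|[pred y | (comp y == comp u) && cut_lt u y x]|.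

Lemma cut_rankE u x y : comp x = comp u -> comp y = comp u ->
  (cut_rank u x < cut_rank u y) = cut_lt u x y.
Proof.
have mono a b : comp a = comp u -> cut_lt u a b -> cut_rank u a < cut_rank u b.
  move=> ac ab; apply: proper_card; apply/properP; split.
    apply/subsetP => c; rewrite !inE => /andP[-> /=] ca; exact: cut_lt_trans ab.
  by exists a; rewrite !inE ?ac ?eqxx //= cut_lt_irr.
move=> xc yc; apply/idP/idP; last exact: mono.
case: (eqVneq x y) => [->|xy]; first by rewrite ltnn.
case/orP: (cut_lt_total xc yc xy) => // /(mono _ _ yc) yx.
by move/(ltn_trans yx); rewrite ltnn.
Qed.

Lemma cyc_rankP u : [/\
  forall x y, comp x = comp u -> comp y = comp u ->
    (x == y) = (cut_rank u x == cut_rank u y),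
  forall x y z, comp x = comp u -> comp y = comp u -> comp z = comp u ->
    cyc x y z = cyc_of_lt (fun a b => cut_rank u a < cut_rank u b) x y z &
  forall x, comp x = comp u -> cut_rank u x <= cut_rank u u].
Proof.
split=> [x y xc yc|x y z xc yc zc|x xc].
- apply/eqP/eqP => [->//|E]; apply/eqP/negP => /negP xy.
  by case/orP: (cut_lt_total xc yc xy); rewrite -cut_rankE // E ltnn.
- by rewrite (@cyc_cut_lt u) // /cyc_of_lt !cut_rankE.
- by rewrite leqNgt cut_rankE // /cut_lt eqxx.
Qed.
End CyclicOrder.

(** [s x] is the point met immediately after [x], and [x] itself when [x] is
alone on its circle. *)
Definition is_succ (S : mcset) (s : S -> S) : Prop :=
  forall x, comp (s x) = comp x /\
    forall z, comp z = comp x -> z != x -> (z == s x) || cyc x (s x) z.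

Lemma succ_exists (S : mcset) : exists s : S -> S, is_succ s.
Proof.
suff /choice[s Hs] : forall x : S, exists y : S, comp y = comp x /\
    forall z, comp z = comp x -> z != x -> (z == y) || cyc x y z.
  by exists s.
move=> x; case: (pickP [pred y | (comp y == comp x) && (y != x)]) => [y0 y0P|H].
  case: (arg_minnP (cut_rank x) y0P) => y /andP[/eqP yc yx] ymin.
  exists y; split=> // z zc zx; have [eqE cycE umax] := cyc_rankP x.
  have := ymin z; rewrite inE zc eqxx zx => /(_ isT).
  have := umax z zc; move: zx yx; rewrite !eqE // cycE // /cyc_of_lt; lia.
exists x; split=> // z zc zx; have := H z; by rewrite inE zc eqxx zx.
Qed.

(** Following successors from [x], one meets all points of the circle of [x] in
their cyclic order, so that a map which commutes with successors preserves the
circles and their orders.  Both parts go by induction on the number of points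
which remain to be passed. *)
Lemma succ_pcyc (S T : mcset) (f : S -> T) (s : S -> S) (t : T -> T) :
  injective f -> is_succ s -> is_succ t -> (forall x, f (s x) = t (f x)) ->
  (forall x y, comp x = comp y -> comp (f x) = comp (f y)) /\
  (forall x y z, cyc x y z -> cyc (f x) (f y) (f z)).
Proof.
move=> fI Hs Ht E.
have step x : comp (f (s x)) = comp (f x) by rewrite E; case: (Ht (f x)).
have closer x y : comp x = comp y -> x != y -> s x != y ->
    [/\ cyc x (s x) y &
    #|[pred z | cyc (s x) z y]| < #|[pred z | cyc x z y]|].
  move=> xy nxy nsy; have [sc /(_ y (esym xy))] := Hs x.
  rewrite eq_sym nxy eq_sym (negbTE nsy) => /(_ isT) /= H; split=> //.
  apply: proper_card; apply/properP; split.
    apply/subsetP => z; rewrite !inE => szy.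
    by apply: cyc_rot; apply: cyc_trans (cyc_rot (cyc_rot H)) (cyc_rot (cyc_rot szy)).
  exists (s x); rewrite !inE ?H //.
  by apply/negP => K; move: (cyc_rot (cyc_rot K)); rewrite cyc_irr.
have compP x y : comp x = comp y -> comp (f x) = comp (f y).
  have [n] := ubnP #|[pred z | cyc x z y]|; elim: n x => // n IH x le_n xy.
  case: (eqVneq x y) => [->//|nxy]; case: (eqVneq (s x) y) => [<-//|nsy].
  have [_ lt_n] := closer _ _ xy nxy nsy.
  rewrite -step; apply: IH; first exact: leq_trans lt_n _.
  by case: (Hs x) => ->.
split=> // x y z.
have [n] := ubnP #|[pred w | cyc x w y]|; elim: n x => // n IH x le_n H.
have [xy yz] := cyc_comp H.
have nxy : x != y.
  by apply/eqP => K; move: (cyc_rot (cyc_rot H)); rewrite K cyc_irr.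
have nyz : y != z by apply/eqP => K; move: H; rewrite K cyc_irr.
have nxz : x != z.
  by apply/eqP => K; move: (cyc_rot H); rewrite K cyc_irr.
have [_ tP] := Ht (f x).
have zx' : comp (f z) = comp (f x) by apply: compP; rewrite xy yz.
have := tP _ zx'; rewrite (inj_eq fI) eq_sym nxz => /(_ isT).
case: (eqVneq (s x) y) => [sy|nsy].
  by rewrite -E sy (inj_eq fI) eq_sym (negbTE nyz).
have [K lt_n] := closer _ _ xy nxy nsy.
have K' : cyc (s x) y z by apply: cyc_cut K H.
have := IH _ (leq_trans lt_n le_n) K'.
rewrite -E => C D.
have nsz : s x != z.
  by apply/eqP => F; move: (cyc_rot K'); rewrite F cyc_irr.
rewrite (inj_eq fI) eq_sym (negbTE nsz) /= in D.
by apply: cyc_rot; apply: cyc_trans (cyc_rot (cyc_rot D)) (cyc_rot (cyc_rot C)).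
Qed.

(** * Surgery on multicyclic orders *)

Section Surgery.
Variables (S : mcset) (u v : S).

(** The points [u] and [v] close the interval which precedes them: [v] belongs to
the interval from [u] to [v], and [u] to the one from [v] to [u]. *)
Definition surg_raw (x : S) : idx S + bool :=
  if touched u v x then inr [|| comp u != comp v, x == v | cyc u x v]
  else inl (comp x).

Lemma surg_raw_subproof (x : S) : mdel_index u v (surg_raw x).
Proof.
rewrite /surg_raw /touched; case: ifP => [_|/negbT]; last by rewrite negb_or.
by rewrite /=; case: eqP; rewrite ?orbT.
Qed.

Definition surg_comp (x : S) : mdel_idx u v := exist _ (surg_raw x) (surg_raw_subproof x).

(** The merged circle a_1 < ... < a_k < u < b_1 < ... < b_l < v, where a_1, ...,
a_k and b_1, ..., b_l are the orders cut at [u] and [v]. *)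
Definition surg_lt (x y : S) : bool :=
  if comp x == comp u then (comp y != comp u) || cut_lt u x y
  else (comp y != comp u) && cut_lt v x y.

Definition surg_cyc (x y z : S) : bool :=
  [&& surg_comp x == surg_comp y, surg_comp y == surg_comp z &
      if (comp u != comp v) && touched u v x then cyc_of_lt surg_lt x y z
      else cyc x y z].

Lemma surg_cyc_comp x y z : surg_cyc x y z ->
  surg_comp x = surg_comp y /\ surg_comp y = surg_comp z.
Proof. by case/and3P => /eqP-> /eqP->. Qed.

Lemma surg_ltP : total_cyclic (touched u v) (cyc_of_lt surg_lt).
Proof.
apply: cyc_of_ltP; rewrite /surg_lt /touched.
- by move=> x; rewrite !cut_lt_irr; case: eqP.
- move=> y x z _ _ _.
  case: (comp x == _); case: (comp y == _); case: (comp z == _) => //=;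
  exact: cut_lt_trans.
- move=> x y /orP xc /orP yc xy.
  case: (eqVneq (comp x) (comp u)) xc => [xE _|_ []// /eqP xE];
  case: (eqVneq (comp y) (comp u)) yc => [yE _|_ []// /eqP yE] //=;
  exact: cut_lt_total.
Qed.

Lemma surg_total i : total_cyclic [pred x | surg_comp x == i] surg_cyc.
Proof.
have E3 (A : pred S) (R : S -> S -> S -> bool) :
    total_cyclic A R ->
    (forall x, surg_comp x = i -> x \in A) ->
    (forall x, surg_comp x = i ->
       (if (comp u != comp v) && touched u v x
        then cyc_of_lt surg_lt else cyc) = R) ->
  total_cyclic [pred x | surg_comp x == i] surg_cyc.
  move=> H AP RP; apply: (total_cyclic_sub (@inj_id S) _ _ H).
    by move=> x /eqP/AP.
  move=> x y z /eqP xi /eqP yi /eqP zi.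
  by rewrite /surg_cyc xi yi zi !eqxx /= -(RP x xi); case: ifP.
have raw x : surg_comp x = i -> surg_raw x = val i by move <-.
case Ei : (val i) => [k|b]; last case: (eqVneq (comp u) (comp v)) => uv.
- apply: (E3 _ _ (cyc_total k)) => x /raw; rewrite Ei /surg_raw.
    by case: ifP => // _ [<-]; rewrite inE.
  by case: ifP => //; rewrite andbF.
- apply: (E3 _ _ (cyc_total (comp u))) => x /raw; rewrite Ei /surg_raw.
    by case: ifP => // /orP[/eqP xu|/eqP xv] _; rewrite inE ?xu ?xv ?uv.
  by rewrite uv eqxx.
- apply: (E3 _ _ surg_ltP) => x /raw; rewrite Ei /surg_raw uv; case: ifP => //.
Qed.

(** Contraction with the two points kept.  The components have the same indices
as those of [mdel u v], but surgery does not change the set of points and it can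
be undone. *)
Definition surg : mcset :=
  @MCSet S (mdel_idx u v) surg_comp surg_cyc (mdel_gt0 u v) surg_cyc_comp surg_total.

Lemma surg_comp_del (x : del u v) : surg_comp (val x) = mdel_comp x.
Proof.
apply: val_inj => /=; rewrite /surg_raw /mdel_raw.
by case/andP: (valP x) => _ /negbTE ->.
Qed.

Lemma surg_cyc_del (x y z : del u v) : surg_cyc (val x) (val y) (val z) = mdel_cyc x y z.
Proof.
rewrite /surg_cyc /mdel_cyc !surg_comp_del; do 2![case: eqP => //= _].
have ltE (a b : del u v) : surg_lt (val a) (val b) = merged_lt u v (val a) (val b).
  case/andP: (valP a) => au av; case/andP: (valP b) => bu bv.
  by rewrite /surg_lt /merged_lt /cut_lt au av (negbTE bu) (negbTE bv).
by rewrite /cyc_of_lt !ltE.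
Qed.

Definition del_surg : emb (mdel u v) surg :=
  @Emb (mdel u v) surg val id val_inj (inv_bij (fun=> erefl)) surg_comp_del surg_cyc_del.

(** The successor after surgery: [s] composed with the transposition of [u] and
[v]. *)
Definition surg_perm (s : S -> S) (x : S) : S :=
  s (if x == u then v else if x == v then u else x).

(** Away from the circles of [u] and [v] nothing changes; on these circles the
claim compares a few ranks in the orders cut at [u] and [v]. *)
Lemma surg_succ (s : S -> S) : is_succ s -> u != v -> is_succ (surg_perm s : surg -> surg).
Proof.
move=> Hs uv.
have untouched (x : S) : ~~ touched u v x ->
    surg_comp (surg_perm s x) = surg_comp x /\
    forall z, surg_comp z = surg_comp x -> z != x ->
      (z == surg_perm s x) || surg_cyc x (surg_perm s x) z.
  move=> xt; have xuv : (x != u) && (x != v).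
    by apply: contraR xt; rewrite negb_and !negbK /touched => /orP[]/eqP->;
      rewrite eqxx ?orbT.
  case/andP: xuv => /negbTE xu /negbTE xv; rewrite /surg_perm xu xv.
  have [sx1 sx2] := Hs x.
  have rawx y : comp y = comp x -> surg_comp y = surg_comp x.
    by move: xt; rewrite /touched => /negbTE xt yx; apply: val_inj;
      rewrite /= /surg_raw /touched yx xt.
  split=> [|z zx znx]; first exact: rawx.
  rewrite /surg_cyc zx (rawx _ sx1) !eqxx (negbTE xt) andbF /=; apply: sx2 => //.
  move/(congr1 val): zx; rewrite /= /surg_raw (negbTE xt).
  by case: ifP => // _ [].
have [su1 su2] := Hs u; have [sv1 sv2] := Hs v.
have [equ cycu umax] := cyc_rankP u; have [eqv cycv vmax] := cyc_rankP v.
suff H (x : S) : surg_comp (surg_perm s x) = surg_comp x /\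
    forall z : S, surg_comp z = surg_comp x -> z != x ->
      (z == surg_perm s x) || surg_cyc x (surg_perm s x) z by exact: H.
case: (boolP (touched u v x)) => [xt|/untouched//].
have [sx1 sx2] := Hs x.
case: (eqVneq (comp u) (comp v)) => cuv.
- have xu : comp x = comp u by case/orP: xt => /eqP->.
  have tE y : comp y = comp u -> touched u v y by rewrite /touched => ->; rewrite eqxx.
  have rawE y : comp y = comp u -> surg_raw y = inr ((y == v) || cyc u y v).
    by move=> yu; rewrite /surg_raw tE // cuv eqxx.
  have yc : comp (surg_perm s x) = comp u.
    by rewrite /surg_perm; case: ifP => _; [rewrite sv1|case: ifP => _; [|rewrite sx1]].
  have vc := esym cuv.
  have yE : surg_comp (surg_perm s x) = surg_comp x.
    apply: val_inj; rewrite /= !rawE //; congr inr; move: yc.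
    rewrite /surg_perm; case: (eqVneq x u) => [xE|nxu].
      subst x => yc; have := sv2 u cuv uv; move: uv (umax _ yc) (umax _ vc).
      rewrite !equ // !cycu // /cyc_of_lt; lia.
    case: (eqVneq x v) => [xE|nxv] yc.
      subst x; have := su2 v vc nxu; move: uv (umax _ yc) (umax _ vc).
      rewrite !equ // !cycu // /cyc_of_lt; lia.
    have := sx2 u (esym xu); have := sx2 v (etrans vc (esym xu)).
    move: uv nxu nxv (umax _ yc) (umax _ vc) (umax _ xu).
    rewrite !equ // !cycu // /cyc_of_lt; lia.
  split=> // z zx zx'; have zc : comp z = comp u.
    move/(congr1 val): zx; rewrite /= (rawE x) // /surg_raw /touched -cuv orbb.
    by case: eqP.
  rewrite /surg_cyc yE zx !eqxx cuv eqxx /=.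
  move/(congr1 val): zx => /=; rewrite !rawE // => -[].
  move: zx' yc; rewrite /surg_perm; case: (eqVneq x u) => [xE|nxu].
    subst x => zx' yc; have := sv2 u cuv uv; have := sv2 z (etrans zc cuv).
    move: uv zx' (umax _ yc) (umax _ vc) (umax _ zc).
    rewrite !equ // !cycu // /cyc_of_lt; lia.
  case: (eqVneq x v) => [xE|nxv] zx' yc.
    subst x; have := su2 v vc nxu; have := su2 z zc.
    move: uv zx' (umax _ yc) (umax _ vc) (umax _ zc).
    rewrite !equ // !cycu // /cyc_of_lt; lia.
  by have := sx2 z (etrans zc (esym xu)) zx'.
- have tE y : comp y = comp u \/ comp y = comp v -> surg_comp y = surg_comp u.
    by move=> yc; apply: val_inj; rewrite /= /surg_raw /touched cuv eqxx /=;
      case: yc => ->; rewrite eqxx ?orbT.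
  have yc : comp (surg_perm s x) = comp u \/ comp (surg_perm s x) = comp v.
    rewrite /surg_perm; case: ifP => _; first by right.
    case: ifP => _; first by left.
    by rewrite sx1; case/orP: xt => /eqP->; [left | right].
  have xc : comp x = comp u \/ comp x = comp v.
    by case/orP: xt => /eqP->; [left | right].
  split; first by rewrite !tE.
  move=> z zx zx'; have zc : comp z = comp u \/ comp z = comp v.
    move: zx; rewrite (tE x) // => /(congr1 val); rewrite /= /surg_raw.
    rewrite {2}/touched eqxx /=; case: ifP => // /orP[]/eqP->; by [left|right].
  rewrite /surg_cyc zx !tE // !eqxx cuv xt /=.
  have nvu : (comp v == comp u) = false by rewrite eq_sym (negbTE cuv).
  have uc := erefl (comp u); have vc := erefl (comp v).
  rewrite /cyc_of_lt /surg_lt; move: zx' yc; rewrite /surg_perm.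
  case: (eqVneq x u) => [xE|nxu].
    subst x => zx' _; rewrite sv1 nvu eqxx /=.
    have := vmax _ sv1; case: zc => zc; rewrite zc ?eqxx ?nvu /=.
      move=> _; apply/orP; right; move: zx' (umax _ zc).
      by rewrite -cut_rankE // !equ //; lia.
    have := sv2 z zc; have := vmax _ zc.
    case: (eqVneq z v) => [->|nzv].
      by rewrite -cut_rankE // !eqv //; lia.
    move=> + /(_ isT); move: nzv; rewrite -!cut_rankE // !eqv // !cycv // /cyc_of_lt.
    lia.
  case: (eqVneq x v) => [xE|nxv].
    subst x => zx' _; rewrite su1 nvu eqxx /=.
    have := umax _ su1; case: zc => zc; rewrite zc ?eqxx ?nvu /=; last first.
      move=> _; apply/orP; right; move: zx' (vmax _ zc).
      by rewrite -cut_rankE // !eqv //; lia.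
    have := su2 z zc; have := umax _ zc.
    case: (eqVneq z u) => [->|nzu].
      by rewrite -cut_rankE // !equ //; lia.
    move=> + /(_ isT); move: nzu; rewrite -!cut_rankE // !equ // !cycu // /cyc_of_lt.
    lia.
  move=> zx' _; case: xc => xc; rewrite sx1 xc ?eqxx ?nvu /=.
    have yc := etrans sx1 xc; have := sx2 u (esym xc); rewrite eq_sym nxu => /(_ isT).
    move: nxu (umax _ xc) (umax _ yc); case: zc => zc; rewrite zc ?eqxx ?nvu /=.
      have := sx2 z (etrans zc (esym xc)); move: zx' => nzx /(_ nzx); move: nzx.
      move: (umax _ zc); rewrite -!cut_rankE // !equ // !cycu // /cyc_of_lt; lia.
    move=> nxu' x_max y_max sx; apply/orP; right; move: nxu' x_max y_max sx.
    rewrite -!cut_rankE // !equ // !cycu // /cyc_of_lt; lia.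
  have yc := etrans sx1 xc; have := sx2 v (esym xc); rewrite eq_sym nxv => /(_ isT).
  move: nxv (vmax _ xc) (vmax _ yc); case: zc => zc; rewrite zc ?eqxx ?nvu /=.
    move=> nxv' x_max y_max sx; apply/orP; right; move: nxv' x_max y_max sx.
    rewrite -!cut_rankE // !eqv // !cycv // /cyc_of_lt; lia.
  have := sx2 z (etrans zc (esym xc)); move: zx' => nzx /(_ nzx); move: nzx.
  move: (vmax _ zc); rewrite -!cut_rankE // !eqv // !cycv // /cyc_of_lt; lia.
Qed.
End Surgery.

(** * Isomorphisms determined by points and successors *)

Section SurgeryEmb.
Variables (S T : mcset) (e : emb S T) (u v : S).

Lemma surg_emb_comp (x : S) : surg_comp (e u) (e v) (e x) = mdel_eidx e (surg_comp u v x).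
Proof.
have eI := bij_inj (eidx_bij e); apply: val_inj => /=.
rewrite /surg_raw /touched !emb_comp !(inj_eq eI) emb_cyc (inj_eq (@epts_inj _ _ e)).
by case: ifP.
Qed.

Lemma surg_emb_cyc (x y z : S) :
  surg_cyc (e u) (e v) (e x) (e y) (e z) = surg_cyc u v x y z.
Proof.
have eI := bij_inj (eidx_bij e).
have ltE (a b : S) : surg_lt (e u) (e v) (e a) (e b) = surg_lt u v a b.
  by rewrite /surg_lt /cut_lt !emb_comp !(inj_eq eI) !emb_cyc !(inj_eq (@epts_inj _ _ e)).
rewrite /surg_cyc !surg_emb_comp !(inj_eq (bij_inj (mdel_eidx_bij e u v))).
by rewrite /cyc_of_lt /touched !ltE !emb_comp !(inj_eq eI) emb_cyc.
Qed.

Definition surg_emb : emb (surg u v) (surg (e u) (e v)) :=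
  @Emb (surg u v) (surg (e u) (e v)) e (@mdel_eidx _ _ e u v) (@epts_inj _ _ e)
    (mdel_eidx_bij e u v) surg_emb_comp surg_emb_cyc.
End SurgeryEmb.

(** Surgeries at provably equal points have different types. *)
Definition surg_cast (S : mcset) (u v u' v' : S) (Eu : u = u') (Ev : v = v') :
  emb (surg u v) (surg u' v') :=
  match Eu in _ = w, Ev in _ = w' return emb (surg u v) (surg w w') with
  | erefl, erefl => emb_id (surg u v)
  end.

Lemma surg_cast_pts (S : mcset) (u v u' v' : S) (Eu : u = u') (Ev : v = v') x :
  surg_cast Eu Ev x = x.
Proof. by case: u' / Eu; case: v' / Ev. Qed.

Lemma surg_cast_idx (S : mcset) (u v u' v' : S) (Eu : u = u') (Ev : v = v') i :
  val (eidx (surg_cast Eu Ev) i) = val i.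
Proof. by case: u' / Eu; case: v' / Ev. Qed.

(** An embedding has bijective components and reflects the cyclic orders, so
factoring it through another one is a matter of points only. *)
Lemma emb_factor (T1 T2 Y : mcset) (e1 : emb T1 Y) (e2 : emb T2 Y) :
  (forall x, exists y, e2 y = e1 x) -> exists phi : emb T1 T2, emb_cmp e2 phi = e1.
Proof.
move=> /choice[f Hf].
have [g1 g1K K1g] := eidx_bij e1; have [g2 g2K K2g] := eidx_bij e2.
have comp_f x : comp (f x) = g2 (eidx e1 (comp x)).
  by apply: (can_inj g2K); rewrite K2g -!emb_comp Hf.
have cyc_f x y z : cyc (f x) (f y) (f z) = cyc x y z.
  by rewrite -(emb_cyc e2) !Hf emb_cyc.
have hb : bijective (g2 \o eidx e1).
  by exists (g1 \o eidx e2) => i /=; rewrite ?K2g ?g1K ?K1g ?g2K.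
have fI : injective f by move=> x y E; apply: (epts_inj (e := e1)); rewrite -!Hf E.
exists (@Emb _ _ f _ fI hb comp_f cyc_f).
by apply: emb_eq => x /=; rewrite ?Hf ?K2g.
Qed.

Lemma emb_over (T1 T2 Y : mcset) (e1 : emb T1 Y) (e2 : emb T2 Y) :
  (forall x, exists y, e2 y = e1 x) -> (forall y, exists x, e1 x = e2 y) ->
  exists phi : mciso T1 T2, emb_cmp e2 phi = e1.
Proof.
move=> H1 H2; have [phi E] := emb_factor H1.
have phib : bijective phi.
  apply: inj_surj_bij; first exact: epts_inj.
  move=> y; have [x xy] := H2 y; exists x; apply: (epts_inj (e := e2)).
  by rewrite -xy -E.
by exists (@MCIso _ _ phi phib).
Qed.

Lemma iso_inv_exists (S T : mcset) (f : mciso S T) :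
  exists g : mciso T S, emb_cmp f g = emb_id T /\ emb_cmp g f = emb_id S.
Proof.
have [h fh hf] := iso_bij f.
have [g Eg] : exists g : mciso T S, emb_cmp f g = emb_id T.
  by apply: emb_over => x; [exists (h x); rewrite hf | exists (f x)].
exists g; split=> //; apply: emb_eq => x.
  apply: (epts_inj (e := f)).
  exact: (congr1 (fun k => epts k (f x)) Eg).
apply: (bij_inj (eidx_bij f)).
exact: (congr1 (fun k => eidx k (eidx f x)) Eg).
Qed.

(** A bijection of points together with a matching [n] of components, which has to
include those without points: on the latter the points give no information. *)
Record link (S T : mcset) (f : S -> T) (n : idx S -> idx T -> Prop) : Prop := Link {
  link_bij : bijective f;
  link_comp : forall i j x, n i j -> (comp x = i <-> comp (f x) = j);
  link_inj : forall i j i' j', n i j -> n i' j' -> (i = i' <-> j = j');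
  link_l : forall i, (exists x : S, comp x = i) \/ exists j, n i j;
  link_r : forall j, (exists x : T, comp x = j) \/ exists i, n i j }.

Lemma link_sym (S T : mcset) (f : S -> T) (g : T -> S) n :
  link f n -> cancel f g -> cancel g f -> link g (fun j i => n i j).
Proof.
move=> [_ H1 H2 H3 H4] fg gf; split=> //.
- by exists f.
- by move=> i j x A; have := iff_sym (H1 _ _ (g x) A); rewrite gf.
- by move=> i j i' j' A B; exact: iff_sym (H2 _ _ _ _ A B).
Qed.

Lemma link_trans (S T U : mcset) (f : S -> T) (g : T -> U) n m :
  link f n -> link g m -> link (g \o f) (fun i k => exists2 j, n i j & m j k).
Proof.
move=> [H0 H1 H2 H3 H4] [K0 K1 K2 K3 K4]; split.
- exact: (bij_comp K0 H0).
- by move=> i k x [j A B]; exact: iff_trans (H1 _ _ x A) (K1 _ _ (f x) B).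
- move=> i k i' k' [j nij mjk] [j' nij' mjk'].
  exact: iff_trans (H2 _ _ _ _ nij nij') (K2 _ _ _ _ mjk mjk').
- move=> i; case: (H3 i) => [|[j nij]]; first by left.
  case: (K3 j) => [[y yj]|[k mjk]]; last by right; exists k, j.
  left; have [f' f'K Kf'] := H0; exists (f' y); apply/(H1 _ _ _ nij).
  by rewrite Kf'.
- move=> k; case: (K4 k) => [|[j mjk]]; first by left.
  case: (H4 j) => [[y yj]|[i nij]]; last by right; exists i, j.
  by left; exists (g y); apply/(K1 _ _ _ mjk).
Qed.

Lemma link_iso (S T : mcset) (phi : mciso S T) :
  link phi (fun i j => eidx phi i = j).
Proof.
have eI := bij_inj (eidx_bij phi); split.
- exact: iso_bij.
- by move=> i j x <-; rewrite emb_comp; split=> [->//|/eI].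
- by move=> i j i' j' <- <-; split=> [->//|/eI].
- by move=> i; right; exists (eidx phi i).
- by move=> j; right; have [g _ K] := eidx_bij phi; exists (g j).
Qed.

(** The components not containing [u] or [v] keep their names, and the others
contain [u] or [v]. *)
Lemma link_surg (S : mcset) (u v : S) : u != v ->
  link (id : S -> surg u v) (fun i j => val j = inl i).
Proof.
move=> uv; split.
- by exists id.
- move=> i j x E; have := valP j; rewrite E /= => /andP[iu iv].
  split=> [xi|/(congr1 val)].
    by apply: val_inj; rewrite E /= /surg_raw /touched xi (negbTE iu) (negbTE iv).
  rewrite E /= /surg_raw; case: ifP => // _ []//.
- move=> i j i' j' E E'; split=> [ii|jj]; first by apply: val_inj; rewrite E E' ii.
  by move: E; rewrite jj E' => -[].
- move=> i; case: (boolP ((i != comp u) && (i != comp v))) => [iP|].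
    by right; exists (exist (fun k => is_true (mdel_index u v k)) (inl i) iP).
  by rewrite negb_and !negbK => /orP[]/eqP->; left; [exists u | exists v].
- case=> -[i|b] jP; first by right; exists i.
  left; case: b jP => jP; [exists v | exists u]; apply: val_inj.
    by rewrite /= /surg_raw /touched !eqxx ?orbT.
  move: jP; rewrite /= /surg_raw /touched eqxx /= (negbTE uv) => /eqP->.
  by rewrite eqxx; congr inr; apply/negP => /cyc_rot/cyc_rot; rewrite cyc_irr.
Qed.

(** A bijection which commutes with successors is an isomorphism as far as the
points are concerned; the link provides the images of the components without
points. *)
Lemma link_mciso (S T : mcset) (f : S -> T) n (s : S -> S) (t : T -> T) :
  link f n -> is_succ s -> is_succ t -> (forall x, f (s x) = t (f x)) ->
  exists phi : mciso S T, (forall x, phi x = f x) /\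
    forall i j, n i j -> eidx phi i = j.
Proof.
move=> [fb H1 H2 H3 H4] Hs Ht E; have [g fg gf] := fb.
have E' y : g (t y) = s (g y) by apply: (can_inj fg); rewrite E !gf.
have [compf cycf] := succ_pcyc (bij_inj fb) Hs Ht E.
have [compg cycg] := succ_pcyc (can_inj gf) Ht Hs E'.
pose r i j := (exists2 x, comp x = i & comp (f x) = j) \/ n i j.
have rI i j i' j' : r i j -> r i' j' -> (i = i' <-> j = j').
  move=> [[x <- <-]|A] [[x' <- <-]|B].
  - by split=> [/compf//|/compg]; rewrite !fg.
  - by rewrite (H1 _ _ x B).
  - by split=> /esym/(H1 _ _ x' A)/esym.
  - exact: H2 A B.
have rl i : exists j, r i j.
  case: (H3 i) => [[x xi]|[j nij]]; last by exists j; right.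
  by exists (comp (f x)); left; exists x.
have rr j : exists i, r i j.
  case: (H4 j) => [[y yj]|[i nij]]; last by exists i; right.
  by exists (comp (g y)); left; exists (g y); rewrite ?gf.
have [h hP] := choice rl; have [k kP] := choice rr.
have hb : bijective h.
  exists k => i; first by apply/(rI _ _ _ _ (kP (h i)) (hP i)).
  by apply/(rI _ _ _ _ (hP (k i)) (kP i)).
have comp_f x : comp (f x) = h (comp x).
  by apply/(rI (comp x) _ (comp x) _ _ (hP _)) => //; left; exists x.
have cyc_f x y z : cyc (f x) (f y) (f z) = cyc x y z.
  by apply/idP/idP => [/cycg|/cycf//]; rewrite !fg.
exists (@MCIso _ _ (@Emb _ _ f h (bij_inj fb) hb comp_f cyc_f) fb).
by split=> //= i j nij; apply/(rI i _ i j (hP i)) => //; right.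
Qed.

(** * Relations between surgeries; canonical isomorphisms *)

Lemma surg_permC (S : mcset) (s : S -> S) (a b c d x : S) :
  a != c -> a != d -> b != c -> b != d ->
  surg_perm a b (surg_perm c d s) x = surg_perm c d (surg_perm a b s) x.
Proof.
move=> /negbTE ac /negbTE ad /negbTE bc /negbTE bd; rewrite /surg_perm.
case: (eqVneq x a) => [->|xa]; first by rewrite ac ad bc bd eqxx.
case: (eqVneq x b) => [->|xb].
  by rewrite ac ad bc bd eqxx; case: eqVneq => // ->.
case: (eqVneq x c) => [_|xc] /=; first by rewrite [d == a]eq_sym ad [d == b]eq_sym bd.
case: (eqVneq x d) => [_|xd] /=; first by rewrite [c == a]eq_sym ac [c == b]eq_sym bc.
by rewrite (negbTE xa) (negbTE xb).
Qed.

Lemma surg_perm_flip (S : mcset) (s : S -> S) (u v x : S) :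
  surg_perm u v s x = surg_perm v u s x.
Proof.
by rewrite /surg_perm; case: (eqVneq x u) => [->|]; case: eqVneq => // ->.
Qed.

Lemma surg_permK (S : mcset) (s : S -> S) (u v x : S) :
  surg_perm u v (surg_perm u v s) x = s x.
Proof.
rewrite /surg_perm; case: (eqVneq x u) => [->|xu]; first by rewrite eqxx; case: eqVneq => // ->.
case: (eqVneq x v) => [->|xv]; first by rewrite eqxx.
by rewrite (negbTE xu) (negbTE xv).
Qed.

(** [k] is the component [i], untouched by either surgery. *)
Definition is_null2 (S : mcset) (a b c d : S) (i : idx S)
    (k : idx (@surg (surg c d) a b)) : Prop :=
  exists2 j : idx (surg c d), val j = inl i & val k = inl j.

Lemma link_surg2 (S : mcset) (a b c d : S) : a != b -> c != d ->
  link (id : S -> @surg (surg c d) a b) (@is_null2 S a b c d).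
Proof.
move=> ab cd.
exact: (link_trans (link_surg cd) (link_surg (ab : (a : surg c d) != b))).
Qed.

Lemma link_surg_sym (S : mcset) (u v : S) : u != v ->
  link (id : surg u v -> S) (fun j i => val j = inl i).
Proof. by move/link_surg/link_sym; apply. Qed.

Lemma link_surg2_sym (S : mcset) (a b c d : S) : a != b -> c != d ->
  link (id : @surg (surg c d) a b -> S) (fun k i => @is_null2 S a b c d i k).
Proof. by move=> ab cd; apply: (link_sym (link_surg2 ab cd)). Qed.

Lemma surg_succ2 (S : mcset) (a b c d : S) (s : S -> S) : a != b -> c != d ->
  is_succ s -> is_succ (surg_perm a b (surg_perm c d s) : @surg (surg c d) a b -> _).
Proof.
move=> ab cd Hs; exact: (@surg_succ (surg c d) a b _ (surg_succ Hs cd) ab).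
Qed.

(** Disjoint transpositions commute. *)
Lemma surg_commute (S : mcset) (a b c d : S) :
  a != b -> c != d -> a != c -> a != d -> b != c -> b != d ->
  exists w : mciso (@surg (surg c d) a b) (@surg (surg a b) c d),
    (forall x, w x = x) /\
    forall i k k', @is_null2 S a b c d i k -> @is_null2 S c d a b i k' -> eidx w k = k'.
Proof.
move=> ab cd ac ad bc bd; have [s Hs] := succ_exists S.
have L := link_trans (link_surg2_sym ab cd)
  (link_surg2 cd ab).
have [w [w1 w2]] := link_mciso L (surg_succ2 ab cd Hs) (surg_succ2 cd ab Hs)
  (fun x => surg_permC s x ac ad bc bd).
by exists w; split=> // i k k' A B; apply: w2; exists i.
Qed.

Lemma surg_flip (S : mcset) (u v : S) : u != v ->
  exists w : mciso (surg u v) (surg v u),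
    (forall x, w x = x) /\
    forall i k k', val k = inl i -> val k' = inl i -> eidx w k = k'.
Proof.
move=> uv; have [s Hs] := succ_exists S; have vu : v != u by rewrite eq_sym.
have L := link_trans (link_surg_sym uv)
  (link_surg vu).
have [w [w1 w2]] := link_mciso L (surg_succ Hs uv) (surg_succ Hs vu)
  (surg_perm_flip s u v).
by exists w; split=> // i k k' A B; apply: w2; exists i.
Qed.

(** A transposition is an involution. *)
Lemma surg_surg (S : mcset) (u v : S) : u != v ->
  exists w : mciso (@surg (surg u v) u v) S,
    (forall x, w x = x) /\ forall i k, @is_null2 S u v u v i k -> eidx w k = i.
Proof.
move=> uv; have [s Hs] := succ_exists S.
have L := link_surg2_sym uv uv.
have [w [w1 w2]] := link_mciso L (surg_succ2 uv uv Hs) Hs (surg_permK s u v).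
by exists w; split=> // i k A; apply: w2.
Qed.

(** An isomorphism [w] between sets which contain the two sets being compared
settles the matching of components: only its compatibility with the embeddings
[e1], [e2] has to be known. *)
Lemma comps_match_square (T1 T2 U1 U2 V1 V2 : mcset) (W : Type) (h : idx T1 -> idx T2)
    (e1 : emb T1 U1) (e2 : emb T2 U2) (o1 : U1 -> W) (o2 : U2 -> W)
    (i1 : emb U1 V1) (i2 : emb U2 V2) (w : mciso V1 V2) :
  (forall p q, o1 p = o2 q -> w (i1 p) = i2 q) ->
  (forall k, eidx w (eidx i1 (eidx e1 k)) = eidx i2 (eidx e2 (h k))) ->
  comps_match h e1 e2 o1 o2.
Proof.
move=> H K p q k opq pk; apply: (bij_inj (eidx_bij i2)).
by rewrite -emb_comp -(H _ _ opq) !emb_comp pk K.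
Qed.

(** Naturality is clear on components with points, and the other components are
matched by the link. *)
Lemma link_natural (A1 A2 B1 B2 : mcset) (e1 : emb A1 B1) (e2 : emb A2 B2)
    (f : A1 -> A2) (nA : idx A1 -> idx A2 -> Prop) (wA : mciso A1 A2) (wB : mciso B1 B2) :
  link f nA ->
  (forall x, e2 (wA x) = wB (e1 x)) ->
  (forall i j, nA i j -> eidx wA i = j /\ eidx wB (eidx e1 i) = eidx e2 j) ->
  forall k, eidx wB (eidx e1 k) = eidx e2 (eidx wA k).
Proof.
move=> L E N k; case: (link_l L k) => [[x <-]|[j /N[-> //]]].
by rewrite -!emb_comp E.
Qed.

(** The isomorphism between surgeries is recorded along with the canonical one
because it shows how the latter sits in enlargements of [S]. *)
Lemma can_del_sym_exists (S : mcset) (u v : S) : u != v ->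
  exists (chi : mciso (mdel u v) (mdel v u)) (w : mciso (surg u v) (surg v u)),
  [/\ can_del_sym chi, forall x, w x = x &
      emb_cmp (del_surg v u) chi = emb_cmp w (del_surg u v)].
Proof.
move=> uv; have vu : v != u by rewrite eq_sym.
have [w [w1 w2]] := surg_flip uv.
have [chi Echi] : exists chi : mciso (mdel u v) (mdel v u),
    emb_cmp (del_surg v u) chi = emb_cmp w (del_surg u v).
  apply: emb_over => -[x xP] /=.
    have yP : (x != v) && (x != u) by rewrite andbC.
    by exists (exist (fun z => is_true ((z != v) && (z != u))) x yP); rewrite /= w1.
  have yP : (x != u) && (x != v) by rewrite andbC.
  by exists (exist (fun z => is_true ((z != u) && (z != v))) x yP); rewrite /= w1.
have ptE z : val (chi z) = val z.
  by rewrite -[RHS]w1; exact: (congr1 (fun k => epts k z) Echi).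
have idxE k : eidx chi k = eidx w k by exact: (congr1 (fun h => eidx h k) Echi).
exists chi, w; split=> //; split=> // U e.
have euv : e u != e v by rewrite (inj_eq (@epts_inj _ _ e)).
have [wU [wU1 wU2]] := surg_flip euv.
apply: (comps_match_square (i1 := del_surg _ _) (i2 := del_surg _ _) (w := wU)).
  by move=> p q /= E; rewrite wU1 E.
move=> k /=; rewrite idxE.
have L := link_trans (link_surg_sym uv)
  (link_surg vu).
apply: (link_natural (e1 := surg_emb e u v) (e2 := surg_emb e v u) L).
  by move=> x /=; rewrite w1 wU1.
move=> i j [i0 A B]; split; first exact: w2 A B.
by apply: (wU2 (eidx e i0)); rewrite /= ?A ?B.
Qed.

Section DelDel.
Variables (S : mcset) (a b c d : S) (a' b' : mdel c d).
Hypotheses (Ea : val a' = a) (Eb : val b' = b).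

(** An iterated contraction inside the iterated surgery; it is the identity on
points and on the names of components. *)
Definition deldel_surg : emb (mdel a' b') (@surg (surg c d) a b) :=
  emb_cmp (surg_cast (S := surg c d) Ea Eb)
    (emb_cmp (surg_emb (del_surg c d) a' b') (del_surg a' b')).

Lemma deldel_surg_pts z : deldel_surg z = val (val z).
Proof. exact: surg_cast_pts. Qed.

Lemma deldel_surg_idx k : val (eidx deldel_surg k) = val k.
Proof. by rewrite [LHS]surg_cast_idx /=; case: (val k). Qed.

Lemma deldel_surg_image x : x != a -> x != b -> x != c -> x != d ->
  exists z, deldel_surg z = x.
Proof.
move=> xa xb xc xd; have xP : (x != c) && (x != d) by rewrite xc xd.
pose x' : mdel c d := exist _ x xP.
have xP' : (x' != a') && (x' != b').
  by rewrite -!(inj_eq val_inj) Ea Eb /= xa xb.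
by exists (exist _ x' xP'); rewrite deldel_surg_pts.
Qed.

Lemma deldel_surg_notin z : [/\ deldel_surg z != a, deldel_surg z != b,
  deldel_surg z != c & deldel_surg z != d].
Proof.
rewrite deldel_surg_pts; case/andP: (valP (val z)) => -> ->.
by case/andP: (valP z); rewrite -!(inj_eq val_inj) Ea Eb => -> ->.
Qed.
End DelDel.

(** Both iterated contractions sit in iterated surgeries, which are identified by
[surg_commute] naturally in [S]. *)
Lemma can_del_del_exists (S : mcset) (a b c d : S) (a' b' : mdel c d) (c' d' : mdel a b)
    (Ea : val a' = a) (Eb : val b' = b) (Ec : val c' = c) (Ed : val d' = d) :
  a != b -> c != d ->
  exists (chi : mciso (mdel a' b') (mdel c' d'))
         (w : mciso (@surg (surg c d) a b) (@surg (surg a b) c d)),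
  [/\ can_del_del chi, forall x, w x = x &
      emb_cmp (deldel_surg Ec Ed) chi = emb_cmp w (deldel_surg Ea Eb)].
Proof.
move=> ab cd; have /andP[ac ad] := valP a'; have /andP[bc bd] := valP b'.
rewrite -/(val a') Ea in ac ad; rewrite -/(val b') Eb in bc bd.
have [w [w1 w2]] := surg_commute ab cd ac ad bc bd.
have [chi Echi] : exists chi : mciso (mdel a' b') (mdel c' d'),
    emb_cmp (deldel_surg Ec Ed) chi = emb_cmp w (deldel_surg Ea Eb).
  apply: emb_over => z.
    have -> : emb_cmp w (deldel_surg Ea Eb) z = deldel_surg Ea Eb z := w1 _.
    by have [*] := deldel_surg_notin Ea Eb z; apply: deldel_surg_image.
  have [*] := deldel_surg_notin Ec Ed z.
  have [//|//|//|//|y Hy] := @deldel_surg_image _ _ _ _ _ _ _ Ea Eb (deldel_surg Ec Ed z).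
  by exists y; rewrite -Hy; apply: w1.
have ptE z : val (val (chi z)) = val (val z).
  rewrite -(deldel_surg_pts Ec Ed) -(deldel_surg_pts Ea Eb) -[RHS]w1.
  exact: (congr1 (fun k => epts k z) Echi).
have idxE k : eidx (deldel_surg Ec Ed) (eidx chi k) = eidx w (eidx (deldel_surg Ea Eb) k).
  exact: (congr1 (fun h => eidx h k) Echi).
exists chi, w; split=> //; split=> // U e.
have eE x y : (e x != e y) = (x != y) by rewrite (inj_eq (@epts_inj _ _ e)).
have [|||||| wU [wU1 wU2]] := @surg_commute U (e a) (e b) (e c) (e d); rewrite ?eE //.
have ca (f : mdel c d) x (E : val f = x) : val (mdel_emb e c d f) = e x by rewrite -E.
have cc (f : mdel a b) x (E : val f = x) : val (mdel_emb e a b f) = e x by rewrite -E.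
apply: (comps_match_square (i1 := deldel_surg (ca _ _ Ea) (ca _ _ Eb))
  (i2 := deldel_surg (cc _ _ Ec) (cc _ _ Ed)) (w := wU)).
  by move=> p q E; rewrite wU1 !deldel_surg_pts.
pose t1 := surg_emb (surg_emb e c d) a b; pose t2 := surg_emb (surg_emb e a b) c d.
have i1E k : eidx (deldel_surg (ca _ _ Ea) (ca _ _ Eb)) (eidx (mdel_emb (mdel_emb e c d) a' b') k)
    = eidx t1 (eidx (deldel_surg Ea Eb) k).
  apply: val_inj; rewrite [LHS]deldel_surg_idx.
  exact: (congr1 (sum_map (@mdel_eidx _ _ e c d) id) (esym (deldel_surg_idx Ea Eb k))).
have i2E k : eidx (deldel_surg (cc _ _ Ec) (cc _ _ Ed)) (eidx (mdel_emb (mdel_emb e a b) c' d') k)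
    = eidx t2 (eidx (deldel_surg Ec Ed) k).
  apply: val_inj; rewrite [LHS]deldel_surg_idx.
  exact: (congr1 (sum_map (@mdel_eidx _ _ e a b) id) (esym (deldel_surg_idx Ec Ed k))).
move=> k; rewrite i1E i2E idxE.
have L := link_trans (link_surg2_sym ab cd) (link_surg2 cd ab).
apply: (link_natural (e1 := t1) (e2 := t2) L).
  by move=> x /=; rewrite w1 wU1.
move=> i j [i0 A B]; split; first exact: w2 A B.
apply: (wU2 (eidx e i0)).
  by case: A => l l1 l2; exists (mdel_eidx e l); rewrite /= ?l1 ?l2.
by case: B => l l1 l2; exists (mdel_eidx e l); rewrite /= ?l1 ?l2.
Qed.

Lemma sum_swapK (A B : Type) : cancel (@sum_swap A B) (@sum_swap B A).
Proof. by case. Qed.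

Lemma sum_swap_bij (A B : Type) : bijective (@sum_swap A B).
Proof. by exists (@sum_swap B A); apply: sum_swapK. Qed.

Definition munion_swap (S' S'' : mcset) : mciso (munion S' S'') (munion S'' S').
Proof.
unshelve refine (@MCIso _ _ (@Emb (munion S' S'') (munion S'' S') (@sum_swap _ _)
  (@sum_swap _ _) (bij_inj (@sum_swap_bij _ _)) (@sum_swap_bij _ _) _ _)
  (@sum_swap_bij _ _)).
- by case.
- by case=> x [] y [].
Defined.

Lemma can_glue_sym_exists (S' S'' : mcset) (u : S') (v : S'') :
  exists phi : mciso (mglue u v) (mglue v u), can_glue_sym phi.
Proof.
have uv : (inr u : munion S'' S') != inl v by [].
have [chi [w [[chi1 chi2] _ _]]] := can_del_sym_exists uv.
pose s := mdel_iso (munion_swap S' S'') (inl u) (inr v).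
exists (@cmp MultCyc _ _ _ chi s); split=> [z|U' U'' e' e'' p q k pq pk].
  exact: chi1.
pose sU := mdel_iso (munion_swap U' U'') (inl (e' u)) (inr (e'' v)).
apply: (chi2 _ (munion_emb e'' e') (sU p) q (eidx s k)) => //.
rewrite emb_comp pk; apply: val_inj => /=.
by case: (val k) => [[]|].
Qed.

Section UnionDel.
Variables (S' S'' : mcset) (c d : S').

Lemma union_del_pts_subproof (x : mdel c d + S'') :
  (orig_d x != inl c) && (orig_d x != inl d).
Proof. by case: x => x //=; rewrite !(inj_eq inl_inj) (valP x). Qed.

Definition union_del_pts (x : munion (mdel c d) S'')
    : @mdel (munion S' S'') (inl c) (inl d) :=
  exist _ (orig_d x) (union_del_pts_subproof x).

Definition union_del_raw (k : mdel_idx c d + idx S'') : (idx S' + idx S'') + bool :=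
  match k with
  | inl l => match val l with inl i => inl (inl i) | inr b => inr b end
  | inr j => inl (inr j)
  end.

Lemma union_del_idx_subproof k :
  mdel_index (inl c : munion S' S'') (inl d) (union_del_raw k).
Proof.
by case: k => [[[i|b] /= kP]|j].
Qed.

Definition union_del_idx (k : idx (munion (mdel c d) S''))
    : mdel_idx (inl c : munion S' S'') (inl d) :=
  exist _ (union_del_raw k) (union_del_idx_subproof k).

Lemma union_del_pts_bij : bijective union_del_pts.
Proof.
apply: inj_surj_bij.
- by move=> [x|x] [y|y] /(congr1 val) //= [E]; congr inl || congr inr => //; apply: val_inj.
- case=> -[x|y] xP; last by exists (inr y); apply: val_inj.
  have xP' : (x != c) && (x != d) by move: xP; rewrite !(inj_eq inl_inj).
  by exists (inl (exist _ x xP' : mdel c d)); apply: val_inj.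
Qed.

Lemma union_del_idx_bij : bijective union_del_idx.
Proof.
apply: inj_surj_bij.
- move=> [x|x] [y|y] /(congr1 val) //=.
  + case Ex: (val x) => [i|b]; case Ey: (val y) => [j|b'] // [E]; congr inl;
      apply: val_inj; by rewrite Ex Ey E.
  + by case: (val x).
  + by case: (val y).
  + by case=> ->.
- case=> -[[i|j]|b] kP; last 2 first.
  + by exists (inr j); apply: val_inj.
  + have kP' : mdel_index c d (inr b) by move: kP; rewrite /= (inj_eq inl_inj).
    by exists (inl (exist (fun k => is_true (mdel_index c d k)) _ kP')); apply: val_inj.
  have kP' : mdel_index c d (inl i) by move: kP; rewrite /= !(inj_eq inl_inj).
  by exists (inl (exist (fun k => is_true (mdel_index c d k)) _ kP')); apply: val_inj.
Qed.

Lemma union_del_comp (x : munion (mdel c d) S'') :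
  comp (union_del_pts x) = union_del_idx (comp x).
Proof.
apply: val_inj; case: x => x /=; rewrite /mdel_raw /touched /=.
  by rewrite !(inj_eq inl_inj); case: ifP.
by [].
Qed.

Lemma union_del_cyc (x y z : munion (mdel c d) S'') :
  cyc (union_del_pts x) (union_del_pts y) (union_del_pts z) = cyc x y z.
Proof.
have cE (p q : munion (mdel c d) S'') :
    (mdel_comp (union_del_pts p) == mdel_comp (union_del_pts q)) = (comp p == comp q).
  by rewrite -(inj_eq (bij_inj union_del_idx_bij)) -!union_del_comp.
rewrite -[LHS]/(mdel_cyc (union_del_pts x) (union_del_pts y) (union_del_pts z)).
rewrite {1}/mdel_cyc !cE; case: x => x; case: y => y; case: z => z //=;
  rewrite ?andbF //.
apply/and3P/idP => [[]//|H].
by have [-> ->] := cyc_comp H.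
Qed.

(** Contraction inside the first summand of a disjoint union. *)
Definition union_del : mciso (munion (mdel c d) S'') (@mdel (munion S' S'') (inl c) (inl d)) :=
  @MCIso _ _ (@Emb _ _ union_del_pts union_del_idx (bij_inj union_del_pts_bij)
    union_del_idx_bij union_del_comp union_del_cyc) union_del_pts_bij.
End UnionDel.

(** A composition is a contraction in the disjoint union, so that this is a case
of [can_del_del_exists]. *)
Lemma can_glue_del_exists (S' S'' : mcset) (a c d : S') (b : S'') (a' : mdel c d)
    (c' d' : mglue a b) :
  val a' = a -> val c' = inl c -> val d' = inl d -> c != d ->
  exists phi : mciso (mglue a' b) (mdel c' d'), can_glue_del phi.
Proof.
move=> Ea Ec Ed cd; pose D := union_del S'' c d.
have Ea' : val (D (inl a')) = inl a by rewrite /= Ea.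
have Eb' : val (D (inr b)) = inr b by [].
have ab' : (inl a : munion S' S'') != inr b by [].
have cd' : (inl c : munion S' S'') != inl d by rewrite (inj_eq inl_inj).
have [chi [w [[chi1 chi2] _ _]]] := can_del_del_exists Ea' Eb' Ec Ed ab' cd'.
pose s := mdel_iso D (inl a') (inr b).
exists (@cmp MultCyc _ _ _ chi s); split=> [z|U' U'' e' e'' p q k pq pk].
  exact: chi1.
pose DU := union_del U'' (e' c) (e' d).
pose mU := mdel_emb (munion_emb e' e'') (inl c) (inl d).
have Eq1 : DU (inl (mdel_emb e' c d a')) = mU (D (inl a')) by apply: val_inj.
have Eq2 : DU (inr (e'' b)) = mU (D (inr b)) by apply: val_inj.
have [p' [Ep' Cp']] : exists p' : mdel (mU (D (inl a'))) (mU (D (inr b))),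
    val p' = DU (val p) /\
    val (comp p') = val (comp (mdel_iso DU (inl (mdel_emb e' c d a')) (inr (e'' b)) p)).
  rewrite -Eq1 -Eq2.
  by exists (mdel_iso DU (inl (mdel_emb e' c d a')) (inr (e'' b)) p).
apply: (chi2 _ (munion_emb e' e'') p' q (eidx s k)); first by rewrite Ep'.
apply: val_inj; rewrite Cp' emb_comp pk /=.
case: (val k) => [[l|j]|//]; congr inl; apply: val_inj => //=.
by case: (val l).
Qed.

(** * The generated elements *)

Section Generated.
Variables (Q : ns_mod_operad) (f : ns_cyc_mor ns_star_C (ns_box_ob Q)).

Lemma nmod_act_cmp (S T U : mcset) g h k (psi : mciso T U) (phi : mciso S T)
    (e : g = h) (e' : h = k) (x : nmod_at Q S g) :
  nmod_act Q psi e' (nmod_act Q phi e x) =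
  nmod_act Q (@cmp MultCyc S T U psi phi : mciso S U) (etrans e e') x.
Proof.
exact/esym/(congr1 (@^~ x) (@fmapM _ _ Q (S, g) (T, h) (U, k) (psi, e') (phi, e))).
Qed.

Lemma nmod_act_id (S : mcset) g (x : nmod_at Q S g) :
  nmod_act Q (idm (S : MultCyc) : mciso S S) erefl x = x.
Proof. exact: (congr1 (@^~ x) (fmap1 Q (S, g))). Qed.

Lemma nmod_act_inv (S T : mcset) g h (phi : mciso S T) (e : g = h) :
  exists (psi : mciso T S) (e' : h = g), forall x y,
    nmod_act Q phi e x = y -> x = nmod_act Q psi e' y.
Proof.
case: h / e; have [psi [_ psiK]] := iso_inv_exists phi.
exists psi, erefl => x y <-; rewrite nmod_act_cmp -[LHS]nmod_act_id.
congr (nmod_act Q _ _ _); apply: mciso_eq => z.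
  exact/esym/(congr1 (fun k => epts k z) psiK).
exact/esym/(congr1 (fun k => eidx k z) psiK).
Qed.

Lemma nmctr_transport (S T T' : mcset) g (rho : mciso T T') (u v : T) (u' v' : T')
    (uv : u != v) (uv' : u' != v') (x : nmod_at Q T g) :
  rho u = u' -> rho v = v' ->
  forall (phi : mciso (mdel u v) S) (psi : mciso (mdel u' v') S),
  (forall z z', val z' = rho (val z) -> psi z' = phi z) ->
  (forall k k', val k' = sum_map (eidx rho) id (val k) -> eidx psi k' = eidx phi k) ->
  nmod_act Q psi erefl (nmctr uv' (nmod_act Q rho erefl x)) =
  nmod_act Q phi erefl (nmctr uv x).
Proof.
move=> Eu Ev; subst u' v' => phi psi H K; rewrite -nmctr_equiv nmod_act_cmp.
by congr (nmod_act Q _ _ _); apply: mciso_eq => z /=; [apply: H | apply: K].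
Qed.

(** The suboperad of [Q] generated by the image of [f]. *)
Inductive gen : forall (S : mcset) g, nmod_at Q S g -> Prop :=
| gen_in (C : Cyc) : gen (f C tt : nmod_at Q (cset C) 0)
| gen_act (S T : mcset) g h (phi : mciso S T) (e : g = h) x :
    gen x -> gen (nmod_act Q phi e x)
| gen_comp (S' S'' : mcset) g' g'' (u : S') (v : S'')
    (x : nmod_at Q S' g') (y : nmod_at Q S'' g'') :
    gen x -> gen y -> gen (nmcomp u v x y)
| gen_ctr (S : mcset) g (u v : S) (uv : u != v) (x : nmod_at Q S g) :
    gen x -> gen (nmctr uv x).

Definition planar (S : mcset) g (x : nmod_at Q S g) : Prop :=
  exists (C : Cyc) (phi : mciso (cset C) S) (e : 0 = g),
    x = nmod_act Q phi e (f C tt).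

Definition contracted (S : mcset) g (x : nmod_at Q S g) : Prop :=
  exists (T : mcset) (h : nat) (u v : T) (uv : u != v) (y : nmod_at Q T h)
    (phi : mciso (mdel u v) S) (e : h.+1 = g),
    gen y /\ x = nmod_act Q phi e (nmctr uv y).

Lemma planar_act (S T : mcset) g h (phi : mciso S T) (e : g = h) x :
  planar x -> planar (nmod_act Q phi e x).
Proof.
case=> C [psi [e' ->]]; rewrite nmod_act_cmp; exists C.
by exists (@cmp MultCyc _ _ _ phi psi), (etrans e' e).
Qed.

Lemma contracted_act (S T : mcset) g h (phi : mciso S T) (e : g = h) x :
  contracted x -> contracted (nmod_act Q phi e x).
Proof.
case=> R [k [u [v [uv [y [psi [e' [Hy ->]]]]]]]]; rewrite nmod_act_cmp.
by exists R, k, u, v, uv, y, (@cmp MultCyc _ _ _ phi psi), (etrans e' e).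
Qed.

(** A contraction in the first factor can be performed after the composition. *)
Lemma contracted_comp (S' S'' : mcset) g' g'' (u : S') (v : S'')
    (x : nmod_at Q S' g') (y : nmod_at Q S'' g'') :
  contracted x -> gen y -> contracted (nmcomp u v x y).
Proof.
case=> T [h [c [d [cd [z [phi [e [Hz ->]]]]]]]] Hy; case: g' / e x => _.
have [psi psiK phiK] := iso_bij phi; rewrite -(phiK u).
move: (psi u) => a' {u psi psiK phiK}.
rewrite -[y]nmod_act_id.
rewrite -(nmcomp_equiv phi (idm (S'' : MultCyc) : mciso S'' S'') a' v).
apply: contracted_act.
have cP : (inl c != inl (val a') :> (T + S'')%type) &&
          (inl c != inr v :> (T + S'')%type).
  by case/andP: (valP a') => /eqP cu _; rewrite andbT; apply/eqP => -[/esym].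
have dP : (inl d != inl (val a') :> (T + S'')%type) &&
          (inl d != inr v :> (T + S'')%type).
  by case/andP: (valP a') => _ /eqP du; rewrite andbT; apply/eqP => -[/esym].
pose c' : mglue (val a') v := exist _ (inl c) cP.
pose d' : mglue (val a') v := exist _ (inl d) dP.
have cd' : c' != d' by rewrite -(inj_eq val_inj) /= (inj_eq inl_inj).
have [chi Hchi] := @can_glue_del_exists _ _ (val a') c d v a' c' d' erefl erefl erefl cd.
have := nmcomp_ctr (erefl : val a' = val a') (erefl : val c' = _) (erefl : val d' = _)
  cd cd' z y Hchi.
have [psi [e' He']] := nmod_act_inv chi (addSn h g'').
move/He' => ->; apply: contracted_act.
exists (mglue (val a') v), (h + g''), c', d', cd', (nmcomp (val a') v z y).
exists (idm (mdel c' d' : MultCyc)), erefl; rewrite nmod_act_id; split=> //.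
exact: gen_comp.
Qed.

(** Contractions move outwards, and a composite of planar elements is planar
because [f] is a morphism. *)
Lemma gen_cases (S : mcset) g (x : nmod_at Q S g) : gen x -> planar x \/ contracted x.
Proof.
elim=> {S g x} [C|S T g h phi e x _ [H|H]|S' S'' g' g'' u v x y Hx [Px|Cx] Hy [Py|Cy]
               |S g u v uv x Hx _].
- left; exists C, (idm (cset C : MultCyc)), erefl.
  by rewrite nmod_act_id.
- by left; apply: planar_act.
- by right; apply: contracted_act.
- left; case: Px => C [phi [e ->]]; case: g' / e {x Hx}.
  case: Py => D [psi [e ->]]; case: g'' / e {y Hy}.
  have [phi' _ phiK] := iso_bij phi; have [psi' _ psiK] := iso_bij psi.
  rewrite -(phiK u) -(psiK v) -nmcomp_equiv; apply: planar_act.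
  exists (cglue (phi' u) (psi' v)), (idm (mglue _ _ : MultCyc)), erefl.
  rewrite nmod_act_id.
  exact: (esym (@ncyc_ntP _ _ f C D (phi' u) (psi' v) tt tt)).
- right; have [chi Hchi] := can_glue_sym_exists v u.
  rewrite -(nmcomp_sym _ _ Hchi); apply: contracted_act; exact: contracted_comp.
- right; exact: contracted_comp.
- right; exact: contracted_comp.
- right; exists S, g, u, v, uv, x, (idm (mdel u v : MultCyc)), erefl.
  by rewrite nmod_act_id.
Qed.

Lemma gen0_unique (S : mcset) (x y : nmod_at Q S 0) : gen x -> gen y -> x = y.
Proof.
have pl (z : nmod_at Q S 0) : gen z -> exists C (phi : mciso (cset C) S),
    z = nmod_act Q phi erefl (f C tt).
  move/gen_cases => [[C [phi [e ->]]]|[T [h [u [v [uv [w [phi [e _]]]]]]]]]; last by [].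
  by exists C, phi; rewrite (eq_irrelevance e erefl).
move=> /pl[C [phi ->]] /pl[D [psi ->]].
have [psi' [psiK _]] := iso_inv_exists psi.
pose r : mciso (cset C) (cset D) := @cmp MultCyc _ _ _ psi' phi.
have -> : f D tt = nmod_act Q r erefl (f C tt).
  exact: (congr1 (@^~ tt) (@nt_nat _ _ _ _ f C D r)).
rewrite nmod_act_cmp; congr (nmod_act Q _ _ _); apply: mciso_eq => z.
  exact/esym/(congr1 (fun k => epts k (phi z)) psiK).
exact/esym/(congr1 (fun k => eidx k (eidx phi z)) psiK).
Qed.

Lemma genS_contracted (S : mcset) g (x : nmod_at Q S g.+1) : gen x ->
  exists (T : mcset) (u v : T) (uv : u != v) (y : nmod_at Q T g)
    (phi : mciso (mdel u v) S), gen y /\ x = nmod_act Q phi erefl (nmctr uv y).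
Proof.
case/gen_cases => [[C [phi [e _]]]|[T [h [u [v [uv [y [phi [e]]]]]]]]]; first by [].
have Eh : h = g by case: e.
by subst h; rewrite (eq_irrelevance e erefl) => H; exists T, u, v, uv, y, phi.
Qed.
Definition exists_at g : Prop :=
  forall T : mcset, geometric T g -> exists y : nmod_at Q T g, gen y.

Definition unique_at g : Prop :=
  forall (T : mcset) (y z : nmod_at Q T g), gen y -> gen z -> y = z.
End Generated.

(** * Insertion of points and amalgamation *)

Lemma succ_unique (S : mcset) (s t : S -> S) : is_succ s -> is_succ t -> s =1 t.
Proof.
move=> Hs Ht x; have [sx1 sx2] := Hs x; have [tx1 tx2] := Ht x.
have fixed (a b : S) : comp b = comp x -> b != x -> a = x ->
    (b == a) || cyc x a b -> False.
  by move=> _ /negbTE bx ->; rewrite bx /= => /cyc_rot/cyc_rot; rewrite cyc_irr.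
case: (eqVneq (s x) x) => [sx|sx].
  case: (eqVneq (t x) x) => [->//|tx].
  by case: (fixed (s x) (t x) tx1 tx sx); apply: sx2.
case: (eqVneq (t x) x) => [tx|tx].
  by case: (fixed (t x) (s x) sx1 sx tx); apply: tx2.
have := sx2 _ tx1 tx; have := tx2 _ sx1 sx.
case: eqP => //= st H; rewrite eq_sym; case: eqP => [/st//|_ /=] K.
by have := cyc_asym H; rewrite (cyc_rot K).
Qed.

Lemma succ_iso (S T : mcset) (w : mciso S T) (s : S -> S) (t : T -> T) :
  is_succ s -> is_succ t -> forall x, w (s x) = t (w x).
Proof.
move=> Hs Ht; have [h wh hw] := iso_bij w.
have Ht' : is_succ (h \o t \o w).
  move=> x; have [t1 t2] := Ht (w x); split.
    by apply: (bij_inj (eidx_bij w)); rewrite -!emb_comp /= hw.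
  move=> z zx zx'; rewrite -(emb_cyc w) -(inj_eq (can_inj wh)) /= hw.
  by apply: t2; rewrite ?(inj_eq (can_inj wh)) // !emb_comp zx.
by move=> x; rewrite (succ_unique Hs Ht') /= hw.
Qed.

(** Surgery being an involution, an isomorphism between the results of two
surgeries comes from an isomorphism between the sets before surgery. *)
Lemma surg_uncut (S1 S2 : mcset) (u1 v1 : S1) (u2 v2 : S2) (w : mciso (surg u1 v1) (surg u2 v2)) :
  u1 != v1 -> w u1 = u2 -> w v1 = v2 ->
  exists psi : mciso S1 S2, (forall x, psi x = w x) /\
    forall k k', val k' = sum_map (eidx psi) id (val k) -> eidx w k = k'.
Proof.
move=> uv wu wv; have wI : injective w := bij_inj (iso_bij w).
have wuE x : (w x == u2) = (x == u1) by rewrite -[RHS](inj_eq wI) wu.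
have wvE x : (w x == v2) = (x == v1) by rewrite -[RHS](inj_eq wI) wv.
have uv2 : u2 != v2 by rewrite -wv eq_sym [_ == _]wuE eq_sym.
have [s1 Hs1] := succ_exists S1; have [s2 Hs2] := succ_exists S2.
have E := succ_iso w (surg_succ Hs1 uv) (surg_succ Hs2 uv2).
have sE x : w (s1 x) = s2 (w x).
  have -> : s1 x = surg_perm u1 v1 s1 (if x == u1 then v1 else if x == v1 then u1 else x).
    exact: esym (surg_permK s1 u1 v1 x).
  have -> : s2 (w x) =
      surg_perm u2 v2 s2 (if w x == u2 then v2 else if w x == v2 then u2 else w x).
    exact: esym (surg_permK s2 u2 v2 (w x)).
  rewrite [w _]E wuE wvE; congr surg_perm.
  by case: (x == u1) => //; case: (x == v1).
have L := link_trans (link_trans (link_surg uv) (link_iso w)) (link_surg_sym uv2).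
have [psi [psi1 psi2]] := link_mciso L Hs1 Hs2 sE.
have psiE x : psi x = w x := psi1 x.
exists psi; split=> // k k' Ek'.
(* On components with points the claim holds because [psi] and [w] agree on points. *)
have point x : comp (x : surg u1 v1) = k -> eidx w k = k'.
  move=> xk; apply: val_inj; rewrite Ek' -xk -emb_comp.
  have := congr1 val (surg_emb_comp psi u1 v1 x).
  by rewrite /= !psiE wu wv.
case: (link_r (link_surg uv) k) => [[x]|[i ki]]; first exact: point.
case: (link_r (link_surg uv2) (eidx w k)) => [[y yk]|[i' ki']].
  have [h wh hw] := iso_bij w; apply: (point (h y)).
  by apply: (bij_inj (eidx_bij w)); rewrite -emb_comp hw.
apply: val_inj; rewrite Ek' ki ki' /=; congr inl; apply/esym.
by apply: psi2; exists (eidx w k) => //; exists k.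
Qed.

(** Fullness of an enlargement [X] of [S] means that a point can be inserted into
any component of [X] next to an existing one, even if it has no point in [S]. *)
Definition full (S : mcset) : Prop := forall i : idx S, exists x : S, comp x = i.

Lemma sub_exists (Y : mcset) (D : pred Y) :
  exists (S : mcset) (e : emb S Y), forall y, D y <-> exists x, e x = y.
Proof.
pose P : finType := {y : Y | D y}.
have cc (x y z : P) : cyc (val x) (val y) (val z) ->
    comp (val x) = comp (val y) /\ comp (val y) = comp (val z).
  exact: cyc_comp.
have tt i : total_cyclic [pred x : P | comp (val x) == i]
    (fun x y z => cyc (val x) (val y) (val z)).
  exact: (total_cyclic_sub val_inj _ _ (cyc_total i)).
pose S := @MCSet P (idx Y) (fun x => comp (val x)) _ (idx_gt0 Y) cc tt.
exists S, (@Emb S Y val id val_inj (inv_bij (fun=> erefl)) (fun=> erefl)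
  (fun _ _ _ => erefl)) => y.
split=> [yD|[x <-]]; last exact: (valP x).
by exists (exist _ y yD).
Qed.

(** A point is added to each component without points. *)
Lemma full_extension (S : mcset) : exists (X : mcset) (e : emb S X), full X.
Proof.
pose E : finType := {i : idx S | [forall x, comp x != i]}.
pose cp (x : S + E) : idx S := match x with inl y => comp y | inr k => val k end.
pose cy (x y z : S + E) :=
  match x, y, z with inl x, inl y, inl z => cyc x y z | _, _, _ => false end.
have cc x y z : cy x y z -> cp x = cp y /\ cp y = cp z.
  by case: x => x; case: y => y; case: z => z //; apply: cyc_comp.
have alone i (k : E) (y : S + E) : cp (inr k) == i -> cp y == i -> y = inr k.
  move=> /eqP <- /eqP; case: y => y /= => [yk|/val_inj->//].
  by have /forallP/(_ y) := valP k; rewrite yk eqxx.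
have tt i : total_cyclic [pred x | cp x == i] cy.
  have [H1 H2 H3 H4] := cyc_total i; split.
  - case=> x [] y [] z // xi yi zi; exact: (H1 x y z).
  - case=> x [] y [] z // xi yi zi; exact: (H2 x y z).
  - case=> x [] y [] z [] t // xi yi zi ti; exact: (H3 x y z t).
  - move=> x y z xi yi zi; case: (x) xi => [x'|k] xi.
    + case: (y) yi => [y'|k] yi.
        case: (z) zi => [z'|k] zi; first exact: (H4 x' y' z').
        by rewrite (alone _ _ _ zi yi) eqxx.
      by rewrite (alone _ _ _ yi xi) eqxx.
    + by rewrite (alone _ _ _ xi yi) eqxx.
pose X := @MCSet (S + E)%type (idx S) cp cy (idx_gt0 S) cc tt.
exists X, (@Emb S X inl id inl_inj (inv_bij (fun=> erefl)) (fun=> erefl)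
  (fun _ _ _ => erefl)) => i.
case: (pickP [pred x : S | comp x == i]) => [x /eqP xi|H]; first by exists (inl x).
have iE : [forall x : S, comp x != i] by apply/forallP => x; have /= -> := H x.
by exists (inr (exist _ i iE)).
Qed.

Section Insertion.
Variables (X : mcset) (p : X).

Definition ins_comp (x : option X) : idx X := comp (odflt p x).

(** Starting from the new point, which comes immediately after [p], one meets [x]
and then [y]. *)
Definition ins_at (x y : X) : bool :=
  [&& comp x == comp p, comp y == comp p & cut_lt p x y].

Definition ins_cyc (x y z : option X) : bool :=
  match x, y, z with
  | Some x, Some y, Some z => cyc x y z
  | None, Some x, Some y | Some y, None, Some x | Some x, Some y, None => ins_at x y
  | _, _, _ => false
  end.

Lemma ins_cyc_comp x y z : ins_cyc x y z ->
  ins_comp x = ins_comp y /\ ins_comp y = ins_comp z.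
Proof.
rewrite /ins_comp; case: x => [x|]; case: y => [y|]; case: z => [z|] //=;
  try exact: cyc_comp; by case/and3P => /eqP -> /eqP ->.
Qed.

Lemma ins_total i : total_cyclic [pred x | ins_comp x == i] ins_cyc.
Proof.
case: (eqVneq i (comp p)) => [->|ip]; last first.
  have Nn (x : option X) : ins_comp x == i -> exists2 y, x = Some y & comp y == i.
    by case: x => [y|]; [exists y | rewrite /ins_comp /= eq_sym (negbTE ip)].
  have [H1 H2 H3 H4] := cyc_total i; split.
  - move=> x y z; rewrite !inE => /Nn[x' -> xi] /Nn[y' -> yi] /Nn[z' -> zi]; exact: H1.
  - move=> x y z; rewrite !inE => /Nn[x' -> xi] /Nn[y' -> yi] /Nn[z' -> zi]; exact: H2.
  - move=> x y z t; rewrite !inE => /Nn[x' -> xi] /Nn[y' -> yi] /Nn[z' -> zi] /Nn[t' -> ti].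
    exact: H3.
  - move=> x y z; rewrite !inE => /Nn[x' -> xi] /Nn[y' -> yi] /Nn[z' -> zi].
    by rewrite !(inj_eq Some_inj); apply: H4.
(* The inserted point is the least element of the order cut at it *)
pose lt (x y : option X) := match x, y with
  | Some x, Some y => cut_lt p x y | None, Some _ => true | _, None => false end.
have L : total_cyclic [pred x | ins_comp x == comp p] (cyc_of_lt lt).
  apply: cyc_of_ltP.
  - by case=> [x|] //= _; rewrite cut_lt_irr.
  - move=> [y|] [x|] [z|] //= _ _ _; exact: cut_lt_trans.
  - move=> [x|] [y|] //=; rewrite !inE /ins_comp /= => /eqP xp /eqP yp.
    by rewrite (inj_eq Some_inj); apply: cut_lt_total.
apply: (total_cyclic_sub (@inj_id (option X)) _ _ L) => // x y z.
rewrite !inE /ins_comp; case: x => [x|]; case: y => [y|]; case: z => [z|] //=;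
  rewrite /ins_at /cyc_of_lt /= ?andbF ?andbT ?orbF //.
- by move=> /eqP xp /eqP yp /eqP zp; rewrite (@cyc_cut_lt _ p).
- by move=> -> ->.
- by move=> /eqP -> _ /eqP ->; rewrite eqxx.
- by move=> _ -> ->.
Qed.

Definition ins : mcset :=
  @MCSet (option X) (idx X) ins_comp ins_cyc (idx_gt0 X) ins_cyc_comp ins_total.

Definition ins_emb : emb X ins :=
  @Emb X ins Some id Some_inj (inv_bij (fun=> erefl)) (fun=> erefl) (fun _ _ _ => erefl).

Lemma full_ins : full X -> full ins.
Proof. by move=> HX i; have [x xi] := HX i; exists (Some x). Qed.
End Insertion.

(** Surgery connects [u] to the successor of [v], and [v] to that of [u]; thus the
gap which follows [u] goes to the circle of [v]. *)
Lemma ins_comp_first (X : mcset) (u v : X) : u != v ->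
  surg_comp (Some u : ins u) (Some v) None = surg_comp (Some u : ins u) (Some v) (Some v).
Proof.
move=> uv; apply: val_inj; rewrite /= /surg_raw /touched /= /ins_comp /= !eqxx /= ?orbT.
congr inr; rewrite /ins_at eqxx /cut_lt eqxx andbT /= eq_sym [v == u]eq_sym uv.
by case: eqP.
Qed.

Lemma ins_comp_second (X : mcset) (u v : X) : u != v ->
  surg_comp (Some u : ins v) (Some v) None = surg_comp (Some u : ins v) (Some v) (Some u).
Proof.
move=> uv; apply: val_inj; rewrite /= /surg_raw /touched /= /ins_comp /= !eqxx /= ?orbT.
congr inr; rewrite /ins_at /cut_lt !eqxx /= ?andbF (inj_eq Some_inj) (negbTE uv) /=.
congr orb; apply/esym/negP => /cyc_rot/cyc_rot; by rewrite cyc_irr.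
Qed.

Lemma ins_comp_far (X : mcset) (p u v : X) : p != u -> p != v ->
  surg_comp (Some u : ins p) (Some v) None = surg_comp (Some u : ins p) (Some v) (Some p).
Proof.
move=> pu pv; apply: val_inj; rewrite /= /surg_raw /touched /= /ins_comp /=.
case: ifP => // pt; congr inr; rewrite (inj_eq Some_inj) (negbTE pv) /=.
rewrite /ins_at /cut_lt [v == p]eq_sym pv [u == p]eq_sym (negbTE pu) /=.
case: eqP => //= uv.
apply/and3P/idP => [[_ _ /cyc_rot/cyc_rot//]|H].
by have [-> E] := cyc_comp H; rewrite -E eqxx (cyc_rot H).
Qed.

(** The predecessor of [w] on its circle. *)
Lemma last_before (W : mcset) (w : W) :
  (exists2 y, comp y = comp w & y != w) ->
  exists q, [/\ comp q = comp w, q != w &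
    forall z, comp z = comp w -> z != q -> z != w -> cyc q w z].
Proof.
case=> y0 yc yw; have y0P : (comp y0 == comp w) && (y0 != w) by rewrite yc eqxx.
case: (@arg_maxnP _ y0 [pred y | (comp y == comp w) && (y != w)] (cut_rank w) y0P).
move=> q /andP[/eqP qc qw] qmax; exists q; split=> // z zc zq zw.
have [eqE cycE wmax] := cyc_rankP w.
have := qmax z; rewrite /= zc eqxx zw => /(_ isT) => zle.
move: zle zq zw qw (wmax z zc) (wmax q qc).
by rewrite !eqE // cycE // /cyc_of_lt; lia.
Qed.

(** The image of the additional point [w] is inserted after the predecessor of
[w] or, if [w] is alone in its component, after any point of the corresponding
component of [X]. *)
Lemma amalgam1 (S X W : mcset) (e : emb S X) (j : emb S W) (w : W) :
  full X -> (forall y, y = w \/ exists x, j x = y) -> (forall x, j x != w) ->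
  exists (X' : mcset) (i : emb X X') (e' : emb W X'),
    [/\ full X', emb_cmp e' j = emb_cmp i e &
        forall y x, e' y = i x -> exists s, y = j s].
Proof.
move=> HX Hw wj.
have [ji jiK Kji] := eidx_bij j; have eI := bij_inj (eidx_bij e).
have jI := bij_inj (eidx_bij j).
(* The new point will be inserted after [p]. *)
have [p [pc pP]] : exists p : X, comp p = eidx e (ji (comp w)) /\
    forall x y, cyc w (j x) (j y) =
      [&& comp (e x) == comp p, comp (e y) == comp p & cut_lt p (e x) (e y)].
  case: (pickP [pred s : S | comp (j s) == comp w]) => [s0 /= /eqP s0w|H].
    have [|q [qc qw qP]] := @last_before W w.
      by exists (j s0) => //; apply: wj.
    have [qw'|[q0 q0E]] := Hw q; first by rewrite qw' eqxx in qw.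
    subst q; have pc : comp (e q0) = eidx e (ji (comp w)).
      by rewrite -qc !emb_comp jiK.
    exists (e q0); split=> // x y; rewrite pc !emb_comp !(inj_eq eI) -!(inj_eq jI).
    rewrite !Kji -!emb_comp.
    case: (eqVneq (comp (j x)) (comp w)) => [xc|xc] /=; last first.
      by apply/negP => /cyc_comp[xw _]; rewrite -xw eqxx in xc.
    case: (eqVneq (comp (j y)) (comp w)) => [yc|yc] /=; last first.
      by apply/negP => /cyc_comp[xw yw]; rewrite -yw -xw eqxx in yc.
    rewrite /cut_lt emb_cyc !(inj_eq (@epts_inj _ _ e)) -(emb_cyc j).
    rewrite -!(inj_eq (@epts_inj _ _ j)).
    have := qP _ xc; have := qP _ yc; have [eqE cycE wmax] := cyc_rankP w.
    rewrite !wj; move: (wj x) (wj y) qw (wmax _ xc) (wmax _ yc) (wmax _ qc).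
    rewrite !eqE // !cycE // /cyc_of_lt; lia.
  have [p pc] := HX (eidx e (ji (comp w))); exists p; split=> // x y.
  rewrite pc emb_comp (inj_eq eI) -(inj_eq jI) Kji -emb_comp.
  have /= -> := H x; apply/negP => /cyc_comp[/esym/eqP xw _].
  by have /= := H x; rewrite xw.
have /choice[j' Hj'] : forall y, exists o : option S,
    match o with Some x => j x = y | None => y = w end.
  by move=> y; case: (Hw y) => [->|[x <-]]; [exists None | exists (Some x)].
have j'j x : j' (j x) = Some x.
  have := Hj' (j x); case: (j' (j x)) => [y /(epts_inj (e := j))->//|E].
  by have := wj x; rewrite E eqxx.
have j'w : j' w = None.
  by have := Hj' w; case: (j' w) => [x E|//]; have := wj x; rewrite E eqxx.
pose e' (y : W) : ins p := omap e (j' y).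
have e'I : injective e'.
  move=> y z; rewrite /e'; have := Hj' y; have := Hj' z.
  case: (j' y) => [a|]; case: (j' z) => [b|] //= <- <-; last by [].
  by move=> [] /(epts_inj (e := e)) ->.
have hb : bijective (eidx e \o ji).
  by apply: bij_comp; [exact: eidx_bij | exists (eidx j)].
have e'c y : comp (e' y) = eidx e (ji (comp y)).
  case: (Hw y) => [->|[x <-]]; rewrite /e' ?j'w ?j'j; first exact: pc.
  by rewrite -[LHS]/(comp (e x)) !emb_comp jiK.
have e'cyc x y z : cyc (e' x) (e' y) (e' z) = cyc x y z.
  have rotE (T : mcset) (a b c : T) : cyc a b c = cyc b c a.
    by apply/idP/idP => [/cyc_rot//|/cyc_rot/cyc_rot].
  have one s t : cyc (e' w) (e' (j s)) (e' (j t)) = cyc w (j s) (j t).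
    by rewrite pP /e' j'w !j'j.
  have two (T : mcset) (a b : T) : cyc a a b = false by rewrite rotE rotE cyc_irr.
  case: (Hw x) => [->|[a <-]]; case: (Hw y) => [->|[b <-]]; case: (Hw z) => [->|[c <-]];
    rewrite ?two ?cyc_irr ?one //.
  - by rewrite [LHS]rotE [RHS]rotE !cyc_irr.
  - by rewrite [LHS]rotE [RHS]rotE one.
  - by rewrite [LHS]rotE [RHS]rotE [LHS]rotE [RHS]rotE one.
  - by rewrite /e' !j'j (emb_cyc j); apply: (emb_cyc e a b c).
exists (ins p), (ins_emb p), (@Emb W (ins p) e' _ e'I hb e'c e'cyc); split.
- exact: full_ins.
- by apply: emb_eq => x /=; rewrite ?/e' ?j'j ?jiK.
- by move=> y x /=; rewrite /e'; have := Hj' y; case: (j' y) => //= s <- _; exists s.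
Qed.

(** Embeddings have the amalgamation property, with no identification of points
outside [S]; the points of [W] are added one at a time. *)
Lemma amalgam (S X W : mcset) (e : emb S X) (j : emb S W) : full X ->
  exists (X' : mcset) (i : emb X X') (e' : emb W X'),
    [/\ full X', emb_cmp e' j = emb_cmp i e &
        forall y x, e' y = i x -> exists s, y = j s].
Proof.
have [n] := ubnP #|[pred y : W | [forall s, j s != y]]|.
elim: n S X e j => // n IH S X e j le_n HX.
case: (pickP [pred y : W | [forall s, j s != y]]) => [w /forallP wj|Hj]; last first.
  have jS y : exists s, j s = y.
    have /= /negbT := Hj y; rewrite negb_forall => /existsP[s /negPn/eqP <-].
    by exists s.
  have [phi Ephi] : exists phi : emb W S, emb_cmp j phi = emb_id W.
    by apply: emb_factor => y; have [s <-] := jS y; exists s.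
  exists X, (emb_id X), (emb_cmp e phi); split=> //.
    have Ej : emb_cmp phi j = emb_id S.
      apply: emb_eq => x.
        by apply: (epts_inj (e := j)); apply: (congr1 (fun k => epts k (j x)) Ephi).
      apply: (bij_inj (eidx_bij j)).
      exact: (congr1 (fun k => eidx k (eidx j x)) Ephi).
    apply: emb_eq => x /=.
      by congr (epts e _); apply: (congr1 (fun k => epts k x) Ej).
    by congr (eidx e _); apply: (congr1 (fun k => eidx k x) Ej).
  by move=> y x _; have [s <-] := jS y; exists s.
have [W1 [j1 Hj1]] := sub_exists [pred y : W | (y == w) || [exists s, j s == y]].
have [w1 Ew1] : exists x, j1 x = w by apply/Hj1; rewrite /= eqxx.
have [j0 Ej0] : exists j0 : emb S W1, emb_cmp j1 j0 = j.
  by apply: emb_factor => s; apply/Hj1 => /=; apply/orP; right; apply/existsP; exists s.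
have j0E s : j1 (j0 s) = j s by apply: (congr1 (fun k => epts k s) Ej0).
have [||X1 [i1 [e1 [HX1 E1 D1]]]] := @amalgam1 S X W1 e j0 w1 HX.
- move=> y; have /Hj1/= : exists x, j1 x = j1 y by exists y.
  case/orP => [/eqP yw|/existsP[s /eqP ys]]; [left | right].
    by apply: (epts_inj (e := j1)); rewrite yw Ew1.
  by exists s; apply: (epts_inj (e := j1)); rewrite j0E.
- move=> s; apply/eqP => E; have := wj s; rewrite -j0E E Ew1 eqxx //.
have [|X2 [i2 [e2 [HX2 E2 D2]]]] := IH W1 X1 e1 j1 _ HX1.
  apply: leq_trans (_ : #|[pred y : W | [forall s, j s != y]]| <= n); last exact: le_n.
  apply: proper_card; apply/properP; split.
    apply/subsetP => y; rewrite !inE => /forallP yj; apply/forallP => s.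
    by rewrite -j0E; apply: yj.
  exists w; rewrite !inE; first exact/forallP.
  by apply/negP => /forallP/(_ w1); rewrite Ew1 eqxx.
have e1E s : e1 (j0 s) = i1 (e s) by apply: (congr1 (fun k => epts k s) E1).
exists X2, (emb_cmp i2 i1), e2; split=> //.
- rewrite -Ej0; apply: emb_eq => x /=.
    have /= -> := congr1 (fun k => epts k (j0 x)) E2.
    by rewrite e1E.
  have /= -> := congr1 (fun k => eidx k (eidx j0 x)) E2.
  by congr (eidx i2 _); apply: (congr1 (fun k => eidx k x) E1).
- move=> y x /= E; have [s1 ys1] := D2 _ _ E; rewrite {}ys1 in E *.
  have /= E2' := congr1 (fun k => epts k s1) E2; rewrite E2' in E.
  have [s ->] := D1 s1 x (epts_inj E); by exists s; rewrite j0E.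
Qed.

(** * Contractions as arcs *)

Lemma card_surg (X : mcset) (u v : X) :
  #|idx (surg u v)| + (comp u != comp v) = #|idx X| + (comp u == comp v).
Proof. exact: card_mdel. Qed.

Lemma surg2_cast (S : mcset) (a b c d a1 b1 c1 d1 : S) :
  a = a1 -> b = b1 -> c = c1 -> d = d1 ->
  exists i : emb (@surg (surg c d) a b) (@surg (surg c1 d1) a1 b1), forall x, i x = x.
Proof. by move=> -> -> -> ->; exists (emb_id _). Qed.

Lemma emb_cmpA (S T U V : mcset) (h : emb U V) (g : emb T U) (k : emb S T) :
  emb_cmp h (emb_cmp g k) = emb_cmp (emb_cmp h g) k.
Proof. exact: emb_eq. Qed.

Lemma emb_cmp1 (S T : mcset) (g : emb S T) : emb_cmp g (emb_id S) = g.
Proof. exact: emb_eq. Qed.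

Lemma emb_1cmp (S T : mcset) (g : emb S T) : emb_cmp (emb_id T) g = g.
Proof. exact: emb_eq. Qed.

Lemma square_pts (S T T' U : mcset) (g : emb T U) (k : emb S T) (g' : emb T' U)
    (k' : emb S T') : emb_cmp g k = emb_cmp g' k' -> forall x, g (k x) = g' (k' x).
Proof. by move=> E x; apply: (congr1 (fun m => epts m x) E). Qed.

Lemma square_idx (S T T' U : mcset) (g : emb T U) (k : emb S T) (g' : emb T' U)
    (k' : emb S T') : emb_cmp g k = emb_cmp g' k' ->
  forall i, eidx g (eidx k i) = eidx g' (eidx k' i).
Proof. by move=> E i; apply: (congr1 (fun m => eidx m i) E). Qed.

Section Arcs.
Variables (Q : ns_mod_operad) (f : ns_cyc_mor ns_star_C (ns_box_ob Q)).
Notation gen := (gen f).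

(** [x] is a contraction of a generated element, presented by the two points of an
enlargement [X] of [S] where the contracted points appear after surgery: cutting
the surface along an arc from [u] to [v] undoes the contraction. *)
Definition arc (S X : mcset) g (e : emb S X) (u v : X) (x : nmod_at Q S g.+1) : Prop :=
  exists (T : mcset) (u0 v0 : T) (uv : u0 != v0) (y : nmod_at Q T g)
    (phi : mciso (mdel u0 v0) S) (eps : emb (surg u0 v0) X),
    [/\ gen y, x = nmod_act Q phi erefl (nmctr uv y), eps u0 = u, eps v0 = v &
        emb_cmp eps (del_surg u0 v0) = emb_cmp e phi].

Lemma arc_ext (S X X' : mcset) g (e : emb S X) (i : emb X X') (u v : X)
    (x : nmod_at Q S g.+1) : arc e u v x -> arc (emb_cmp i e) (i u) (i v) x.
Proof.
case=> T [u0 [v0 [uv [y [phi [eps [Hy Ex <- <- E]]]]]]].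
exists T, u0, v0, uv, y, phi, (emb_cmp i eps); split=> //.
by rewrite -emb_cmpA E emb_cmpA.
Qed.

(** The set before contraction has as many components as the result of surgery in
the enlargement. *)
Lemma arc_geometric (S X : mcset) g (e : emb S X) (u v : X) (x : nmod_at Q S g.+1) :
  arc e u v x -> geometric (surg u v) g.
Proof.
case=> T [u0 [v0 [uv [y [phi [eps [_ _ <- <- _]]]]]]].
have [w _] := surg_surg uv.
have [h Eh] := nmop_geometric y; exists h; rewrite Eh.
by rewrite -(bij_eq_card (eidx_bij w)) (bij_eq_card (eidx_bij (surg_emb eps u0 v0))).
Qed.

(** The two sets before contraction are recovered by surgery from the part
consisting of [S], [u] and [v] in [X], hence they are isomorphic; then uniqueness
in genus [g] applies. *)
Lemma arc_unique g :
  unique_at f g ->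
  forall (S X : mcset) (e : emb S X) (u v : X) (x x' : nmod_at Q S g.+1),
    arc e u v x -> arc e u v x' -> x = x'.
Proof.
move=> P S X e u v x x'.
case=> T1 [u1 [v1 [uv1 [y1 [phi1 [eps1 [H1 -> eu1 ev1 E1]]]]]]].
case=> T2 [u2 [v2 [uv2 [y2 [phi2 [eps2 [H2 -> eu2 ev2 E2]]]]]]].
have image (Ta Tb : mcset) (ua va : Ta) (ub vb : Tb) (pa : mciso (mdel ua va) S)
    (pb : mciso (mdel ub vb) S) (ea : emb (surg ua va) X) (eb : emb (surg ub vb) X) :
    ea ua = u -> ea va = v -> eb ub = u -> eb vb = v ->
    emb_cmp ea (del_surg ua va) = emb_cmp e pa -> emb_cmp eb (del_surg ub vb) = emb_cmp e pb ->
    forall t : surg ua va, exists t' : surg ub vb, eb t' = ea t.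
  move=> aua ava bub bvb Ea Eb t.
  case: (boolP ((t != ua) && (t != va))) => [tP|]; last first.
    rewrite negb_and !negbK => /orP[]/eqP->; first by exists ub; rewrite aua bub.
    by exists vb; rewrite ava bvb.
  pose s : mdel ua va := exist (fun z => is_true ((z != ua) && (z != va))) t tP.
  have [h _ hK] := iso_bij pb; exists (val (h (pa s))).
  have /= -> := square_pts Eb (h (pa s)).
  by rewrite hK; have /= <- := square_pts Ea s.
(* The results of both surgeries have the same image in [X]. *)
have [w Ew] : exists w : mciso (surg u1 v1) (surg u2 v2), emb_cmp eps2 w = eps1.
  by apply: emb_over; apply: image; eassumption.
have wE t : eps2 (w t) = eps1 t by exact: (congr1 (fun k => epts k t) Ew).
have wI k : eidx eps2 (eidx w k) = eidx eps1 k by exact: (congr1 (fun m => eidx m k) Ew).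
have wu : w u1 = u2 by apply: (epts_inj (e := eps2)); rewrite wE eu1 eu2.
have wv : w v1 = v2 by apply: (epts_inj (e := eps2)); rewrite wE ev1 ev2.
have [psi [psi1 psi2]] := surg_uncut uv1 wu wv.
have psiu : psi u1 = u2 by rewrite psi1.
have psiv : psi v1 = v2 by rewrite psi1.
have -> : y2 = nmod_act Q psi erefl y1 by apply: P => //; apply: gen_act.
apply/esym; apply: nmctr_transport => //.
  move=> z z' Ez; apply: (epts_inj (e := e)).
  have /= <- := square_pts E1 z; have /= <- := square_pts E2 z'.
  by rewrite Ez psi1 wE.
move=> k k' Ek; apply: (bij_inj (eidx_bij e)).
have /= <- := square_idx E1 k; have /= <- := square_idx E2 k'.
by rewrite -(psi2 _ _ Ek) wI.
Qed.

Lemma arc_flip (S X : mcset) g (e : emb S X) (u v : X) (x : nmod_at Q S g.+1) :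
  arc e u v x -> arc e v u x.
Proof.
case=> T [u0 [v0 [uv [y [phi [eps [Hy Ex eu ev E]]]]]]].
have vu : v0 != u0 by rewrite eq_sym.
have [chi [w [Hchi w1 Ew]]] := can_del_sym_exists vu.
exists T, v0, u0, vu, y, (@cmp MultCyc _ _ _ phi chi), (emb_cmp eps w); split=> //.
- rewrite Ex -(nmctr_sym vu uv y Hchi) nmod_act_cmp.
  by congr (nmod_act Q _ _ _).
- by rewrite /= w1.
- by rewrite /= w1.
- rewrite -emb_cmpA -Ew emb_cmpA E; exact: emb_eq.
Qed.

(** The set before contraction is the part consisting of [S], [u] and [v] in the
result of the surgery. *)
Lemma arc_exists g :
  exists_at f g ->
  forall (S X : mcset) (e : emb S X) (u v : X), u != v ->
    (forall s, e s != u) -> (forall s, e s != v) -> geometric (surg u v) g ->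
    exists x : nmod_at Q S g.+1, arc e u v x /\ gen x.
Proof.
move=> EX S X e u v uv eu ev [h Eh].
have [T [eta Heta]] := sub_exists
  [pred y : surg u v | [|| y == u, y == v | [exists s, e s == y]]].
have [u0 Eu] : exists t, eta t = u by apply/Heta; rewrite /= eqxx.
have [v0 Ev] : exists t, eta t = v by apply/Heta; rewrite /= eqxx orbT.
have etau t : (eta t == u) = (t == u0).
  by rewrite -[RHS](inj_eq (@epts_inj _ _ eta)) Eu.
have etav t : (eta t == v) = (t == v0).
  by rewrite -[RHS](inj_eq (@epts_inj _ _ eta)) Ev.
have [|y Hy] := EX T.
  by exists h; rewrite Eh (bij_eq_card (eidx_bij eta)).
have uv0 : u0 != v0 by apply: contra uv => /eqP E; rewrite -Eu E Ev.
have [w [w1 _]] := surg_surg uv.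
pose eps : emb (surg u0 v0) X :=
  emb_cmp w (emb_cmp (surg_cast Eu Ev) (surg_emb eta u0 v0)).
have epsE t : eps t = eta t by rewrite /= w1 surg_cast_pts.
have [phi Ephi] : exists phi : mciso (mdel u0 v0) S,
    emb_cmp e phi = emb_cmp eps (del_surg u0 v0).
  apply: emb_over => [z|s].
    have -> : emb_cmp eps (del_surg u0 v0) z = eta (val z) := epsE _.
    have /Heta/= : exists t, eta t = eta (val z) by exists (val z).
    have /andP[zu zv] := valP z.
    rewrite etau etav (negbTE zu) (negbTE zv).
    by case/existsP => s /eqP <-; exists s.
  have [t Et] : exists t, eta t = e s.
    by apply/Heta; rewrite /= (negbTE (eu s)) (negbTE (ev s)); apply/existsP; exists s.
  have tP : (t != u0) && (t != v0).
    by rewrite -etau -etav Et eu ev.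
  exists (exist (fun z => is_true ((z != u0) && (z != v0))) t tP).
  by rewrite -Et; apply: epsE.
exists (nmod_act Q phi erefl (nmctr uv0 y)); split; last first.
  by apply/gen_act/gen_ctr.
exists T, u0, v0, uv0, y, phi, eps; split; rewrite ?epsE ?Ephi //.
Qed.
End Arcs.

(** * Exchanging two arcs *)

(** Performing the two surgeries again, in the opposite order. *)
Lemma surg_undo2 (X : mcset) (u v c d : X) : u != v -> c != d ->
  exists i : emb (@surg (@surg (@surg (surg u v) c d) c d) u v) X, forall x, i x = x.
Proof.
move=> uv cd; have [w [w1 _]] := @surg_surg (surg u v) c d cd; have [w' [w1' _]] := surg_surg uv.
exists (emb_cmp w' (emb_cmp (surg_cast (S := surg u v) (w1 u) (w1 v)) (surg_emb w u v))) => x.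
by rewrite /= w1' surg_cast_pts w1.
Qed.

Section Part.
Variables (Y : mcset) (D : pred Y) (K : pred (idx Y)).
Definition part_idx : finType := {i : idx Y | K i}.
Hypothesis K0 : 0 < #|part_idx|.

Definition part_pts : finType := {y : Y | D y && K (comp y)}.

Lemma part_comp_subproof (y : part_pts) : K (comp (val y)).
Proof. by case/andP: (valP y). Qed.

Definition part_comp (y : part_pts) : part_idx :=
  exist _ (comp (val y)) (part_comp_subproof y).

Definition part_cyc (x y z : part_pts) : bool := cyc (val x) (val y) (val z).

Lemma part_cyc_comp x y z : part_cyc x y z ->
  part_comp x = part_comp y /\ part_comp y = part_comp z.
Proof. by case/cyc_comp => E1 E2; split; apply: val_inj. Qed.

Lemma part_total i : total_cyclic [pred x | part_comp x == i] part_cyc.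
Proof.
apply: (total_cyclic_sub val_inj _ _ (cyc_total (val i))) => // x.
Qed.

Definition part : mcset :=
  @MCSet part_pts part_idx part_comp part_cyc K0 part_cyc_comp part_total.
End Part.

(** The part [D] of [Y] is the disjoint union of its part in the component [k] and
of its part in the other components. *)
Lemma split_component (Y : mcset) (D : pred Y) (k : idx Y) : 1 < #|idx Y| ->
  exists (A B : mcset) (eta : emb (munion A B) Y),
    [/\ #|idx A| = 1, #|idx B| + 1 = #|idx Y|,
        forall y, D y <-> exists t, eta t = y,
        forall a, comp (eta (inl a)) = k & forall b, comp (eta (inr b)) != k].
Proof.
move=> Y1.
have cA : #|part_idx (pred1 k)| = 1 by rewrite card_sig card1.
have cB : #|part_idx (predC1 k)| + 1 = #|idx Y|.
  by rewrite card_sig addnC -(cardC (pred1 k)) card1; congr addn; apply: eq_card.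
have A0 : 0 < #|part_idx (pred1 k)| by rewrite cA.
have B0 : 0 < #|part_idx (predC1 k)| by lia.
pose A := part D A0; pose B := part D B0.
pose h (t : munion A B) : Y := match t with inl a => val a | inr b => val b end.
pose hi (i : idx (munion A B)) : idx Y := match i with inl a => val a | inr b => val b end.
have mixed (a : A) (b : B) : comp (val a) <> comp (val b).
  have /eqP -> := part_comp_subproof a; move=> E.
  by have /negP := part_comp_subproof b; rewrite -E /= eqxx.
have hI : injective h.
  move=> [x|x] [y|y] /= E; try by congr (_ _); apply: val_inj.
    by case: (mixed x y); apply: (congr1 comp E).
  by case: (mixed y x); apply: (congr1 comp (esym E)).
have hib : bijective hi.
  apply: inj_surj_bij.
    move=> [x|x] [y|y] /= E; try by congr (_ _); apply: val_inj.
      by have /negP := valP y; case; apply/eqP; rewrite -[val y]E (eqP (valP x)).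
    by have /negP := valP x; case; apply/eqP; rewrite [val x]E (eqP (valP y)).
  move=> i; case: (boolP (i == k)) => ik.
    by exists (inl (exist (fun i => is_true (pred1 k i)) i ik)).
  by exists (inr (exist (fun i => is_true (predC1 k i)) i ik)).
have hc t : comp (h t) = hi (comp t) by case: t.
have hcyc x y z : cyc (h x) (h y) (h z) = cyc x y z.
  case: x => x; case: y => y; case: z => z //=; apply/negP => /cyc_comp[E1 E2];
    by [case: (mixed _ _ E1) | case: (mixed _ _ E2) | case: (mixed _ _ (esym E1))
       | case: (mixed _ _ (esym E2))].
exists A, B, (@Emb _ _ h hi hI hib hc hcyc); split=> //.
- move=> y; split=> [yD|[[x|x] <-]]; last 2 first.
  + by case/andP: (valP x).
  + by case/andP: (valP x).
  case: (boolP (comp y == k)) => yk.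
    have yP : D y && pred1 k (comp y) by rewrite yD.
    by exists (inl (exist (fun y => is_true (D y && pred1 k (comp y))) y yP)).
  have yP : D y && predC1 k (comp y) by rewrite yD.
  by exists (inr (exist (fun y => is_true (D y && predC1 k (comp y))) y yP)).
- by move=> a; apply/eqP; apply: (part_comp_subproof a).
- by move=> b; apply: (part_comp_subproof b).
Qed.

Section Exchange.
Variables (Q : ns_mod_operad) (f : ns_cyc_mor ns_star_C (ns_box_ob Q)).
Notation gen := (gen f).
Notation arc := (arc f).

Section Pairs.
Variables (g : nat) (S X : mcset) (e : emb S X) (u v c d : X).
Hypothesis P : unique_at f g.
Hypotheses (uv : u != v) (cd : c != d) (uc : u != c) (ud : u != d) (vc : v != c)
  (vd : v != d).
Hypotheses (eu : forall s, e s != u) (ev : forall s, e s != v)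
  (ec : forall s, e s != c) (ed : forall s, e s != d).

Definition base_and_ends (y : X) : bool :=
  [|| y == u, y == v, y == c, y == d | [exists s, e s == y]].

(** [T] is the part consisting of [S] and the four ends in the result of both
surgeries, and [z1], [z2] arise by contracting, or composing along, one pair of ends.  If
contracting the remaining pair gives the same element in both orders, then this
is the element of each of the two arcs. *)
Lemma exchange (T : mcset) (eta : emb T (@surg (surg u v) c d)) (a b c0 d0 : T)
    (z1 : nmod_at Q (mdel c0 d0) g) (z2 : nmod_at Q (mdel a b) g) :
  (forall y, base_and_ends y <-> exists t, eta t = y) ->
  eta a = u -> eta b = v -> eta c0 = c -> eta d0 = d -> gen z1 -> gen z2 ->
  (forall (a' b' : mdel c0 d0) (c' d' : mdel a b),
     val a' = a -> val b' = b -> val c' = c0 -> val d' = d0 ->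
     forall (ab' : a' != b') (cd' : c' != d') (chi : mciso (mdel a' b') (mdel c' d')),
     can_del_del chi -> nmod_act Q chi erefl (nmctr ab' z1) = nmctr cd' z2) ->
  forall x y : nmod_at Q S g.+1, arc e u v x -> arc e c d y -> x = y.
Proof.
move=> im Ea Eb Ec Ed g1 g2 H x y Hx Hy.
have etaI := @epts_inj _ _ eta.
have tu t : (eta t == u) = (t == a) by rewrite -[RHS](inj_eq etaI) Ea.
have tv t : (eta t == v) = (t == b) by rewrite -[RHS](inj_eq etaI) Eb.
have tc t : (eta t == c) = (t == c0) by rewrite -[RHS](inj_eq etaI) Ec.
have td t : (eta t == d) = (t == d0) by rewrite -[RHS](inj_eq etaI) Ed.
have ab : a != b by rewrite -tv Ea.
have cd0 : c0 != d0 by rewrite -td Ec.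
have aP : (a != c0) && (a != d0) by rewrite -tc -td Ea uc.
have bP : (b != c0) && (b != d0) by rewrite -tc -td Eb vc.
have cP : (c0 != a) && (c0 != b).
  by rewrite ![c0 == _]eq_sym; case/andP: aP => ->; case/andP: bP => ->.
have dP : (d0 != a) && (d0 != b).
  by rewrite ![d0 == _]eq_sym; case/andP: aP => _ ->; case/andP: bP => _ ->.
pose a' : mdel c0 d0 := exist _ a aP; pose b' : mdel c0 d0 := exist _ b bP.
pose c' : mdel a b := exist _ c0 cP; pose d' : mdel a b := exist _ d0 dP.
have Va : val a' = a by []. have Vb : val b' = b by [].
have Vc : val c' = c0 by []. have Vd : val d' = d0 by [].
have [chi [w [Hchi w1 Ew]]] :=
  @can_del_del_exists T a b c0 d0 a' b' c' d' Va Vb Vc Vd ab cd0.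
have [w' [ww' w'w]] := iso_inv_exists w.
pose D1 := @deldel_surg T a b c0 d0 a' b' Va Vb.
pose D2 := @deldel_surg T c0 d0 a b c' d' Vc Vd.
have w'1 (t : T) : w' t = t.
  have E : epts (emb_cmp w' w) t = epts (emb_id (@surg (surg c0 d0) a b)) t by rewrite w'w.
  by move: E; rewrite /= w1.
have [i4 i4E] := surg_undo2 uv cd.
have [i5 i5E] := surg2_cast (S := @surg (surg u v) c d) Ea Eb Ec Ed.
pose eps : emb (@surg (surg c0 d0) a b) X :=
  emb_cmp i4 (emb_cmp i5 (surg_emb (surg_emb eta c0 d0) a b)).
have epsE t : eps t = eta t by rewrite /= i4E i5E.
have image (z : T) : z != a -> z != b -> z != c0 -> z != d0 -> exists s, e s = eta z.
  move=> za zb zc zd; have /im : exists t, eta t = eta z by exists z.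
  rewrite /base_and_ends tu tv tc td (negbTE za) (negbTE zb) (negbTE zc) (negbTE zd) /=.
  by case/existsP => s /eqP; exists s.
have preimage s : exists z, [/\ eta z = e s, z != a, z != b, z != c0 & z != d0].
  have [z Ez] : exists z, eta z = e s.
    by apply/im; rewrite /base_and_ends; do 4![apply/orP; right]; apply/existsP; exists s.
  by exists z; rewrite -tu -tv -tc -td Ez.
have [rho Erho] : exists rho : mciso (mdel a' b') S,
    emb_cmp e rho = emb_cmp eps D1.
  apply: emb_over => [z|s].
    rewrite -[epts (emb_cmp _ _) _]/(eps (D1 z)) epsE.
    by have [*] := @deldel_surg_notin T a b c0 d0 a' b' Va Vb z; apply: image.
  have [z [Ez za zb zc zd]] := preimage s.
  have [z' Ez'] := @deldel_surg_image T a b c0 d0 a' b' Va Vb z za zb zc zd.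
  by exists z'; rewrite -Ez -Ez' -epsE.
have [chi' [chi1 chi2]] := iso_inv_exists chi.
(* With this choice of [rho'] it remains to see that it lies over [X], as [rho] does. *)
pose rho' : mciso (mdel c' d') S := @cmp MultCyc _ _ _ rho chi'.
have Erho' : emb_cmp e rho' = emb_cmp (emb_cmp eps w') D2.
  have E1 : D1 = emb_cmp w' (emb_cmp D2 chi).
    by rewrite Ew emb_cmpA w'w emb_1cmp.
  rewrite -[LHS]/(emb_cmp e (emb_cmp rho chi')) emb_cmpA Erho E1 -!emb_cmpA chi1.
  by rewrite emb_cmp1.
have ab' : a' != b' by [].
have cd' : c' != d' by [].
have -> : x = nmod_act Q rho erefl (nmctr ab' z1).
  apply: (arc_unique P Hx).
  exists (mdel c0 d0), a', b', ab', z1, rho.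
  exists (emb_cmp eps (emb_cmp (surg_cast (S := surg c0 d0) Va Vb)
    (surg_emb (del_surg c0 d0) a' b'))).
  split=> //.
  - by rewrite -[LHS]/(eps (surg_cast (S := surg c0 d0) Va Vb a)) surg_cast_pts epsE.
  - by rewrite -[LHS]/(eps (surg_cast (S := surg c0 d0) Va Vb b)) surg_cast_pts epsE.
  - by rewrite Erho /D1 /D2 /deldel_surg !emb_cmpA.
have -> : y = nmod_act Q rho' erefl (nmctr cd' z2).
  apply: (arc_unique P Hy).
  exists (mdel a b), c', d', cd', z2, rho'.
  exists (emb_cmp (emb_cmp eps w') (emb_cmp (surg_cast (S := surg a b) Vc Vd)
    (surg_emb (del_surg a b) c' d'))).
  split=> //.
  - rewrite -[LHS]/(eps (w' (surg_cast (S := surg a b) Vc Vd c0))) surg_cast_pts w'1.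
    by rewrite epsE.
  - rewrite -[LHS]/(eps (w' (surg_cast (S := surg a b) Vc Vd d0))) surg_cast_pts w'1.
    by rewrite epsE.
  - by rewrite Erho' /D1 /D2 /deldel_surg !emb_cmpA.
rewrite -(H a' b' c' d' Va Vb Vc Vd ab' cd' chi Hchi) nmod_act_cmp.
congr (nmod_act Q _ _ _); apply: mciso_eq => z /=.
  by have /= -> := congr1 (fun k => epts k z) chi2.
by have /= -> := congr1 (fun k => eidx k z) chi2.
Qed.
End Pairs.
End Exchange.

Section Exchanges.
Variables (Q : ns_mod_operad) (f : ns_cyc_mor ns_star_C (ns_box_ob Q)).
Notation gen := (gen f).
Notation arc := (arc f).


(** Here the set before both contractions carries a generated element, and the
contractions commute. *)
Lemma exchange_ctr g (S X : mcset) (e : emb S X) (u v c d : X) (x y : nmod_at Q S g.+2) :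
  unique_at f g.+1 -> exists_at f g ->
  u != v -> c != d -> u != c -> u != d -> v != c -> v != d ->
  (forall s, e s != u) -> (forall s, e s != v) ->
  (forall s, e s != c) -> (forall s, e s != d) ->
  geometric (@surg (surg u v) c d) g ->
  arc e u v x -> arc e c d y -> x = y.
Proof.
move=> U EX uv cd uc ud vc vd eu ev ec ed [h Eh].
have [T [eta Heta]] := sub_exists (Y := @surg (surg u v) c d) (base_and_ends e u v c d).
have [a Ea] : exists t, eta t = u by apply/Heta; rewrite /base_and_ends eqxx.
have [b Eb] : exists t, eta t = v by apply/Heta; rewrite /base_and_ends eqxx !orbT.
have [c0 Ec] : exists t, eta t = c by apply/Heta; rewrite /base_and_ends eqxx !orbT.
have [d0 Ed] : exists t, eta t = d by apply/Heta; rewrite /base_and_ends eqxx !orbT.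
have [|z Hz] := EX T; first by exists h; rewrite Eh (bij_eq_card (eidx_bij eta)).
have ab : a != b by apply: contra uv => /eqP E; rewrite -Ea E Eb.
have cd0 : c0 != d0 by apply: contra cd => /eqP E; rewrite -Ec E Ed.
apply: (@exchange Q f g.+1 S X e u v c d U uv cd uc ud vc vd eu ev ec ed T eta a b c0 d0
  (nmctr cd0 z) (nmctr ab z) Heta Ea Eb Ec Ed).
- exact: gen_ctr.
- exact: gen_ctr.
move=> a' b' c' d' Va Vb Vc Vd ab' cd' chi.
exact: (nmctr_ctr Va Vb Vc Vd ab cd0 ab' cd' z).
Qed.

(** The circle of [u] after both surgeries is a planar piece, joined to the rest
by both pairs of ends; composing along one pair and contracting the other gives
the same element in both orders.  Unlike in [exchange_ctr], this requires no
element of lower genus over [Y], which may have too many components. *)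
Lemma exchange_comp g (S X : mcset) (e : emb S X) (u v c d : X) (x y : nmod_at Q S g.+1) :
  unique_at f g -> exists_at f g -> exists_at f 0 ->
  u != v -> c != d -> u != c -> u != d -> v != c -> v != d ->
  (forall s, e s != u) -> (forall s, e s != v) ->
  (forall s, e s != c) -> (forall s, e s != d) ->
  geometric (surg u v) g -> 
  surg_comp u v c = surg_comp u v d ->
  let Y := @surg (surg u v) c d in
  comp (c : Y) = comp (u : Y) -> comp (v : Y) != comp (u : Y) ->
  comp (d : Y) != comp (u : Y) ->
  arc e u v x -> arc e c d y -> x = y.
Proof.
move=> U EX EX0 uv cd uc ud vc vd eu ev ec ed [h Eh] cdE Y cu vu du.
have cardY : #|idx Y| = #|idx (surg u v)| + 1.
  by have := @card_surg (surg u v) c d; rewrite [comp _]cdE eqxx /= addn0.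
have Y1 : 1 < #|idx Y| by rewrite cardY addn1 ltnS (idx_gt0 (surg u v)).
have [A [B [eta [cA cB Heta HA HB]]]] :=
  @split_component Y (base_and_ends e u v c d) (comp (u : Y)) Y1.
have inA t : eta t = u \/ eta t = c -> exists a, t = inl a.
  case: t => [a|b]; first by exists a.
  by have := HB b => /[swap] -[] ->; rewrite ?cu eqxx.
have inB t : eta t = v \/ eta t = d -> exists b, t = inr b.
  case: t => [a|b]; last by exists b.
  have := HA a => /[swap] -[] -> E; [move: vu | move: du]; by rewrite E eqxx.
have [a Ea] : exists a, eta (inl a) = u.
  have [t Et] : exists t, eta t = u by apply/Heta; rewrite /base_and_ends eqxx.
  by have [a ta] := inA _ (or_introl Et); exists a; rewrite -ta.
have [c0 Ec] : exists a, eta (inl a) = c.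
  have [t Et] : exists t, eta t = c by apply/Heta; rewrite /base_and_ends eqxx !orbT.
  by have [a' ta] := inA _ (or_intror Et); exists a'; rewrite -ta.
have [b Eb] : exists b, eta (inr b) = v.
  have [t Et] : exists t, eta t = v by apply/Heta; rewrite /base_and_ends eqxx !orbT.
  by have [b tb] := inB _ (or_introl Et); exists b; rewrite -tb.
have [d0 Ed] : exists b, eta (inr b) = d.
  have [t Et] : exists t, eta t = d by apply/Heta; rewrite /base_and_ends eqxx !orbT.
  by have [b' tb] := inB _ (or_intror Et); exists b'; rewrite -tb.
have [|xA HxA] := EX0 A; first by exists 0; rewrite cA.
have [|xB HxB] := EX B; first by exists h; rewrite Eh; lia.
apply: (@exchange Q f g S X e u v c d U uv cd uc ud vc vd eu ev ec ed
  (munion A B) eta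
  (inl a) (inr b) (inl c0) (inr d0) (nmcomp c0 d0 xA xB) (nmcomp a b xA xB)
  Heta Ea Eb Ec Ed).
- exact: (gen_comp c0 d0 HxA HxB).
- exact: (gen_comp a b HxA HxB).
move=> a' b' c' d' Va Vb Vc Vd ab' cd' chi.
exact: (nmctr_comp Va Vb Vc Vd ab' cd' xA xB).
Qed.

Lemma exists_at0 : exists_at f 0.
Proof.
move=> S [h Eh]; have S1 : #|idx S| = 1 by have := idx_gt0 S; lia.
pose C : Cyc := exist _ S S1.
by exists (f C tt : nmod_at Q S 0); apply: (gen_in f C).
Qed.

(** If [S] has several components, the ends of the arc are inserted into two
different ones; otherwise both are inserted into the only one, which is possible
because the surface then has positive genus. *)
Lemma exists_atS g : exists_at f g -> exists_at f g.+1.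
Proof.
move=> EX S [h Eh]; have [X [e HX]] := full_extension S.
have [p [q pq]] : exists p q : X, (comp p != comp q) = (1 < #|idx S|).
  rewrite (bij_eq_card (eidx_bij e)).
  case: (ltnP 1 #|idx X|) => [/card_gt1P[i [j [_ _ ij]]]|X1].
    have [p pi] := HX i; have [q qj] := HX j; exists p, q; by rewrite pi qj.
  have /card_gt0P[i _] := idx_gt0 X; have [p pi] := HX i.
  by exists p, p; rewrite eqxx.
pose X1 := ins p; pose X2 := @ins X1 (Some q).
pose e2 : emb S X2 := emb_cmp (ins_emb (Some q : X1)) (emb_cmp (ins_emb p) e).
have cu : comp (Some None : X2) = comp p by [].
have cv : comp (None : X2) = comp q by [].
have [||||x [_ Hx]] := @arc_exists Q f g EX S X2 e2 (Some None) None; last by exists x.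
- by [].
- by [].
- by [].
have := @card_surg X2 (Some None) None; rewrite cu cv pq => E.
have EX2 : #|idx X2| = #|idx S| := esym (bij_eq_card (eidx_bij e)).
rewrite /geometric; have := idx_gt0 S.
move: E Eh; rewrite [#|idx X2|]EX2; case: (ltnP 1 #|idx S|) => b1.
  move=> E Eh; exists h; move: E; rewrite (negbTE (_ : comp p != comp q)) ?pq //; lia.
move=> E Eh; exists h.-1; move: E.
have -> : comp p == comp q by apply/negPn; rewrite pq -leqNgt.
move: b1 Eh; move: #|idx S| #|idx (@surg X2 _ _)| => n m.
by case: h => [|h]; rewrite ?doubleS ?double0 /=; lia.
Qed.

Lemma gen_exists g : exists_at f g.
Proof. by elim: g => [|g]; [exact: exists_at0 | exact: exists_atS]. Qed.
End Exchanges.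

(** * Any two arcs give the same element *)

(** [k] is a genus plus one, [n + 1] and [m] are the numbers of components left
by two surgeries on the same set, which are equal or differ by two. *)
Lemma genus_parity (n m k h : nat) (t : bool) :
  k = n + 1 + h.*2 -> m + ~~ t = n + t -> exists h', k = m + h'.*2.
Proof. by case: t => /= -> E; [exists h | exists h.+1]; rewrite ?doubleS; lia. Qed.

Section SurgeryComponents.
Variables (X : mcset) (u v : X).

Lemma surg_comp_refine (c d : X) : comp u = comp v ->
  surg_comp u v c = surg_comp u v d -> comp c = comp d.
Proof.
move=> uv /(congr1 val); rewrite /= /surg_raw /touched -uv !orbb eqxx /=.
by case: (eqVneq (comp c) (comp u)) => [->|_];
  case: (eqVneq (comp d) (comp u)) => [->|_] // [].
Qed.

(** Two components are identified by surgery only if they are those of [u] and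
[v]. *)
Lemma surg_comp_merge (c d : X) : comp u != comp v ->
  surg_comp u v c = surg_comp u v d -> comp c != comp d -> surg_comp u v c = surg_comp u v u.
Proof.
move=> uv /(congr1 val); rewrite /= /surg_raw => E cd; apply: val_inj => /=.
rewrite /surg_raw uv {2}/touched eqxx /=; move: E.
by case: ifP => // ct; case: ifP => // dt [E]; rewrite E eqxx in cd.
Qed.

Lemma surg_comp_split (c : X) : u != v -> comp u = comp v ->
  surg_comp u v u != surg_comp u v v /\
  (comp c = comp u -> surg_comp u v c = surg_comp u v u \/ surg_comp u v c = surg_comp u v v).
Proof.
move=> uv cuv; have uE : surg_raw u v u = inr false.
  rewrite /surg_raw /touched eqxx cuv eqxx (negbTE uv) /=; congr inr.
  by apply/negP => /cyc_rot/cyc_rot; rewrite cyc_irr.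
have vE : surg_raw u v v = inr true by rewrite /surg_raw /touched !eqxx ?orbT.
split; first by rewrite -(inj_eq val_inj) /= uE vE.
move=> cu; have : surg_raw u v c = inr false \/ surg_raw u v c = inr true.
  by rewrite /surg_raw /touched cu eqxx; case: [|| _, _ | _]; [right | left].
by case=> E; [left | right]; apply: val_inj; rewrite /= E ?uE ?vE.
Qed.
End SurgeryComponents.

Lemma surg_comp_emb (S T : mcset) (e : emb S T) (u v x y : S) :
  (surg_comp (e u) (e v) (e x) == surg_comp (e u) (e v) (e y)) =
  (surg_comp u v x == surg_comp u v y).
Proof. by rewrite !surg_emb_comp (inj_eq (bij_inj (mdel_eidx_bij e u v))). Qed.

Lemma comp_iso (S T : mcset) (w : mciso S T) (x y : S) :
  (comp (w x) == comp (w y)) = (comp x == comp y).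
Proof. by rewrite !emb_comp (inj_eq (bij_inj (eidx_bij w))). Qed.

(** The point is inserted after the end of the arc whose following gap goes to the
side of the arc where [c] is not ([ins_comp_first], [ins_comp_second]). *)
Lemma insert_opposite (X : mcset) (u v c : X) : u != v -> comp u = comp v ->
  exists w : X, (w == u) || (w == v) /\
    surg_comp (Some u : ins w) (Some v) None != surg_comp (Some u : ins w) (Some v) (Some c).
Proof.
move=> uv cuv; have [uv' _] := surg_comp_split c uv cuv.
have E w (x y : X) := surg_comp_emb (ins_emb w) u v x y.
case: (boolP (surg_comp u v v == surg_comp u v c)) => [/eqP vc|vc].
  exists v; rewrite eqxx orbT; split=> //; rewrite ins_comp_second //.
  by rewrite [_ == _]E -vc.
exists u; rewrite eqxx; split=> //; rewrite ins_comp_first //; by rewrite [_ == _]E.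
Qed.

Section Uniqueness.
Variables (Q : ns_mod_operad) (f : ns_cyc_mor ns_star_C (ns_box_ob Q)).
Notation gen := (gen f).
Notation arc := (arc f).

Section Step.
Variables (g : nat) (U : unique_at f g).

Lemma uniq4 (T : eqType) (u v c d : T) : uniq [:: u; v; c; d] ->
  [/\ u != v, c != d, u != c & u != d] /\ v != c /\ v != d.
Proof.
by rewrite /= !inE !negb_or => /and4P[/and3P[-> -> ->] /andP[-> ->] -> _].
Qed.

(** Surgery at [c], [d] decreases the number of components left by the surgery at
[u], [v], so that the remaining genus suffices for both contractions. *)
Lemma arc_step (S X : mcset) (e : emb S X) (u v c d : X) (x y : nmod_at Q S g.+1) :
  uniq [:: u; v; c; d] -> (forall s, e s \notin [:: u; v; c; d]) ->
  surg_comp u v c != surg_comp u v d -> arc e u v x -> arc e c d y -> x = y.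
Proof.
move=> /uniq4[[uv cd uc ud] [vc vd]] en ncd Hx Hy.
have [h Eh] := arc_geometric Hx.
have [m Em] : exists m, g + 1 = #|idx (@surg (surg u v) c d)| + 1 + m.*2.
  have := @card_surg (surg u v) c d; rewrite [comp _ == comp _](negbTE ncd) addn0 => E.
  by exists h; rewrite E.
have Y0 := idx_gt0 (@surg (surg u v) c d).
have notin w : w \in [:: u; v; c; d] -> forall s, e s != w.
  by move=> wI s; apply: contraNneq (en s) => ->.
case: g U x y Hx Hy Em {Eh} => [|g'] U' x y Hx Hy Em; first by exfalso; move: Em Y0; lia.
apply: (exchange_ctr U' (@gen_exists Q f g') uv cd uc ud vc vd _ _ _ _ _ Hx Hy);
  try (by apply: notin; rewrite !inE eqxx ?orbT).
by exists m; move: Em; lia.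
Qed.

Lemma arc_eq (S X : mcset) (e : emb S X) (u v c d : X) (x y : nmod_at Q S g.+1) :
  uniq [:: u; v; c; d] -> (forall s, e s \notin [:: u; v; c; d]) ->
  arc e u v x -> arc e c d y -> x = y.
Proof.
move=> un en Hx Hy; have [[uv cd uc ud] [vc vd]] := uniq4 un.
case: (eqVneq (surg_comp u v c) (surg_comp u v d)) => [cdT|ncd]; last first.
  exact: arc_step un en ncd Hx Hy.
have pe : perm_eq [:: c; d; u; v] [:: u; v; c; d].
  exact: permEl (perm_catC [:: c; d] [:: u; v]).
case: (eqVneq (surg_comp c d u) (surg_comp c d v)) => [uvT|nuv]; last first.
  apply/esym; apply: arc_step nuv Hy Hx.
    by rewrite (perm_uniq pe).
  by move=> s; rewrite (perm_mem pe).
have notin w : w \in [:: u; v; c; d] -> forall s, e s != w.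
  by move=> wI s; apply: contraNneq (en s) => ->.
have [eu ev ec ed] : [/\ forall s, e s != u, forall s, e s != v,
    forall s, e s != c & forall s, e s != d].
  by split; apply: notin; rewrite !inE eqxx ?orbT.
case: (eqVneq (comp u) (comp v)) => [cuv|ncuv]; last first.
  (* Each arc joins the two components joined by the other one. *)
  have ncd : comp c != comp d.
    by apply: contra ncuv => /eqP E; apply/eqP; apply: surg_comp_refine E uvT.
  have cuT : surg_comp u v c = surg_comp u v u := surg_comp_merge ncuv cdT ncd.
  have [w [w1 _]] := surg_commute uv cd uc ud vc vd.
  have nuvY : comp (u : @surg (surg u v) c d) != comp (v : @surg (surg u v) c d).
    have [H _] := @surg_comp_split (surg c d) u v u uv uvT.
    by have := comp_iso w u v; rewrite !w1 => ->.
  have [ncdY /(_ (esym cuT)) uY] := @surg_comp_split (surg u v) c d u cd cdT.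
  have Gx := arc_geometric Hx.
  (* After both surgeries the circle of [u] contains exactly one of [c] and [d];
     if this is [d], the second arc is reversed. *)
  case: uY => uY.
    apply: (exchange_comp U (@gen_exists Q f g) (@gen_exists Q f 0) uv cd uc ud vc vd
      eu ev ec ed Gx cdT _ _ _ Hx Hy).
    - exact: esym uY.
    - by rewrite eq_sym.
    - apply: contra ncdY => /eqP E; apply/eqP; exact: etrans (esym uY) (esym E).
  have dc : d != c by rewrite eq_sym.
  have [w' [w1' _]] := @surg_flip (surg u v) c d cd.
  have flip (p q : X) : (comp (p : @surg (surg u v) d c) == comp (q : @surg (surg u v) d c)) =
      (comp (p : @surg (surg u v) c d) == comp (q : @surg (surg u v) c d)).
    by have := comp_iso w' p q; rewrite !w1'.
  apply: (exchange_comp U (@gen_exists Q f g) (@gen_exists Q f 0) uv dc ud uc vd vc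
      eu ev ed ec Gx (esym cdT) _ _ _ Hx (arc_flip Hy)).
  - by apply/eqP; rewrite flip eq_sym; apply/eqP.
  - by rewrite flip eq_sym.
  - rewrite flip; apply: contra ncdY => /eqP E; apply/eqP; exact: etrans E uY.
(* Both arcs return to the component where they start, and do not cross. The
   ends of a third arc, from [p] to [q], are separated by surgery at each of them. *)
have ccd : comp c = comp d := surg_comp_refine cuv cdT.
have [wu [wuP wuc]] := insert_opposite c uv cuv.
pose X1 := ins wu; pose i1 := ins_emb wu; pose p1 : X1 := None.
have cd1 : i1 c != i1 d by [].
have [w2 [w2P w2c]] := @insert_opposite X1 (i1 c) (i1 d) (i1 u) cd1 ccd.
pose X2 := ins w2; pose i2 := ins_emb w2; pose q : X2 := None.
pose i := emb_cmp i2 i1; pose p : X2 := i2 p1.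
have wuE : wu != c /\ wu != d by case/orP: wuP => /eqP->.
have w2E : w2 != i1 u /\ w2 != i1 v.
  by case/orP: w2P => /eqP->; split; rewrite eq_sym (inj_eq (@epts_inj _ _ i1)).
have uvpq : surg_comp (i u) (i v) p != surg_comp (i u) (i v) q.
  have -> : surg_comp (i u) (i v) q = surg_comp (i u) (i v) (i2 w2).
    by apply: ins_comp_far; case: w2E.
  have -> : surg_comp (i u) (i v) (i2 w2) = surg_comp (i u) (i v) (i c).
    have i2w : i2 w2 = i c \/ i2 w2 = i d.
      by case/orP: w2P => /eqP E; [left | right]; apply: (congr1 i2 E).
    apply/eqP; case: i2w => ->; first exact: eqxx.
    by rewrite [_ == _](surg_comp_emb i) eq_sym; apply/eqP.
  by rewrite [_ == _](surg_comp_emb i2).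
have cdpq : surg_comp (i c) (i d) p != surg_comp (i c) (i d) q.
  have E : surg_comp (i c) (i d) p = surg_comp (i c) (i d) (i u).
    apply/eqP; rewrite [_ == _](surg_comp_emb i2).
    have -> : surg_comp (i1 c) (i1 d) p1 = surg_comp (i1 c) (i1 d) (i1 wu).
      by apply: ins_comp_far; case: wuE.
    rewrite [_ == _](surg_comp_emb i1).
    have wuE' : surg_comp c d wu = surg_comp c d u by case/orP: wuP => /eqP->.
    by rewrite wuE'.
  by rewrite E eq_sym.
have pq : p != q by [].
have ep s : emb_cmp i e s != p by [].
have eq s : emb_cmp i e s != q by [].
have Gpq : geometric (surg p q) g.
  have [h Eh] := arc_geometric Hx.
  have := @card_surg X u v; rewrite cuv eqxx addn0 => Euv.
  have [t Et] : exists t : bool, #|idx (surg p q)| + ~~ t = #|idx X2| + t.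
    by exists (comp p == comp q); apply: card_surg.
  have EX2 : #|idx X2| = #|idx X| := esym (bij_eq_card (eidx_bij i)).
  apply: (genus_parity (n := #|idx X|) (h := h) (t := t)); last by rewrite -EX2.
  by rewrite Eh Euv.
have [z [Hz _]] := arc_exists (@gen_exists Q f g) pq ep eq Gpq.
have -> : x = z.
  apply: arc_step uvpq (arc_ext i Hx) Hz.
    by rewrite /= !inE !negb_or /= (inj_eq Some_inj) (inj_eq Some_inj) uv.
  by move=> s; rewrite !inE !negb_or /= !(inj_eq Some_inj) eu ev.
apply/esym; apply: arc_step cdpq (arc_ext i Hy) Hz.
  by rewrite /= !inE !negb_or /= (inj_eq Some_inj) (inj_eq Some_inj) cd.
by move=> s; rewrite !inE !negb_or /= !(inj_eq Some_inj) ec ed.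
Qed.
End Step.

(** Two contractions over [S] are arcs in a common enlargement of [S], with
distinct ends. *)
Lemma gen_unique g : unique_at f g.
Proof.
elim: g => [|g U]; first exact: gen0_unique.
move=> S x y /genS_contracted[T1 [u1 [v1 [uv1 [x1 [phi1 [G1 E1]]]]]]].
move=> /genS_contracted[T2 [u2 [v2 [uv2 [x2 [phi2 [G2 E2]]]]]]].
have [psi1 [ps1 sp1]] := iso_inv_exists phi1.
have [psi2 [ps2 sp2]] := iso_inv_exists phi2.
have [X0 [e0 H0]] := full_extension S.
have [X1 [i1 [f1 [H1 F1 D1]]]] := amalgam e0 (emb_cmp (del_surg u1 v1) psi1) H0.
have [X2 [i2 [f2 [H2 F2 D2]]]] :=
  amalgam (emb_cmp i1 e0) (emb_cmp (del_surg u2 v2) psi2) H1.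
pose e := emb_cmp i2 (emb_cmp i1 e0).
have Ax : arc e (i2 (f1 u1)) (i2 (f1 v1)) x.
  apply: arc_ext; exists T1, u1, v1, uv1, x1, phi1, f1; split=> //.
  by rewrite -F1 -!emb_cmpA sp1 emb_cmp1.
have Ay : arc e (f2 u2) (f2 v2) y.
  exists T2, u2, v2, uv2, x2, phi2, f2; split=> //.
  by rewrite /e -F2 -!emb_cmpA sp2 emb_cmp1.
have new2 t w : (t == u2) || (t == v2) -> f2 t != i2 w.
  move=> tP; apply/eqP => /D2[s ts]; move: tP.
  by case/andP: (valP (psi2 s)); rewrite ts /= => /negbTE -> /negbTE ->.
have new1 t s : (t == u1) || (t == v1) -> f1 t != i1 s.
  move=> tP; apply/eqP => /D1[s' ts]; move: tP.
  by case/andP: (valP (psi1 s')); rewrite ts /= => /negbTE -> /negbTE ->.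
have I2 := @epts_inj _ _ i2.
apply: (arc_eq U _ _ Ax Ay).
  rewrite /= !inE !negb_or (inj_eq I2) (inj_eq (@epts_inj _ _ f1)) uv1.
  rewrite (inj_eq (@epts_inj _ _ f2)) uv2.
  by do 2![rewrite eq_sym new2 ?eqxx ?orbT // eq_sym new2 ?eqxx ?orbT //=].
move=> s; rewrite !inE !negb_or /= !(inj_eq I2).
by apply/and4P; split; rewrite eq_sym ?new1 ?new2 ?eqxx ?orbT.
Qed.
End Uniqueness.

(** * The envelopes of the terminal operads *)

(** Uniqueness of generated elements makes their choice compatible with all
operations. *)
Lemma ns_star_M_extends (Q : NsModOp) (f : hom ns_star_C (ns_Box Q)) :
  exists m : hom ns_star_M Q, forall t : hom ns_star_C (ns_Box ns_star_M),
    cmp (fmap ns_Box m) t = f.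
Proof.
pose F (S : mcset) g (H : geometric S g) : nmod_at Q S g := sval (cid (gen_exists f H)).
have FP S g (H : geometric S g) : gen f (F S g H) := svalP (cid (gen_exists f H)).
have FE S g (H : geometric S g) x : gen f x -> F S g H = x.
  by move=> Gx; apply: gen_unique (FP S g H) Gx.
unshelve eexists.
  unshelve eexists.
  - exists (fun X => match X return ns_star_M X -> Q X with
                     | (V, g) => fun x => F V g (svalP x) end).
    case=> S g [T h] [phi e]; apply: functional_extensionality_dep => x /=.
    exact/FE/gen_act/FP.
  - by move=> S' S'' g' g'' u v x y /=; apply/FE/gen_comp; apply: FP.
  - by move=> S g u v uv x /=; apply/FE/gen_ctr/FP.
move=> t; apply: ns_cyc_mor_eq => C [] /=.
exact: FE (gen_in f C).
Qed.

Theorem theorem35 :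
  (forall Mod : functor CycOp ModOp,
     left_adjoint Mod Box -> isomorphic (Mod star_C) star_M) /\
  (forall nsMod : functor NsCycOp NsModOp,
     left_adjoint nsMod ns_Box -> isomorphic (nsMod ns_star_C) ns_star_M).
Proof.
split=> F adjF; apply: (left_adjoint_iso adjF).
- exact: star_M_terminal.
- exact: star_M_extends.
- exact: ns_star_M_terminal.
- exact: ns_star_M_extends.
Qed.
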